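(* Let $(\gamma,\nu):I\to\mathbb{R}^2\times S^1$ be a Legendre curve with curvature $(\ell,\beta)$, $\gamma(u)=(x(u),z(u))$, $\nu(u)=(a(u),b(u))$, let $u_0\in I$ with $x(u_0)=0$, let $\lambda\neq0$ be a constant and $r(u,v)=(x(u)\cos v,x(u)\sin v,z(u)+\lambda v)$. Then: (I) If $\beta(u_0)=0$, $x(u_0)=0$, $b(u_0)\neq0$, then for any $v$, $r$ is a $5/2$-cuspidal edge at $(u_0,v)$ if and only if $\dot\beta(u_0)\ell(u_0)\neq0$. In this case (i.e. under these hypotheses), $r$ at $(u_0,v)$ is never a cuspidal edge, a $4/3$-cuspidal edge nor a $5/3$-cuspidal edge. (II) If $\beta(u_0)\neq0$, $(x(u_0),b(u_0))=(0,0)$, then for any $v$, $r$ is a $3/2$-cuspidal edge at $(u_0,v)$ if and only if $\ell(u_0)\neq0$, and $r$ is a $4/3$-cuspidal edge at $(u_0,v)$ if and only if $\ell(u_0)=0$ and $\dot\ell(u_0)\neq0$. In this case, $r$ at $(u_0,v)$ is never a $5/2$-cuspidal edge nor a $5/3$-cuspidal edge. (III) If $\beta(u_0)=0$, $(x(u_0),b(u_0))=(0,0)$, then for any $v$, $r$ is a $5/3$-cuspidal edge at $(u_0,v)$ if and only if $\dot\beta(u_0)\ell(u_0)\neq0$. In this case, $r$ at $(u_0,v)$ is never a cuspidal edge, a $5/2$-cuspidal edge nor a $4/3$-cuspidal edge.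
   Context: A Legendre curve is a smooth $(\gamma,\nu):I\to\mathbb{R}^2\times S^1$ with $\dot\gamma\cdot\nu=0$; with $\mu=J\nu$ ($J$ anticlockwise rotation by $\pi/2$), its curvature is $(\ell,\beta)$ with $\ell=\dot\nu\cdot\mu$, $\beta=\dot\gamma\cdot\mu$; so $\dot x=-\beta b$, $\dot z=\beta a$, $\dot a=-\ell b$, $\dot b=\ell a$. Two map-germs $f:(\mathbb{R}^m,p)\to(\mathbb{R}^n,f(p))$, $g:(\mathbb{R}^m,q)\to(\mathbb{R}^n,g(q))$ are $\mathcal{A}$-equivalent if there are diffeomorphism-germs $\varphi:(\mathbb{R}^m,p)\to(\mathbb{R}^m,q)$ and $\Phi:(\mathbb{R}^n,f(p))\to(\mathbb{R}^n,g(q))$ with $g\circ\varphi=\Phi\circ f$. For $(i,j)\in\{(2,3),(2,5),(3,4),(3,5)\}$, a surface germ $f$ at a point is a $j/i$-cuspidal edge if it is $\mathcal{A}$-equivalent to $(u,v)\mapsto(u,v^i,v^j)$ at the origin; a $3/2$-cuspidal edge is also called a cuspidal edge. *)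

(* Defs.v *)
From HB Require Import structures.
From mathcomp Require Import all_boot all_order all_algebra.
From mathcomp Require Import all_classical all_reals all_analysis.
Set Implicit Arguments. Unset Strict Implicit. Unset Printing Implicit Defensive.
Import Order.TTheory GRing.Theory Num.Theory.
Import numFieldNormedType.Exports.
Local Open Scope classical_set_scope.
Local Open Scope ring_scope.

Section Smooth.
Variables (R : realType) (V W : normedModType R).

Definition iterD (vs : seq V) (f : V -> W) : V -> W :=
  foldr (fun v g => 'D_v g) f vs.

Definition smooth_on (U : set V) (f : V -> W) : Prop :=
  forall (vs : seq V) (x : V), U x ->
    {for x, continuous (iterD vs f)} /\ (forall v, derivable (iterD vs f) x v).

Definition smooth_at (p : V) (f : V -> W) : Prop :=
  exists U : set V, [/\ open U, U p & smooth_on U f].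
End Smooth.

Section Diffeo.
Variables (R : realType) (M : normedModType R).

Definition diffeo_germ (phi : M -> M) (p q : M) : Prop :=
  [/\ phi p = q, smooth_at p phi &
    exists psi : M -> M, [/\ psi q = p, smooth_at q psi,
       (\forall y \near p, psi (phi y) = y) &
       (\forall y \near q, phi (psi y) = y)]].

End Diffeo.

Section Germs.
Variables (R : realType) (M N : normedModType R).

Definition A_equiv (f : M -> N) (p : M) (g : M -> N) (q : M) : Prop :=
  exists (phi : M -> M) (Phi : N -> N),
    [/\ diffeo_germ phi p q, diffeo_germ Phi (f p) (g q) &
        \forall y \near p, g (phi y) = Phi (f y)].
End Germs.

Section Cusp.
Variable R : realType.

Definition cusp_model (i j : nat) : R * R -> R * R * R :=
  fun p => (p.1, p.2 ^+ i, p.2 ^+ j).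

Definition cuspidal_edge (j i : nat) (f : R * R -> R * R * R) (p : R * R) : Prop :=
  A_equiv f p (cusp_model i j) 0.

Definition legendre (I : set R) (x z a b : R -> R) : Prop :=
  [/\ smooth_on I x, smooth_on I z, smooth_on I a & smooth_on I b] /\
  (forall u, I u -> a u ^+ 2 + b u ^+ 2 = 1) /\
  (forall u, I u -> derive1 x u * a u + derive1 z u * b u = 0).

(* curvature (ell, beta) with mu = J nu = (-b, a) *)
Definition curv_ell (a b : R -> R) : R -> R :=
  fun u => derive1 a u * - b u + derive1 b u * a u.
Definition curv_beta (x z a b : R -> R) : R -> R :=
  fun u => derive1 x u * - b u + derive1 z u * a u.

Definition helicoidal (x z : R -> R) (lam : R) : R * R -> R * R * R :=
  fun p => (x p.1 * cos p.2, x p.1 * sin p.2, z p.1 + lam * p.2).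
End Cusp.

(* Main.v *)
(** The screw motion of angle [w / lam] and height [w] straightens [r]: up to
    A-equivalence [r] at [(u0, v)] is the product of a line with the planar curve
    [c = (x cos zeta, - x sin zeta)], where [zeta = (z - z u0) / lam].

    Sufficiency: after a reparametrization [c = (s^i, h s)], and [h] is split along the
    residues of the exponent modulo [i] with coefficients smooth in [s^i].  This Whitney
    type decomposition comes from Borel's theorem (in Peano's form), which reduces it to
    flat functions, and these may be composed with [i]-th roots freely.  Diffeomorphisms
    of the target then remove everything but [s^j]; for [i = 3] the remaining gap term is
    absorbed by [X + k Y] and a quadratic change of [Y].

    Necessity: intersecting the surface with the plane [Z = z u0 + lam * v] turns an
    equivalence with the [j/i]-cuspidal edge into a function [q] comparable with [t] such
    that [q^i] and [q^j] are smooth functions of [c] with independent linear parts.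
    Comparing orders of vanishing at [u0], computed from the structure equations of the
    Legendre curve, excludes every pair [(i, j)] but the right one. *)

Require Import Defs.
From HB Require Import structures.
From mathcomp Require Import all_boot all_order all_algebra.
From mathcomp Require Import all_classical all_reals all_analysis.
From mathcomp Require Import ring lra zify.
Import Order.TTheory GRing.Theory Num.Theory.
Import numFieldNormedType.Exports.
Local Open Scope classical_set_scope.
Local Open Scope ring_scope.

(** Germs are handled through iterated Fréchet differentiability ([smg]), where the chain rule makes
    composition an induction; the iterated directional derivatives of the statement are converted to
    it, and back, only where diffeomorphisms enter or leave. The obstacle in the sufficiency part is
    that an i-th root is not smooth at 0. A flat [F] absorbs this defect: if [theta] is the root,
    the derivative of [F (theta) / theta^k] is again a flat function of [theta] over a power of
    [theta]. The gap term exists because 3 and 4 do not generate the exponent 5, and 3 and 5 do not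
    generate 7. With [j = 3 + e] the missing exponent is [j + e], and such a term is not a function
    of [s^3] and [s^j], so no change of the target alone removes it. In the necessity part few
    Taylor monomials survive because the second component of [c] carries the extra factor
    [sin zeta]. The square of the first component has to be kept: in case (I) it has order four when
    [beta'] is nonzero, the second component has order at least four, and [ell] shows only in their
    combination at order five. *)

(** * Smooth real functions as iterated Fréchet differentiability *)

Section SmoothFunctions.
Variable R : realType.
Implicit Types V W : normedModType R.

Lemma differentiable_bound {V W} (f : V -> W) (x : V) (df : {linear V -> W}) :
  continuous df ->
  (forall e : R, 0 < e -> \forall h \near (0 : V),
     `|f (h + x) - f x - df h| <= e * `|h|) ->
  differentiable f x /\ 'd f x = df :> (V -> W).
Proof.
move=> cdf H.
have e : f \o shift x = cst (f x) + df +o_ (0 : V) id.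
  apply/eqaddoP => e e0; apply: filterS (H e e0) => h /=.
  by rewrite !fctE /= opprD addrA.
have E := diff_unique cdf e; split => //.
by apply/diff_locallyP; rewrite E.
Qed.

Lemma differentiable_boundP {V W} (f : V -> W) (x : V) : differentiable f x ->
  forall e : R, 0 < e -> \forall h \near (0 : V),
     `|f (h + x) - f x - 'd f x h| <= e * `|h|.
Proof.
move=> /diff_locallyP [_ /eqaddoP H] e e0; apply: filterS (H e e0) => h /=.
by rewrite !fctE /= opprD addrA.
Qed.

Lemma near_shift0 {V} (x : V) (P : set V) :
  (\forall y \near x, P y) -> \forall h \near (0 : V), P (h + x).
Proof. by rewrite (near_shift 0 x) subr0. Qed.

Lemma near_eq_differentiable {V W} (f g : V -> W) (x : V) : {near x, f =1 g} ->
  differentiable f x -> differentiable g x.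
Proof.
move=> fg df; have E := nbhs_singleton fg.
apply: (proj1 (@differentiable_bound _ _ g x ('d f x) _ _)) => [|e e0].
  exact: diff_continuous.
have := differentiable_boundP _ _ df e e0.
have : \forall h \near (0 : V), f (h + x) = g (h + x).
  exact: near_shift0 fg.
by apply: filterS2 => h /= -> ; rewrite E.
Qed.

(** Fréchet differentiability is required at each level because directional derivatives alone do not
    satisfy the chain rule. The finite level [n] is what the closure lemmas are proved by induction
    on. *)
Fixpoint diff_n {V} (n : nat) (U : set V) (f : V -> R) : Prop :=
  if n is m.+1 then (forall x, U x -> differentiable f x) /\
                    (forall v, diff_n m U ('D_v f))
  else True.

Definition sm {V} (U : set V) (f : V -> R) := forall n, diff_n n U f.

Definition smg {V} (p : V) (f : V -> R) := exists U, [/\ open U, U p & sm U f].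

Lemma diff_n_le {V} (U : set V) n m f : (m <= n)%N -> diff_n n U f -> diff_n m U f.
Proof.
elim: n m f => [|n IH] [|m] f //= mn [df Df]; split=> // v; exact: IH.
Qed.

Lemma diff_nS {V} (U : set V) n f : diff_n n.+1 U f -> diff_n n U f.
Proof. exact: diff_n_le. Qed.

Lemma diff_n_sub {V} (U W : set V) n f : W `<=` U -> diff_n n U f -> diff_n n W f.
Proof.
move=> WU; elim: n f => //= n IH f [df Df]; split=> [x /WU/df //|v]; exact: IH.
Qed.

Lemma eq_diff_n {V} (U : set V) n f g : open U -> (forall x, U x -> f x = g x) ->
  diff_n n U f -> diff_n n U g.
Proof.
move=> oU; elim: n f g => //= n IH f g fg [df Df].
have fgn x : U x -> {near x, f =1 g}.
  by move=> Ux; apply: filterS fg _; exact: open_nbhs_nbhs.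
split=> [x Ux|v].
  exact: near_eq_differentiable (fgn x Ux) (df x Ux).
by apply: IH (Df v) => x Ux; apply: near_eq_derive; exact: fgn.
Qed.

Lemma diff_n_cst {V} (U : set V) n (c : R) : open U -> diff_n n U (cst c).
Proof.
move=> oU; elim: n c => //= n IH c; split=> [x _|v]; first exact: differentiable_cst.
by apply: eq_diff_n oU _ (IH 0) => x _; rewrite derive_cst.
Qed.

Lemma diff_n_lin {V} (U : set V) n (l : {linear V -> R}) : open U ->
  continuous l -> diff_n n U l.
Proof.
move=> oU cl; case: n => //= n; split=> [x _|v]; first exact: linear_differentiable.
apply: eq_diff_n oU _ (diff_n_cst _ n (l v) oU) => x _.
by rewrite deriveE ?diff_lin//; exact: linear_differentiable.
Qed.

Lemma diff_nD {V} (U : set V) n f g : open U ->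
  diff_n n U f -> diff_n n U g -> diff_n n U (fun x => f x + g x).
Proof.
move=> oU; elim: n f g => //= n IH f g [df Df] [dg Dg].
split=> [x Ux|v]; first exact: differentiableD (df x Ux) (dg x Ux).
apply: eq_diff_n oU _ (IH _ _ (Df v) (Dg v)) => x Ux.
by rewrite (@deriveD _ _ _ f g) //; apply: diff_derivable; [exact: df|exact: dg].
Qed.

Lemma diff_nM {V} (U : set V) n f g : open U ->
  diff_n n U f -> diff_n n U g -> diff_n n U (fun x => f x * g x).
Proof.
move=> oU; elim: n f g => //= n IH f g /[dup] Sf [df Df] /[dup] Sg [dg Dg].
split=> [x Ux|v]; first exact: differentiableM (df x Ux) (dg x Ux).
have := diff_nD U n _ _ oU (IH _ _ (diff_nS _ _ _ Sf) (Dg v))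
  (IH _ _ (diff_nS _ _ _ Sg) (Df v)).
apply: eq_diff_n oU _ => x Ux.
by rewrite (@deriveM _ _ f g) //; apply: diff_derivable; [exact: df|exact: dg].
Qed.

(** Induction with [h] and [f] generalised: the derivative is [h' (f x)] times ['D_v f x], and the
    hypothesis at the lower level applies to [h'] and [f]. *)
Lemma diff_n_comp {V} (U : set V) (U' : set R) n (h : R -> R) (f : V -> R) :
  open U -> open U' -> (forall x, U x -> U' (f x)) ->
  diff_n n U' h -> diff_n n U f -> diff_n n U (fun x => h (f x)).
Proof.
move=> oU oU' UU'; elim: n h f UU' => //= n IH h f UU' [dh Dh] /[dup] Sf [df Df].
split=> [x Ux|v].
  by apply: (differentiable_comp (df x Ux)); exact/dh/UU'.
have S1 := IH _ _ UU' (Dh 1) (diff_nS _ _ _ Sf).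
apply: eq_diff_n oU _ (diff_nM U n _ _ oU S1 (Df v)) => x Ux.
have d1 := df x Ux; have d2 := dh _ (UU' _ Ux).
rewrite !deriveE //; last exact: differentiable_comp.
rewrite (diff_comp d1 d2) /= -[X in _ = 'd h (f x) X]mulr1.
by rewrite [RHS]linearZ mulrC.
Qed.

Lemma diff_n_comp2 {V} (U : set V) (U' : set (R * R)) n (h : R * R -> R)
    (f g : V -> R) :
  open U -> open U' -> (forall x, U x -> U' (f x, g x)) ->
  diff_n n U' h -> diff_n n U f -> diff_n n U g ->
  diff_n n U (fun x => h (f x, g x)).
Proof.
move=> oU oU' UU'; elim: n h f g UU' => //= n IH h f g UU' [dh Dh]
  /[dup] Sf [df Df] /[dup] Sg [dg Dg].
have dfg x : U x -> differentiable (fun x => (f x, g x)) x.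
  by move=> Ux; apply: differentiable_pair; [exact: df|exact: dg].
split=> [x Ux|v].
  by apply: (differentiable_comp (dfg x Ux)); exact/dh/UU'.
have S1 := IH _ _ _ UU' (Dh (1, 0)) (diff_nS _ _ _ Sf) (diff_nS _ _ _ Sg).
have S2 := IH _ _ _ UU' (Dh (0, 1)) (diff_nS _ _ _ Sf) (diff_nS _ _ _ Sg).
apply: eq_diff_n oU _ (diff_nD U n _ _ oU (diff_nM U n _ _ oU S1 (Df v))
  (diff_nM U n _ _ oU S2 (Dg v))) => x Ux.
have d1 := dfg x Ux; have d2 := dh _ (UU' _ Ux).
rewrite !deriveE //; [|exact: differentiable_comp|exact: dg|exact: df].
rewrite (diff_comp d1 d2) /= diff_pair /=; [|exact: df|exact: dg].
set a := 'd f x v; set b := 'd g x v.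
have -> : (a, b) = a *: ((1, 0) : R * R) + b *: ((0, 1) : R * R).
  by congr pair; rewrite /= /GRing.scale /= ?mulr1 ?mulr0 ?addr0 ?add0r.
by rewrite linearD !linearZ /= mulrC; congr (_ + _); rewrite mulrC.
Qed.
End SmoothFunctions.

(** * Closure properties of smooth germs and the elementary functions *)

Section SmoothGerms.
Variable R : realType.
Implicit Types V : normedModType R.

Lemma smg_near {V} (p : V) (f : V -> R) : smg R p f -> \forall y \near p, smg R y f.
Proof.
move=> [U [oU Up sU]]; near=> y; exists U; split => //; near: y.
exact: open_nbhs_nbhs.
Unshelve. all: by end_near. Qed.

Lemma smg_eq {V} (p : V) (f g : V -> R) : {near p, f =1 g} -> smg R p f -> smg R p g.
Proof.
move=> fg [U [oU Up sU]]; exists (U `&` (fun x => f x = g x)°); split.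
- by apply: openI => //; exact: open_interior.
- by split => //.
move=> n; apply: (eq_diff_n R _ n f).
- by apply: openI => //; exact: open_interior.
- by move=> x [_ /interior_subset].
- apply: diff_n_sub (sU n); exact: subIsetl.
Qed.

Lemma eq_smg {V} (p : V) (f g : V -> R) : (forall x, f x = g x) -> smg R p f -> smg R p g.
Proof. by move=> /funext ->. Qed.
Arguments eq_smg {V p f g}.
Arguments smg_eq {V p f g}.

Lemma smg_differentiable {V} (p : V) (f : V -> R) : smg R p f -> differentiable f p.
Proof. by move=> [U [oU Up /(_ 1%N)[+ _]]]; exact. Qed.

Lemma smg_continuous {V} (p : V) (f : V -> R) : smg R p f -> {for p, continuous f}.
Proof. by move=> /smg_differentiable; exact: differentiable_continuous. Qed.

Lemma smg_derive {V} (p v : V) (f : V -> R) : smg R p f -> smg R p ('D_v f).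
Proof. by move=> [U [oU Up sU]]; exists U; split=> // n; exact: (sU n.+1).2. Qed.

Lemma smg_derive1 (p : R) (f : R -> R) : smg R p f -> smg R p (derive1 f).
Proof.
move=> /(smg_derive p 1); apply: eq_smg.
by move=> x; rewrite derive1E.
Qed.

Lemma smg_is_derive (p : R) (f : R -> R) : smg R p f -> is_derive p 1 f (derive1 f p).
Proof.
move=> /smg_differentiable /derivable1_diffP d; rewrite derive1E.
exact: derivableP.
Qed.

Lemma smg_cst {V} (p : V) (c : R) : smg R p (fun _ => c).
Proof.
exists setT; split => //; first exact: openT.
by move=> n; apply: diff_n_cst; exact: openT.
Qed.

Lemma smgD {V} (p : V) (f g : V -> R) :
  smg R p f -> smg R p g -> smg R p (fun x => f x + g x).
Proof.
move=> [U [oU Up sU]] [U' [oU' Up' sU']]; have oI := openI oU oU'.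
exists (U `&` U'); split => // n.
apply: diff_nD => //; [apply: diff_n_sub (sU n)|apply: diff_n_sub (sU' n)].
  exact: subIsetl.
exact: subIsetr.
Qed.

Lemma smgM {V} (p : V) (f g : V -> R) :
  smg R p f -> smg R p g -> smg R p (fun x => f x * g x).
Proof.
move=> [U [oU Up sU]] [U' [oU' Up' sU']]; have oI := openI oU oU'.
exists (U `&` U'); split => // n.
apply: diff_nM => //; [apply: diff_n_sub (sU n)|apply: diff_n_sub (sU' n)].
  exact: subIsetl.
exact: subIsetr.
Qed.

Lemma smgN {V} (p : V) (f : V -> R) : smg R p f -> smg R p (fun x => - f x).
Proof.
move=> /(smgM p (fun=> -1) _ (smg_cst p (-1))); apply: eq_smg.
by move=> x; rewrite mulN1r.
Qed.

Lemma smgB {V} (p : V) (f g : V -> R) :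
  smg R p f -> smg R p g -> smg R p (fun x => f x - g x).
Proof. by move=> sf sg; apply: smgD => //; exact: smgN. Qed.

Lemma smgX {V} (p : V) (f : V -> R) n : smg R p f -> smg R p (fun x => f x ^+ n).
Proof.
move=> sf; elim: n => [|n IH].
  by apply: eq_smg _ (smg_cst p 1) => x; rewrite expr0.
by apply: eq_smg _ (smgM p _ _ sf IH) => x; rewrite exprS.
Qed.

Lemma smg_sum {V} (p : V) (I : Type) (r : seq I) (f : I -> V -> R) :
  (forall i, smg R p (f i)) -> smg R p (fun x => \sum_(i <- r) f i x).
Proof.
move=> sf; elim: r => [|i r IH].
  by apply: eq_smg _ (smg_cst p 0) => x; rewrite big_nil.
by apply: eq_smg _ (smgD p _ _ (sf i) IH) => x; rewrite big_cons.
Qed.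

Lemma smg_lin {V} (p : V) (l : {linear V -> R}) : continuous l -> smg R p l.
Proof.
move=> cl; exists setT; split => //; first exact: openT.
by move=> n; apply: diff_n_lin => //; exact: openT.
Qed.

Lemma smg_id (p : R) : smg R p id.
Proof. by apply: (@smg_lin _ p idfun) => x; exact: cvg_id. Qed.

Lemma smg_comp {V} (p : V) (h : R -> R) (f : V -> R) :
  smg R (f p) h -> smg R p f -> smg R p (fun x => h (f x)).
Proof.
move=> [U' [oU' Up' sU']] /[dup] /smg_continuous cf [U [oU Up sU]].
have pW : (U `&` f @^-1` U')° p.
  apply: filterI; first exact: open_nbhs_nbhs.
  by apply: cf; exact: open_nbhs_nbhs.
exists (U `&` f @^-1` U')°; split => //; first exact: open_interior.
move=> n; apply: (diff_n_comp R _ U') => //; first exact: open_interior.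
  by move=> x /interior_subset[].
by apply: diff_n_sub (sU n) => x /interior_subset[].
Qed.

Lemma smg_comp2 {V} (p : V) (h : R * R -> R) (f g : V -> R) :
  smg R (f p, g p) h -> smg R p f -> smg R p g -> smg R p (fun x => h (f x, g x)).
Proof.
move=> [U' [oU' Up' sU']] /[dup] /smg_differentiable cf [U [oU Up sU]].
move=> /[dup] /smg_differentiable cg [W [oW Wp sW]].
pose fg x := (f x, g x).
have cfg : {for p, continuous fg} by exact/differentiable_continuous/differentiable_pair.
have pW : (U `&` W `&` fg @^-1` U')° p.
  apply: filterI; first by apply: filterI; exact: open_nbhs_nbhs.
  by apply: cfg; exact: open_nbhs_nbhs.
exists (U `&` W `&` fg @^-1` U')°; split => //; first exact: open_interior.
move=> n; apply: (diff_n_comp2 R _ U') => //; first exact: open_interior.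
- by move=> x /interior_subset[].
- by apply: diff_n_sub (sU n) => x /interior_subset[[]].
- by apply: diff_n_sub (sW n) => x /interior_subset[[]].
Qed.

Lemma smg_fst (p : R * R) : smg R p fst.
Proof. by apply: (@smg_lin _ p fst) => x; exact: cvg_fst. Qed.

Lemma smg_snd (p : R * R) : smg R p snd.
Proof. by apply: (@smg_lin _ p snd) => x; exact: cvg_snd. Qed.

Lemma smg_fst3 (p : R * R * R) : smg R p (fun x => x.1.1).
Proof.
apply: (@smg_lin _ p (fst \o fst)) => x.
by apply: continuous_comp; exact: cvg_fst.
Qed.

Lemma smg_snd3 (p : R * R * R) : smg R p (fun x => x.1.2).
Proof.
apply: (@smg_lin _ p (snd \o fst)) => x.
by apply: continuous_comp; [exact: cvg_fst|exact: cvg_snd].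
Qed.

Lemma smg_thd3 (p : R * R * R) : smg R p snd.
Proof. by apply: (@smg_lin _ p snd) => x; exact: cvg_snd. Qed.

Lemma diff_n_derive1 (U : set R) n (f g : R -> R) : open U ->
  (forall x, U x -> is_derive x 1 f (g x)) -> diff_n R n U g -> diff_n R n.+1 U f.
Proof.
move=> oU fg Dg; split=> [x Ux|v].
  by apply/derivable1_diffP; have [] := fg x Ux.
apply: (eq_diff_n R _ _ (fun x => cst v x * g x)) => //; last first.
  by apply: diff_nM => //; exact: diff_n_cst.
move=> x Ux; have [d e] := fg x Ux.
move/derivable1_diffP: d => d; rewrite deriveE //.
by rewrite -[v in RHS]mulr1 [RHS]linearZ /= -e deriveE.
Qed.

(** A class of functions closed under differentiation consists of smooth functions. This gives
    smoothness of [cos] and of Borel's series without formulas for higher derivatives. *)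
Lemma sm_coind (U : set R) (C : (R -> R) -> Prop) : open U ->
  (forall f, C f -> exists g, C g /\ forall x, U x -> is_derive x 1 f (g x)) ->
  forall f, C f -> sm R U f.
Proof.
move=> oU H f Cf n; elim: n f Cf => [//|n IH] f /H [g [Cg fg]].
by apply: diff_n_derive1 fg _ => //; exact: IH.
Qed.

(** A solution of [f' = F (f)] gains one derivative at each round. It is applied to [expR], to the
    inverse ([F y = - y^2]) and to local inverse functions. *)
Lemma sm_ode (U U' : set R) (f F : R -> R) : open U -> open U' ->
  (forall x, U x -> U' (f x)) -> sm R U' F ->
  (forall x, U x -> is_derive x 1 f (F (f x))) -> sm R U f.
Proof.
move=> oU oU' UU' sF fF; elim => [//|n IH].
apply: diff_n_derive1 fF _ => //.
exact: (diff_n_comp R _ U').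
Qed.

Lemma smg_cos (p : R) : smg R p cos.
Proof.
exists setT; split => //; first exact: openT.
apply: (sm_coind _ (fun f => exists c d : R, f = (fun x => c * cos x + d * sin x))).
- exact: openT.
- move=> _ [c [d ->]]; exists (fun x => d * cos x + (- c) * sin x); split.
    by exists d, (- c).
  move=> x _; apply: is_derive_eq.
  by rewrite /GRing.scale /=; ring.
- by exists 1, 0; apply/funext => x; ring.
Qed.

Lemma smg_sin (p : R) : smg R p sin.
Proof.
have /(smgN _ _) := smg_derive1 p _ (smg_cos p).
by apply: eq_smg => x; rewrite derive1E derive_val opprK.
Qed.

Lemma smg_expR (p : R) : smg R p expR.
Proof.
exists setT; split => //; first exact: openT.
apply: (sm_ode _ setT _ id) => //; try exact: openT.
by move=> n; apply: (diff_n_lin R _ _ idfun) => [|x]; [exact: openT|exact: cvg_id].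
Qed.

Lemma smg_inv (p : R) : p != 0 -> smg R p GRing.inv.
Proof.
move=> p0; exists [set x | x != 0]; split => //.
apply: (sm_ode _ setT _ (fun y => - y ^+ 2)) => //.
- exact: openT.
- move=> n; apply: (@diff_n_sub R R setT) => //.
  apply: (@eq_diff_n R R _ _ (fun y : R => (-1) * (y * y))).
  + exact: openT.
  + by move=> x _; ring.
  + have o := @openT R; have i : diff_n R n setT (@idfun R) by apply: diff_n_lin => // x; exact: cvg_id.
    by apply: diff_nM => //; [exact: diff_n_cst|exact: diff_nM].
- move=> x /= x0; apply: is_derive_eq; first exact: is_deriveV.
  by rewrite /GRing.scale /= exprVn mulr1.
Qed.

Lemma smgV {V} (p : V) (f : V -> R) : f p != 0 -> smg R p f -> smg R p (fun x => (f x)^-1).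
Proof. by move=> f0; apply: smg_comp; exact: smg_inv. Qed.

Lemma smg_of_derive (p : R) (f g : R -> R) :
  (\forall x \near (p : R), is_derive (x : R) 1 f (g x)) -> smg R p g -> smg R p f.
Proof.
move=> fg [U [oU Up sU]]; exists (U `&` (fun x : R => is_derive x 1 f (g x))°).
have oI : open (U `&` (fun x : R => is_derive x 1 f (g x))°).
  by apply: openI => //; exact: open_interior.
split => // n; apply: diff_nS; apply: (diff_n_derive1 _ _ _ g) => //.
  by move=> x [_ /interior_subset].
by apply: diff_n_sub (sU n) => x [].
Qed.

Lemma smg_ln (p : R) : 0 < p -> smg R p (@ln R).
Proof.
move=> p0; apply: (smg_of_derive _ _ GRing.inv); last by apply: smg_inv; rewrite gt_eqF.
near=> x; apply: is_derive1_ln; near: x.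
exact: (@open_nbhs_nbhs _ _ [set x : R | 0 < x] (conj (@open_gt R 0) p0)).
Unshelve. all: by end_near. Qed.

(** The value on the closed negative half-line is 0 even for odd [i]; cube roots of negative numbers
    are recovered later by reflection. *)
Definition root (i : nat) (x : R) : R := if 0 < x then expR (ln x / i%:R) else 0.

Lemma smg_root i (p : R) : 0 < p -> smg R p (root i).
Proof.
move=> p0; apply: (@smg_eq _ _ (fun x => expR (ln x * i%:R^-1))).
  by near=> x; rewrite /root ifT //; near: x; exact: (@open_nbhs_nbhs _ _ [set x : R | 0 < x] (conj (@open_gt R 0) p0)).
apply: (@smg_comp _ _ expR); first exact: smg_expR.
apply: smgM; first exact: smg_ln p0.
exact: smg_cst.
Unshelve. all: by end_near. Qed.

Lemma rootK i (x : R) : (0 < i)%N -> 0 < x -> root i x ^+ i = x.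
Proof.
move=> i0 x0; rewrite /root x0 -expRM_natl mulrC divfK ?lnK ?posrE //.
by rewrite pnatr_eq0 -lt0n.
Qed.

Lemma root_gt0 i (x : R) : 0 < x -> 0 < root i x.
Proof. by move=> x0; rewrite /root x0 expR_gt0. Qed.
End SmoothGerms.

(** * The mean value theorem and local inverses on the line *)

Section InverseFunction.
Variable R : realType.

Lemma near_le (p : R) (P : set R) : (\forall x \near p, P x) ->
  exists2 d : R, 0 < d & forall x, `|x - p| <= d -> P x.
Proof.
move=> /nbhs_ballP [d /= d0 H]; exists (d / 2); first by rewrite divr_gt0.
move=> x xd; apply: H; rewrite /ball /= distrC.
by apply: le_lt_trans xd _; rewrite ltr_pdivrMr// ltr_pMr// ltr1n.
Qed.

Lemma lt_near (p d : R) (P : set R) : 0 < d ->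
  (forall x, `|x - p| < d -> P x) -> \forall x \near p, P x.
Proof.
move=> d0 H; apply/nbhs_ballP; exists d => //= x xd.
by apply: H; rewrite distrC.
Qed.

(** The points [x] and [y] come in either order, and [c] is located from both ends by absolute
    values, so that callers need no case distinction on signs. *)
Lemma mean_value (f df : R -> R) (p d : R) :
  (forall x, `|x - p| <= d -> is_derive x 1 f (df x)) ->
  forall x y, `|x - p| <= d -> `|y - p| <= d ->
  exists c, [/\ `|c - p| <= d, `|c - x| <= `|y - x|, `|c - y| <= `|y - x|
              & f y - f x = df c * (y - x)].
Proof.
move=> H x y; wlog xy : x y / x <= y.
  move=> W xd yd; have [xy|yx] := leP x y; first exact: W.
  have [c [cd cx cy e]] := W _ _ (ltW yx) yd xd.
  by exists c; split; rewrite // 1?[`|y - x|]distrC // -opprB e -mulrN opprB.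
move=> xd yd.
have cd z : x <= z <= y -> `|z - p| <= d.
  move=> /andP[xz zy]; rewrite ler_norml; move: xd yd; rewrite !ler_norml.
  move=> /andP[? ?] /andP[? ?]; apply/andP; split; lra.
have [] := @MVT_segment R f df x y xy.
- by move=> z /[!in_itv] /= /andP[xz zy]; apply: H; apply: cd; rewrite !ltW.
- apply/continuous_in_subspaceT => z; rewrite inE /= in_itv /= => zz.
  by apply/differentiable_continuous/derivable1_diffP; have [] := H z (cd z zz).
- move=> c; rewrite in_itv /= => /[dup] xcy /andP[xc cy] e; exists c; split => //.
  + exact: cd.
  + by rewrite !ger0_norm ?subr_ge0 // lerB.
  + by rewrite distrC !ger0_norm ?subr_ge0 // lerB.
Qed.

(** The mean value theorem gives injectivity on a ball where the derivative does not vanish. The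
    inverse satisfies [g' = 1 / f' (g)], so [sm_ode] makes it smooth. *)
Lemma smg_inverse (f : R -> R) (p : R) : smg R p f -> derive1 f p != 0 ->
  exists g : R -> R, [/\ smg R (f p) g, g (f p) = p,
    \forall x \near p, g (f x) = x & \forall y \near f p, f (g y) = y].
Proof.
move=> sf f0; have sf' := smg_derive1 _ _ _ sf.
have nd : \forall x \near p, is_derive (x : R) 1 f (derive1 f x) /\ derive1 f x != 0.
  have nz : \forall x \near p, derive1 f x != 0.
    exact: (smg_continuous _ _ _ sf' _ (open_nbhs_nbhs (conj (@open_neq R 0) f0))).
  by apply: filterS2 (smg_near _ _ _ sf) nz => x sx ?; split => //; exact: smg_is_derive.
have [d d0 H] := near_le _ _ nd.
have inj x y : `|x - p| <= d -> `|y - p| <= d -> f x = f y -> x = y.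
  move=> xd yd fxy.
  have [c [cd _ _]] := mean_value _ _ _ _ (fun x xd => (H x xd).1) _ _ xd yd.
  move/eqP; rewrite fxy subrr eq_sym mulf_eq0 (negbTE (H c cd).2) subr_eq0 => /eqP.
  by move->.
(* The preimage inside the ball is chosen; [p] is the default where there is none. *)
pose g y := xget p [set x | `|x - p| <= d /\ f x = y].
have gK x : `|x - p| <= d -> g (f x) = x.
  move=> xd; rewrite /g; case: xgetP => [z _ /= [zd e]|/(_ x) /=].
    exact: inj.
  by case.
have gKn : {near p, cancel f g} by apply: (lt_near _ d) => // x /ltW; exact: gK.
have cfn : {near p, continuous f}.
  by apply: filterS (smg_near _ _ _ sf) => x; exact: smg_continuous.
have [cg fgn] := near_can_continuousAcan_sym gKn cfn.
have gp : g (f p) = p by apply: gK; rewrite subrr normr0 ltW.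
exists g; split => //.
have sF : smg R p (fun x => (derive1 f x)^-1) by exact: smgV.
have [U' [oU' U'p sU']] := sF.
have cgp : {for f p, continuous g} by exact: nbhs_singleton cg.
have ng (P : set R) : (\forall x \near p, P x) -> \forall y \near f p, P (g y).
  by move=> HP; apply: (cgp P); rewrite gp.
have gd : \forall y \near f p, is_derive (y : R) 1 g (derive1 f (g y))^-1 /\ U' (g y).
  have n1 := ng _ (near_join gKn); have n2 := ng _ (near_join cfn).
  have n3 := ng _ nd; have n4 := ng _ (open_nbhs_nbhs (conj oU' U'p)).
  near=> y; have fgy : f (g y) = y by near: y.
  split; last by near: y.
  have [dy fy0] : is_derive (g y) 1 f (derive1 f (g y)) /\ derive1 f (g y) != 0.
    by near: y.
  rewrite -{1}fgy; apply: is_derive_inverse => //; near: y; [exact: n1|exact: n2].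
exists (fun y : R => is_derive y 1 g (derive1 f (g y))^-1 /\ U' (g y))°.
split; [exact: open_interior | exact: gd |].
apply: (sm_ode _ _ U' _ (fun x => (derive1 f x)^-1)) => //.
- exact: open_interior.
- by move=> x /interior_subset[].
- by move=> x /interior_subset[].
Unshelve. all: by end_near. Qed.
End InverseFunction.

(** * Orders of vanishing and Taylor polynomials at 0 *)

Section Taylor.
Variable R : realType.

(** A bound is used instead of vanishing Taylor coefficients because it also applies to absolute
    values of functions and is stable under products without computing derivatives. *)
Definition ordO (n : nat) (f : R -> R) :=
  exists K, \forall t \near (0 : R), `|f t| <= K * `|t| ^+ n.

Lemma ordO_eq n (f g : R -> R) : {near (0 : R), f =1 g} -> ordO n f -> ordO n g.
Proof.
move=> fg [K fK]; exists K; move: fK; apply: filterS2 fg => t -> //.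
Qed.

Lemma eq_ordO n (f g : R -> R) : f =1 g -> ordO n f -> ordO n g.
Proof. by move=> /funext ->. Qed.

Lemma ordO_pos n f : ordO n f -> exists2 K, 0 < K & \forall t \near (0 : R), `|f t| <= K * `|t| ^+ n.
Proof.
move=> [K fK]; exists (`|K| + 1); first by rewrite ltr_wpDl.
apply: filterS fK => t /le_trans; apply.
by rewrite ler_wpM2r // ?exprn_ge0 // (le_trans (ler_norm K)) // lerDl.
Qed.

Lemma ordOD n f g : ordO n f -> ordO n g -> ordO n (fun t => f t + g t).
Proof.
move=> [K fK] [L gL]; exists (K + L); apply: filterS2 fK gL => t ft gt.
by rewrite mulrDl; apply: le_trans (ler_normD _ _) (lerD ft gt).
Qed.

Lemma ordON n f : ordO n f -> ordO n (fun t => - f t).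
Proof. by move=> [K fK]; exists K; apply: filterS fK => t; rewrite normrN. Qed.

Lemma ordOB n f g : ordO n f -> ordO n g -> ordO n (fun t => f t - g t).
Proof. by move=> fn gn; apply: ordOD => //; exact: ordON. Qed.

Lemma ordOM n m f g : ordO n f -> ordO m g -> ordO (n + m) (fun t => f t * g t).
Proof.
move=> [K fK] [L gL]; exists (K * L); apply: filterS2 fK gL => t ft gt.
by rewrite normrM exprD mulrACA ler_pM.
Qed.

Lemma ordO_le n m f : (m <= n)%N -> ordO n f -> ordO m f.
Proof.
move=> mn /ordO_pos [K K0 fK]; exists K; near=> t.
have ft : `|f t| <= K * `|t| ^+ n by near: t.
have t1 : `|t| <= 1.
  by near: t; apply: (lt_near R _ 1) => // t; rewrite subr0; exact: ltW.
by apply: le_trans ft _; rewrite ler_pM2l //; exact: ler_wiXn2l.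
Unshelve. all: by end_near. Qed.

Lemma ordO_continuous f : {for 0, continuous f} -> ordO 0 f.
Proof.
move=> cf; exists (`|f 0| + 1); near=> t; rewrite expr0 mulr1.
have ft : `|f 0 - f t| <= 1.
  by near: t; have /cvgrPdist_le /(_ 1 ltr01) := cf.
rewrite -lerBlDl; apply: le_trans (ler_norm _) _.
by apply: le_trans (ler_dist_dist _ _) _; rewrite distrC.
Unshelve. all: by end_near. Qed.

Lemma smg_ordO0 f : smg R 0 f -> ordO 0 f.
Proof. by move=> /smg_continuous; exact: ordO_continuous. Qed.

Lemma ordO_expr n : ordO n (fun t => t ^+ n).
Proof.
by exists 1; near=> t; rewrite mul1r normrX.
Unshelve. all: by end_near. Qed.

Lemma ordO_Xn n f : smg R 0 f -> ordO n (fun t => t ^+ n * f t).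
Proof. by move=> sf; rewrite -[X in ordO X]addn0; apply: ordOM; [exact: ordO_expr|exact: smg_ordO0]. Qed.

Lemma ordOZ n (c : R) f : ordO n f -> ordO n (fun t => c * f t).
Proof. by move=> fn; rewrite -[X in ordO X]add0n; apply: ordOM fn; apply: smg_ordO0; exact: smg_cst. Qed.

Lemma ordO_leading n (c : R) : ordO n.+1 (fun t => c * t ^+ n) -> c = 0.
Proof.
move=> /ordO_pos [K K0] /nbhs_ballP [d /= d0 H]; apply/eqP/negPn/negP => c0.
(* At this [t] the bound would give [|c| <= K t <= |c| / 2]. *)
pose t := Num.min (d / 2) (`|c| / K / 2).
have t0 : 0 < t by rewrite /t lt_min !divr_gt0 // normr_gt0.
have td : ball 0 d t.
  by rewrite /ball /= sub0r normrN gtr0_norm // /t gt_min ltr_pdivrMr // ltr_pMr // ltr1n.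
have := H t td; rewrite normrM normrX (gtr0_norm t0) exprSr mulrA (mulrAC K) ler_pM2r ?exprn_gt0 //.
apply/negP; rewrite -ltNge -ltr_pdivlMl // mulrC.
have : t <= `|c| / K / 2 by rewrite /t ge_min lexx orbT.
move/le_lt_trans; apply; rewrite ltr_pdivrMr // ltr_pMr ?ltr1n //.
by rewrite divr_gt0 // normr_gt0.
Qed.

Definition coefT (f : R -> R) (k : nat) : R := derive1n k f 0 / k`!%:R.

Definition taylor (f : R -> R) n : {poly R} := \poly_(k < n) coefT f k.

Lemma coefT0 f : coefT f 0 = f 0.
Proof. by rewrite /coefT fact0 divr1. Qed.

Lemma coefT_derive1 f k : coefT (derive1 f) k = coefT f k.+1 *+ k.+1.
Proof.
rewrite /coefT derive1Sn -[RHS]mulr_natr -mulrA; congr (_ * _).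
by rewrite factS natrM invfM mulrAC mulVf ?mul1r // pnatr_eq0.
Qed.

Lemma deriv_taylor f n : (taylor f n.+1)^`()%R = taylor (derive1 f) n.
Proof.
apply/polyP => k; rewrite coef_deriv !coef_poly ltnS.
by case: ifP => _; rewrite ?mul0rn // coefT_derive1.
Qed.

Lemma ordO_primitive n (f df : R -> R) :
  (\forall t \near (0 : R), is_derive (t : R) 1 f (df t)) -> f 0 = 0 ->
  ordO n df -> ordO n.+1 f.
Proof.
move=> D f0 /ordO_pos [K K0 fK]; have [d d0 H] := near_le R _ _ (filterI D fK).
exists K; apply: (lt_near R _ d) => // t; rewrite subr0 => td.
have [||c [cd cx _]] := mean_value R _ _ _ _ (fun x xd => (H x xd).1) 0 t.
- by rewrite subrr normr0 ltW.
- by rewrite subr0 ltW.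
rewrite f0 !subr0 => ->; rewrite normrM exprSr mulrA ler_wpM2r //.
apply: le_trans (H c cd).2 _; rewrite ler_pM2l //.
by apply: lerXn2r; rewrite ?nnegrE //; move: cx; rewrite !subr0.
Qed.

(** The derivative of the remainder of [f] is the remainder of [f'] one order lower, and integration
    from 0 raises the order by one. *)
Lemma taylor_ordO n f : smg R 0 f -> ordO n (fun t => f t - (taylor f n).[t]).
Proof.
elim: n f => [|n IH] f sf.
  apply: eq_ordO (smg_ordO0 _ sf) => t.
  by rewrite /taylor horner_poly big_ord0 subr0.
apply: ordO_primitive (IH _ (smg_derive1 _ _ _ sf)).
  apply: filterS (smg_near _ _ _ sf) => t /smg_is_derive ft.
  by rewrite -deriv_taylor; apply: is_deriveB.
by rewrite horner_coef0 coef_poly coefT0 subrr.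
Qed.

Lemma ordO_coefT n f k : smg R 0 f -> ordO n f -> (k < n)%N -> coefT f k = 0.
Proof.
move=> sf fn; elim/ltn_ind: k => k IH kn; apply: (ordO_leading k).
have := ordOB _ _ _ (ordO_le _ _ _ kn fn) (taylor_ordO k.+1 f sf); apply: eq_ordO => t.
rewrite /taylor horner_poly big_ord_recr /= big1 ?add0r; last first.
  by move=> i _; rewrite IH ?mul0r // (ltn_trans _ kn).
by rewrite opprB addrC subrK.
Qed.

Definition flat (f : R -> R) := forall n, ordO n f.

Lemma flat_coefT f k : smg R 0 f -> flat f -> coefT f k = 0.
Proof. by move=> sf ff; exact: (ordO_coefT k.+1). Qed.

(** All Taylor coefficients of [f'] vanish, so its Taylor remainder of any order is [f'] itself. *)
Lemma flat_derive1 f : smg R 0 f -> flat f -> flat (derive1 f).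
Proof.
move=> sf ff n; apply: eq_ordO (taylor_ordO n _ (smg_derive1 _ _ _ sf)) => t.
rewrite /taylor horner_poly big1 ?subr0 // => i _.
by rewrite coefT_derive1 flat_coefT // mul0rn mul0r.
Qed.

End Taylor.

(** * Termwise differentiation of series *)

Section TermwiseDerivation.
Variable R : realType.

Lemma is_derive_bound (f : R -> R) (x l M : R) :
  (\forall h \near (0 : R), `|f (h + x) - f x - h * l| <= M * `|h| ^+ 2) ->
  is_derive x 1 f l.
Proof.
move=> H.
have cv : (fun h => h^-1 *: (f (h *: 1 + x) - f x)) @ 0^' --> l.
  apply/cvgrPdist_le => e e0; near=> h.
  have h0 : h != 0 by near: h; exact: nbhs_dnbhs_neq.
  have h1 : `|f (h + x) - f x - h * l| <= M * `|h| ^+ 2.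
    by near: h; exact: nbhs_dnbhs.
  have he : `|h| * (`|M| + 1) <= e.
    rewrite -ler_pdivlMr ?ltr_wpDl //.
    near: h; apply: nbhs_dnbhs.
    apply: (lt_near R _ (e / (`|M| + 1))); first by rewrite divr_gt0 ?ltr_wpDl.
    by move=> h; rewrite subr0; exact: ltW.
  rewrite /GRing.scale /= mulr1 distrC.
  have -> : h^-1 * (f (h + x) - f x) - l = h^-1 * (f (h + x) - f x - h * l).
    by rewrite [RHS]mulrBr mulKf.
  rewrite normrM normfV ler_pdivrMl ?normr_gt0 //; apply: le_trans h1 _.
  rewrite expr2 mulrCA ler_wpM2l //; apply: le_trans he.
  by rewrite mulrC ler_wpM2l //; apply: le_trans (ler_norm _) _; rewrite lerDl.
by apply: DeriveDef; [apply/cvg_ex; exists l|exact: cvg_lim].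
Unshelve. all: by end_near. Qed.

(** [s m k] stands for the m-th derivative of the k-th term, [B m k] for its bound on the unit
    interval, and [M m] bounds the partial sums of [B m] uniformly. *)
Variables (s : nat -> nat -> R -> R) (B : nat -> nat -> R) (M : nat -> R).
Hypothesis ds : forall m k (w : R), is_derive w 1 (s m k) (s m.+1 k w).
Hypothesis sB : forall m k w, `|w| <= 1 -> `|s m k w| <= B m k.
Hypothesis BM : forall m N, \sum_(0 <= k < N) B m k <= M m.

Definition sum_series m (w : R) : R := limn (series (fun k => s m k w)).

Let B0 m k : 0 <= B m k.
Proof. by apply: le_trans (sB m k 0 _); rewrite ?normr0. Qed.

Lemma is_cvg_sum_series m w : `|w| <= 1 -> cvgn (series (fun k => s m k w)).
Proof.
move=> w1; apply: normed_cvg; apply: nondecreasing_is_cvgn.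
  by apply: nondecreasing_series => k _ _; exact: normr_ge0.
exists (M m) => _ [N _ <-]; apply: le_trans (BM m N).
by rewrite /series /=; apply: ler_sum => k _; exact: sB.
Qed.

(** Two uses of the mean value theorem bound the error of each term by its second derivative times
    [h^2]. The bounds sum to at most [M m.+2], and the estimate passes to the limit. *)
Lemma sum_series_quad m w h : `|w| <= 1 -> `|h + w| <= 1 ->
  `|sum_series m (h + w) - sum_series m w - h * sum_series m.+1 w| <= M m.+2 * `|h| ^+ 2.
Proof.
move=> w1 hw1.
have c1 := is_cvg_sum_series m _ hw1; have c2 := is_cvg_sum_series m _ w1.
have c3 := is_cvg_sum_series m.+1 _ w1.
pose u := (fun N => series (fun k => s m k (h + w)) N - series (fun k => s m k w) N
   - h * series (fun k => s m.+1 k w) N).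
have cu : u @ \oo --> sum_series m (h + w) - sum_series m w - h * sum_series m.+1 w.
  by apply: cvgB; [exact: cvgB|exact: cvgMr].
set L := sum_series m (h + w) - _ - _ in cu *.
have cnu : (fun N => `|u N|) @ \oo --> `|L| by exact: cvg_norm.
have <- := cvg_lim (@Rhausdorff R) cnu.
apply: limr_le; first by apply/cvg_ex; eexists; exact: cnu.
near=> N; rewrite /u /series /= mulr_sumr -!sumrB.
apply: le_trans (ler_norm_sum _ _ _) _.
apply: (@le_trans _ _ (\sum_(0 <= k < N) B m.+2 k * `|h| ^+ 2)); last first.
  by rewrite -mulr_suml ler_wpM2r // exprn_ge0.
apply: ler_sum => k _.
have D j (x : R) : `|x - 0| <= 1 -> is_derive x 1 (s j k) (s j.+1 k x) by move=> _; exact: ds.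
have w1' : `|w - 0| <= 1 by rewrite subr0.
have hw1' : `|h + w - 0| <= 1 by rewrite subr0.
have [c [cd cx _ ->]] := mean_value R _ _ _ _ (D m) _ _ w1' hw1'.
have [c' [cd' _ _]] := mean_value R _ _ _ _ (D m.+1) _ _ w1' cd.
rewrite addrK [s m.+1 k c * h]mulrC -mulrBr => ->.
rewrite mulrCA normrM expr2 ler_pM //; rewrite ?mulr_ge0 //.
  by apply: sB; rewrite subr0 in cd'.
rewrite normrM ler_wpM2l //; move: cx; by rewrite addrK.
Unshelve. all: by end_near. Qed.

Lemma sum_series_derive m (w : R) : `|w| < 1 -> is_derive w 1 (sum_series m) (sum_series m.+1 w).
Proof.
move=> w1; apply: (is_derive_bound _ _ _ (M m.+2)).
apply: (lt_near R _ (1 - `|w|)); first by rewrite subr_gt0.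
move=> h; rewrite subr0 => hw; apply: sum_series_quad; first exact: ltW.
by apply: le_trans (ler_normD _ _) _; rewrite -lerBrDr ltW.
Qed.

Lemma sum_series_finite m w n : (forall k, (n <= k)%N -> s m k w = 0) ->
  sum_series m w = \sum_(0 <= k < n) s m k w.
Proof.
move=> H; apply: (cvg_lim (@Rhausdorff R)).
apply: cvg_near_cst; exists n => // N /= nN.
rewrite /series /= (big_cat_nat _ (n := n)) //= [X in _ + X]big_nat_cond [X in _ + X]big1 ?addr0 //.
by move=> k /andP[/andP[nk _] _]; exact: H.
Qed.

Lemma sum_series_smg m : smg R 0 (sum_series m).
Proof.
have o : open [set w : R | `|w| < 1].
  rewrite (_ : [set w | _] = ball (0 : R) 1); first exact: ball_open.
  by apply/seteqP; split => w; rewrite /ball /= sub0r normrN.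
exists [set w : R | `|w| < 1]; split => //=; first by rewrite normr0.
apply: (sm_coind _ _ (fun f => exists m, f = sum_series m)) => //; last by exists m.
move=> _ [j ->]; exists (sum_series j.+1); split; first by exists j.+1.
by move=> w; exact: sum_series_derive.
Qed.

Lemma sum_series_coefT m : coefT R (sum_series 0) m = sum_series m 0 / m`!%:R.
Proof.
rewrite /coefT; congr (_ / _).
suff H (w : R) : `|w| < 1 -> derive1n m (sum_series 0) w = sum_series m w.
  by apply: H; rewrite normr0.
elim: m w => [|m IH] w w1; first by rewrite derive1n0.
rewrite derive1nS derive1E.
have [_ <-] := sum_series_derive m w w1.
apply: near_eq_derive; near=> y; apply: IH; near: y.
apply: (lt_near R _ (1 - `|w|)); first by rewrite subr_gt0.
move=> y yw; rewrite -(subrK w y); apply: le_lt_trans (ler_normD _ _) _.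
by rewrite -ltrBrDr.
Unshelve. all: by end_near. Qed.
End TermwiseDerivation.

(** * Borel's theorem on prescribed Taylor coefficients *)

Section Borel.
Variable R : realType.

(* The n-fold primitive of [cos], integrated from 0. *)
Fixpoint cos_prim (n : nat) : R -> R :=
  match n with
  | 0 => cos
  | 1 => sin
  | n'.+2 => fun w => w ^+ n' / n'`!%:R - cos_prim n' w
  end.

Lemma is_derive_monomial n (w : R) :
  is_derive w 1 (fun t : R => t ^+ n.+1 / n.+1`!%:R) (w ^+ n / n`!%:R).
Proof.
have := is_derive_poly (n.+1`!%:R^-1 *: 'X^(n.+1)) w.
rewrite derivZ derivXn hornerZ hornerMn hornerXn.
have -> : horner (n.+1`!%:R^-1 *: 'X^(n.+1)) = (fun t : R => t ^+ n.+1 / n.+1`!%:R).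
  by apply/funext => t; rewrite hornerZ hornerXn mulrC.
congr (is_derive _ _ _ _); rewrite factS natrM invfM /= -[w ^+ n *+ _]mulr_natr.
by rewrite mulrC -!mulrA; congr (_ * _); rewrite mulrA mulfV ?mul1r // pnatr_eq0.
Qed.

Lemma cos_prim_derive n (w : R) : is_derive w 1 (cos_prim n.+1) (cos_prim n w).
Proof.
suff : is_derive w 1 (cos_prim n.+1) (cos_prim n w) /\
       is_derive w 1 (cos_prim n.+2) (cos_prim n.+1 w) by case.
elim: n => [|n [IH1 IH2]].
  split; first exact: is_derive_sin.
  have -> : cos_prim 2 = fun w => 1 - cos w.
    by apply/funext => t /=; rewrite expr0 fact0 divr1.
  by apply: is_derive_eq; rewrite add0r mul1r opprK.
split => //.
apply: is_deriveB.
exact: is_derive_monomial.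
Qed.

Lemma cos_prim0 n : cos_prim n 0 = (n == 0)%:R.
Proof.
suff : cos_prim n 0 = (n == 0)%:R /\ cos_prim n.+1 0 = 0 by case.
elim: n => [|n [IH1 IH2]]; first by rewrite /= cos0 sin0.
split => //=; rewrite IH1; case: n {IH1 IH2} => [|n].
  by rewrite expr0 fact0 divr1 subrr.
by rewrite expr0n mul0r subrr.
Qed.

(** This is the j-th derivative of [cos], a shift by j quarter turns. *)
Definition cos_shift (j : nat) (w : R) := cos (w + pi / 2 *+ j).

Lemma cos_shift_derive j (w : R) : is_derive w 1 (cos_shift j) (cos_shift j.+1 w).
Proof.
rewrite /cos_shift [pi / 2 *+ j.+1]mulrSr addrA cosDpihalf.
by apply: is_derive_eq; rewrite addr0 mulr1.
Qed.

(** [scaled_prim b k] is the k-fold primitive from 0 of [cos (b w)]; [scaled_shift b j] below is its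
    j-th derivative. *)
Definition scaled_prim (b : R) k (w : R) := b ^- k * cos_prim k (b * w).

Definition scaled_shift (b : R) j (w : R) := b ^+ j * cos_shift j (b * w).

Lemma is_derive_rescale (b c w l : R) (f : R -> R) : is_derive (b * w) 1 f l ->
  is_derive w 1 (fun w => c * f (b * w)) (c * (b * l)).
Proof.
move=> fl; apply: is_derive_eq.
by rewrite /GRing.scale /= mulr1 [l * b]mulrC.
Qed.

Lemma scaled_prim_derive b k (w : R) : 0 < b ->
  is_derive w 1 (scaled_prim b k.+1) (scaled_prim b k w).
Proof.
move=> b0; have bn0 : b != 0 by rewrite gt_eqF.
have -> : scaled_prim b k w = b ^- k.+1 * (b * cos_prim k (b * w)).
  by rewrite /scaled_prim exprS invfM mulrACA mulVf ?mul1r // mulrC.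
apply: is_derive_rescale; exact: cos_prim_derive.
Qed.

Lemma scaled_shift_derive b j (w : R) :
  is_derive w 1 (scaled_shift b j) (scaled_shift b j.+1 w).
Proof.
rewrite /scaled_shift exprSr -mulrA; apply: is_derive_rescale.
exact: cos_shift_derive.
Qed.

(** The first primitive is [sin (b w) / b]. Each further integration starts at 0 and runs over a
    length of at most 1, hence does not enlarge the bound. *)
Lemma scaled_prim_small b k w : 1 <= b -> `|w| <= 1 -> `|scaled_prim b k.+1 w| <= b^-1.
Proof.
move=> b1; have b0 : 0 < b by exact: lt_le_trans b1.
elim: k w => [|k IH] w w1.
  by rewrite /scaled_prim expr1 normrM normfV (gtr0_norm b0) ler_piMr ?invr_ge0 ?(ltW b0) // sin_max.
have w1' : `|w - 0| <= 1 by rewrite subr0.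
have o1' : `|0 - 0 : R| <= 1 by rewrite subrr normr0.
have [c [cd _ _]] := mean_value R _ _ _ _
  (fun (x : R) (_ : `|x - 0| <= 1) => scaled_prim_derive b k.+1 x b0) _ _ o1' w1'.
rewrite {2}/scaled_prim mulr0 cos_prim0 mulr0 !subr0 => ->.
rewrite normrM -[leRHS]mulr1 ler_pM //.
by apply: IH; rewrite subr0 in cd.
Qed.

(* The m-th derivative of the n-fold primitive of w |-> cos (b w). *)
Definition borel_term (b : R) (n m : nat) : R -> R :=
  if (m <= n)%N then scaled_prim b (n - m) else scaled_shift b (m - n).

Lemma borel_term_derive b n m (w : R) : 0 < b ->
  is_derive w 1 (borel_term b n m) (borel_term b n m.+1 w).
Proof.
move=> b0; rewrite /borel_term; case: (ltngtP m n) => mn.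
- rewrite -(subSS m n) subSn //; exact: scaled_prim_derive.
- rewrite subSn; last exact: ltnW.
  exact: scaled_shift_derive.
- rewrite mn subnn subSn // subnn.
  have -> : scaled_prim b 0 = scaled_shift b 0.
    by apply/funext => t; rewrite /scaled_prim /scaled_shift /cos_shift expr0 invr1 mulr0n addr0.
  exact: scaled_shift_derive.
Qed.

(** Triangularity: the n-th term contributes nothing to derivatives at 0 of order below [n], and 1
    to the n-th, so the coefficients can be solved for in succession. *)
Lemma borel_term0 b n m : (m <= n)%N -> borel_term b n m 0 = (m == n)%:R.
Proof.
move=> mn; rewrite /borel_term mn /scaled_prim mulr0 cos_prim0 subn_eq0 eqn_leq mn /=.
case: leqP => nm; last by rewrite mulr0.
by rewrite mulr1 (_ : n - m = 0)%N ?expr0 ?invr1 //; apply/eqP; rewrite subn_eq0.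
Qed.

Lemma borel_term_small b n m w : 1 <= b -> (m < n)%N -> `|w| <= 1 ->
  `|borel_term b n m w| <= b^-1.
Proof.
move=> b1 mn w1; rewrite /borel_term ltnW // -(subSS m n) subSn //.
exact: scaled_prim_small.
Qed.

Lemma borel_term_large b n m w : 0 < b -> (n <= m)%N -> `|w| <= 1 ->
  `|borel_term b n m w| <= b ^+ (m - n).
Proof.
move=> b0; rewrite leq_eqVlt /borel_term => /predU1P[<-|nm] w1.
  by rewrite leqnn subnn /scaled_prim expr0 invr1 mul1r; exact: cos_max.
rewrite leqNgt nm /= /scaled_shift normrM normrX (gtr0_norm b0).
by rewrite ler_piMr ?exprn_ge0 ?(ltW b0) //; exact: cos_max.
Qed.

(** Course-of-values recursion: each value may depend on the list of all earlier ones. *)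
Lemma prefix_recursion (Phi : nat -> seq R -> R) :
  exists A : nat -> R, forall n, A n = Phi n (mkseq A n).
Proof.
pose fix pre n := if n is n'.+1 then rcons (pre n') (Phi n' (pre n')) else [::].
pose A n := Phi n (pre n).
suff E n : mkseq A n = pre n by exists A => n; rewrite E.
by elim: n => // n IH; rewrite mkseqS IH.
Qed.

Lemma geometric_sum_le N : \sum_(0 <= k < N) (2 ^- k : R) <= 2.
Proof.
suff -> : \sum_(0 <= k < N) (2 ^- k : R) = 2 - 2 * 2 ^- N.
  by rewrite gerBl mulr_ge0 // invr_ge0 exprn_ge0.
elim: N => [|N IH]; first by rewrite big_geq // expr0 invr1 mulr1 subrr.
rewrite big_nat_recr //= IH exprS invfM mulVKf //.
by rewrite [in LHS]mulr_natl mulr2n opprD addrA subrK.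
Qed.

(* Peano's proof of Borel's theorem: the coefficients are found one after the other,
   the n-th term being damped by a frequency chosen once its coefficient is known. *)
Theorem borel (d : nat -> R) : exists G : R -> R, smg R 0 G /\ forall k, coefT R G k = d k.
Proof.
(* This frequency is at least 1 and satisfies [|a| / freq a n <= 2^-n], which makes every derivative
   of the series summable past finitely many terms. *)
pose freq (a : R) n := 1 + `|a| * 2 ^+ n.
(* [A n] is the wanted n-th derivative [d n * n!] minus what the earlier terms already contribute to
   it at 0. *)
have [A AE] := prefix_recursion (fun n s => d n * n`!%:R -
  \sum_(0 <= k < n) nth 0 s k * borel_term (freq (nth 0 s k) k) k n 0).
pose b n := freq (A n) n.
have b1 n : 1 <= b n by rewrite /b /freq lerDl mulr_ge0 // exprn_ge0.
have b0 n : 0 < b n by exact: lt_le_trans (b1 n).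
pose s m k w := A k * borel_term (b k) k m w.
(* The terms with [k <= m] have been differentiated beyond [cos] and grow with the frequency, but
   there are only [m + 1] of them; the other terms are below [2^-k]. *)
pose B m k := (if (k <= m)%N then `|A k| * b k ^+ (m - k) else 0) + 2 ^- k.
pose M m := \sum_(0 <= k < m.+1) `|A k| * b k ^+ (m - k) + 2.
have ds m k (w : R) : is_derive w 1 (s m k) (s m.+1 k w).
  exact: (is_deriveZ (A k) (borel_term_derive (b k) k m w (b0 k))).
have sB m k w : `|w| <= 1 -> `|s m k w| <= B m k.
  move=> w1; rewrite /s /B normrM; case: leqP => km.
    rewrite ler_wpDr ?invr_ge0 ?exprn_ge0 // ler_wpM2l //.
    exact: borel_term_large.
  rewrite add0r; apply: (@le_trans _ _ (`|A k| / b k)).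
    by rewrite ler_wpM2l // borel_term_small.
  rewrite ler_pdivrMr // mulrC ler_pdivlMr ?exprn_gt0 //.
  by rewrite /b /freq lerDr.
have BM m N : \sum_(0 <= k < N) B m k <= M m.
  rewrite /B /M big_split /= lerD ?geometric_sum_le // -big_mkcond /=.
  set X := fun k => `|A k| * b k ^+ (m - k).
  have X0 k : 0 <= X k by rewrite /X mulr_ge0 // exprn_ge0 // ltW.
  have [Nm|mN] := leqP N m.+1.
    rewrite [leRHS](big_cat_nat _ (n := N)) //= ler_wpDr //.
      by apply: sumr_ge0 => k _; exact: X0.
    by rewrite big_mkcond; apply: ler_sum => k _; case: ifP => // _; exact: X0.
  rewrite (big_cat_nat _ (n := m.+1)) //=; last exact: ltnW.
  rewrite [X in _ + X]big_nat_cond [X in _ + X]big1 ?addr0.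
    by rewrite big_mkcond; apply: ler_sum => k _; case: ifP => // _; exact: X0.
  by move=> k /andP[/andP[mk _]]; rewrite leqNgt mk.
exists (sum_series R s 0); split; first exact: (sum_series_smg R s B M ds sB BM).
move=> k; rewrite (sum_series_coefT R s B M ds sB BM).
rewrite (sum_series_finite R s _ _ k.+1); last first.
  by move=> j kj; rewrite /s borel_term0 1?ltnW // ltn_eqF // mulr0.
rewrite big_nat_recr //= {2}/s borel_term0 // eqxx mulr1 [A k]AE.
apply: (canLR (mulfK _)); first by rewrite pnatr_eq0 -lt0n fact_gt0.
rewrite addrC -addrA [X in _ + X](_ : _ = 0) ?addr0 //.
rewrite addrC; apply/eqP; rewrite subr_eq0; apply/eqP.
by apply: eq_big_nat => j /andP[_ jk]; rewrite nth_mkseq.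
Qed.
End Borel.

(** * Flat functions composed with roots *)

Section FlatFunctions.
Variable R : realType.

Lemma flat0 (f : R -> R) : flat R f -> f 0 = 0.
Proof.
move=> /(_ 1%N) [K /nbhs_singleton]; rewrite normr0 expr0n mulr0.
by move=> h; apply/eqP; rewrite -normr_le0.
Qed.

Section Root.
(** [theta] is abstract to serve twice: as the identity with [i = 1], for division by powers of [t],
    and as [root i], whose zero branch on the negative half-line is the second alternative of
    [thetaP]. *)
Variables (theta : R -> R) (i : nat).
Hypothesis i0 : (0 < i)%N.
Hypothesis thetaP : forall s : R, s != 0 ->
  [/\ theta s != 0, theta s ^+ i = s & is_derive s 1 theta (theta s / (i%:R * s))] \/
  \forall y \near s, theta y = 0.
Hypothesis theta_le : forall s, `|theta s| ^+ i <= `|s|.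

Let theta_lt e : 0 < e -> \forall s \near (0 : R), `|theta s| < e.
Proof.
move=> e0; apply: (lt_near R _ (e ^+ i)); first exact: exprn_gt0.
move=> s; rewrite subr0 => se; rewrite ltNge; apply/negP => es.
have := le_lt_trans (theta_le s) se; apply/negP; rewrite -leNgt.
by apply: lerXn2r => //; rewrite nnegrE // ltW.
Qed.

Let theta0 : theta 0 = 0.
Proof.
apply/eqP/negPn/negP => t0.
have /theta_lt/nbhs_singleton : 0 < `|theta 0| by rewrite normr_gt0.
by rewrite ltxx.
Qed.

Let quot (F : R -> R) k (s : R) := F (theta s) / theta s ^+ k.

(** Since [theta' = theta / (i s)] and [s = theta^i], the derivative of [F (theta) / theta^k] is
    [(theta F' (theta) - k F (theta)) / (i theta^(k + i))]: the same shape with this new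
    numerator. *)
Let dnum (F : R -> R) k (t : R) := (t * derive1 F t - k%:R * F t) / i%:R.

Let flat_dnum F k : smg R 0 F -> flat R F -> flat R (dnum F k).
Proof.
move=> sF fF n; have fF' := flat_derive1 _ _ sF fF.
apply: (eq_ordO R n (fun t => i%:R^-1 * (t * derive1 F t - k%:R * F t))).
  by move=> t; rewrite mulrC.
apply/ordOZ/ordOB; last exact/ordOZ/fF.
rewrite -[n]add0n; apply: ordOM; last exact: fF'.
by apply: smg_ordO0; exact: smg_id.
Qed.

Let smg_dnum p F k : smg R p F -> smg R p (dnum F k).
Proof.
move=> sF; apply: smgM; last exact: smg_cst.
apply: smgB; apply: smgM => //; [exact: smg_id|exact: smg_derive1|exact: smg_cst].
Qed.

Let quot_derive0 F k : flat R F -> is_derive (0 : R) 1 (quot F k) 0.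
Proof.
(* The order [k] pays for the denominator, and the remaining [|theta|^(2 i) <= |h|^2] gives the
   quadratic bound. *)
move=> fF; have [K FK] := fF (k + i * 2)%N.
have [d d0 H] := near_le _ _ _ FK.
apply: (is_derive_bound R _ _ _ `|K|).
apply: filterS (theta_lt _ d0) => h hd.
rewrite addr0 mulr0 subr0 {2}/quot theta0 flat0 // mul0r subr0 /quot.
have [->|th0] := eqVneq (theta h) 0.
  by rewrite flat0 // mul0r normr0 mulr_ge0 // exprn_ge0.
rewrite normrM normfV normrX ler_pdivrMr ?exprn_gt0 ?normr_gt0 //.
apply: le_trans (H _ _) _; first by rewrite subr0 ltW.
apply: (@le_trans _ _ (`|K| * `|theta h| ^+ (k + i * 2))).
  by rewrite ler_wpM2r ?exprn_ge0 // ler_norm.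
rewrite exprD -mulrA ler_wpM2l // mulrC ler_wpM2r ?exprn_ge0 //.
by rewrite exprM; apply: lerXn2r => //; rewrite nnegrE // exprn_ge0.
Qed.

Let quot_derive F k s : smg R (theta s) F -> flat R F -> smg R 0 F ->
  is_derive (s : R) 1 (quot F k) (quot (dnum F k) (k + i) s).
Proof.
move=> sF fF sF0; have fd := flat_dnum F k sF0 fF.
have [->|s0] := eqVneq s 0.
  rewrite {2}/quot theta0 (flat0 _ fd) mul0r; exact: quot_derive0.
case: (thetaP s s0) => [[t0 ts dt]|nt]; last first.
  rewrite {2}/quot (nbhs_singleton nt) (flat0 _ fd) mul0r.
  have c0 : is_derive s 1 (cst (0 : R) : R -> R) 0 by exact: is_derive_cst.
  apply: near_eq_is_derive c0.
  by apply: filterS nt => y yt; rewrite /quot yt flat0 // mul0r.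
have dF := smg_is_derive _ _ _ sF.
have tk0 : theta s ^+ k != 0 by rewrite expf_neq0.
have dc : is_derive s 1 (F \o theta) (derive1 F (theta s) * (theta s / (i%:R * s))).
  exact: is_derive1_comp.
have dX := is_deriveX k dt.
rewrite exprfctE in dX.
have dV := @is_deriveV R (fun y => theta y ^+ k) s _ 1 tk0 dX.
have dM := is_deriveM dc dV.
apply: (is_derive_eq dM).
rewrite /GRing.scale /= /quot /dnum.
have ir0 : i%:R != 0 :> R by rewrite pnatr_eq0 -lt0n.
rewrite exprD ts; case: k {tk0 dX dV dM fd} => [|k].
  rewrite !expr0 /=; field; by rewrite ir0 s0.
rewrite /= [theta s ^+ k.+1]exprS; have tk0 : theta s ^+ k != 0 by rewrite expf_neq0.
move: (k.+1%:R) (theta s ^+ k) tk0 => c T T0.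
by field; rewrite ir0 s0 t0 T0.
Qed.

(** Differentiation replaces [(F, k)] by [(dnum F k, k + i)], whose numerator is again smooth and
    flat; hence the induction with [F] and [k] generalised. *)
Lemma flat_quot_smg F k : smg R 0 F -> flat R F ->
  smg R 0 (fun s => F (theta s) / theta s ^+ k).
Proof.
move=> sF0 fF; have [U [oU U0 sU]] := sF0.
have nV : \forall s \near (0 : R), U (theta s).
  have /nbhs_ballP[e e0 eU] := open_nbhs_nbhs (conj oU U0).
  apply: filterS (theta_lt e e0) => s se; apply: eU.
  by rewrite /ball /= sub0r normrN.
exists (fun s => U (theta s))°; split; [exact: open_interior|exact: nV|] => n.
have {}sU p : U p -> smg R p F by move=> Up; exists U; split.
elim: n k F sF0 fF sU => // n IH k F sF0 fF sU.
apply: (diff_n_derive1 _ _ _ _ (quot (dnum F k) (k + i))); first exact: open_interior.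
  move=> s /interior_subset Us; apply: quot_derive => //.
  exact: sU.
apply: IH; [exact: smg_dnum|exact: flat_dnum|].
by move=> p Up; apply: smg_dnum; exact: sU.
Qed.
End Root.
End FlatFunctions.

(** * Division by powers and decomposition by residues of the exponent *)

Section Division.
Variable R : realType.

Lemma ordO_comp_le (n m : nat) (f g : R -> R) : (forall t, `|g t| = `|t| ^+ m) -> (0 < m)%N ->
  ordO R n f -> ordO R (m * n) (fun t => f (g t)).
Proof.
move=> gm m0 [K fK]; exists K; have [d d0 H] := near_le _ _ _ fK.
near=> t; rewrite exprM -gm; apply: H; rewrite subr0 gm.
have t1 : `|t| <= Num.min 1 d.
  near: t; apply: (lt_near R _ (Num.min 1 d)); first by rewrite lt_min ltr01.
  by move=> t; rewrite subr0; exact: ltW.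
move: t1; rewrite le_min => /andP[t1 td].
by apply: le_trans td; rewrite -[leRHS]expr1; exact: ler_wiXn2l.
Unshelve. all: by end_near. Qed.

Lemma smg_horner (P : {poly R}) (p : R) : smg R p (horner P).
Proof.
apply: (@eq_smg R R p (fun t : R => \sum_(i <- index_enum 'I_(size P)) P`_i * t ^+ i)).
  by move=> t; rewrite horner_coef.
apply: smg_sum => i; apply: smgM; first exact: smg_cst.
by apply: smgX; exact: smg_id.
Qed.

Lemma flat_div_smg (F : R -> R) k : smg R 0 F -> flat R F -> smg R 0 (fun t => F t / t ^+ k).
Proof.
move=> sF fF; apply: (@flat_quot_smg R id 1) => // s s0; left; split => //.
by rewrite mul1r divff //; exact: is_derive_id.
Qed.

Lemma root0 i (s : R) : s <= 0 -> root R i s = 0.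
Proof. by move=> s0; rewrite /root ltNge s0. Qed.

Lemma flat_root_smg (F : R -> R) i k : (0 < i)%N -> smg R 0 F -> flat R F ->
  smg R 0 (fun t => F (root R i t) / root R i t ^+ k).
Proof.
move=> i0 sF fF; apply: (@flat_quot_smg R (root R i) i) => // s.
  rewrite neq_lt => /orP[s0|s0]; [right|left].
    have : \forall y \near s, y < 0 by exact: lt_nbhsl.
    by apply: filterS => y y0; rewrite root0 // ltW.
  split; [by rewrite gt_eqF // root_gt0|exact: rootK|].
  have D : is_derive s 1 (fun x => expR (ln x * i%:R^-1)) (root R i s / (i%:R * s)).
    have d1 := @is_derive1_ln R s s0.
    have /= d2 := @is_deriveZ _ _ _ _ (i%:R^-1 : R) _ _ _ d1.
    have d3 := @is_derive1_comp R expR _ _ _ _ (is_derive_expR _) d2.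
    have e : (expR \o (i%:R^-1 \*: (@ln R))) = fun x => expR (ln x * i%:R^-1).
      by apply/funext => x /=; rewrite /GRing.scale /= mulrC.
    rewrite -e; apply: (is_derive_eq d3).
    by rewrite /root s0 /= /GRing.scale /= invfM [_^-1 * ln s]mulrC.
  apply: near_eq_is_derive D; near=> y; rewrite /root ifT //; near: y.
  exact: (@open_nbhs_nbhs _ _ [set x : R | 0 < x] (conj (@open_gt R 0) s0)).
have [s0|s0] := ltP 0 s.
  by rewrite -normrX rootK.
by rewrite root0 // normr0 expr0n gtn_eqF.
Unshelve. all: by end_near. Qed.

(** Borel's theorem supplies [g] with the Taylor coefficients of the expected quotient; the error is
    flat and may be divided by [t^n]. The identity holds for every [t] because the quotient is
    corrected globally. *)
Lemma smooth_taylor n (f : R -> R) : smg R 0 f ->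
  exists q : R -> R, smg R 0 q /\ forall t, f t = (taylor R f n).[t] + t ^+ n * q t.
Proof.
move=> sf; have [g [sg gE]] := borel R (fun k => coefT R f (n + k)).
pose F t := f t - (taylor R f n).[t] - t ^+ n * g t.
have sF : smg R 0 F.
  apply: smgB; last by apply: smgM => //; apply: smgX; exact: smg_id.
  by apply: smgB => //; exact: smg_horner.
have fF : flat R F.
  move=> N; apply: (ordO_le _ (n + N)); first exact: leq_addl.
  have := ordOB _ _ _ _ (taylor_ordO R (n + N) f sf)
    (ordOM _ _ _ _ _ (ordO_expr R n) (taylor_ordO R N g sg)).
  apply: eq_ordO => t; rewrite /F /taylor !horner_poly big_split_ord /=.
  have -> : \sum_(i < N) coefT R f (n + i) * t ^+ (n + i) =
      t ^+ n * \sum_(i < N) coefT R g i * t ^+ i.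
    by rewrite mulr_sumr; apply: eq_bigr => j _; rewrite -gE exprD mulrCA.
  by ring.
exists (fun t => g t + F t / t ^+ n); split.
  by apply: smgD => //; exact: flat_div_smg.
move=> t; have Ft : t ^+ n * (F t / t ^+ n) = F t.
  have [t0|t0] := eqVneq (t ^+ n) 0; last by rewrite mulrC divfK.
  move: t0 => /eqP; rewrite expf_eq0 => /andP[n0 /eqP ->].
  by rewrite flat0 // mul0r mulr0.
by rewrite mulrDr Ft /F; ring.
Qed.

(** [r k] is given the coefficients of [rho] at the exponents congruent to [k] modulo [i]. Both
    sides then have the same Taylor series, so the difference is flat. *)
Lemma decomposition_mod i (rho : R -> R) : (0 < i)%N -> smg R 0 rho ->
  exists r : nat -> R -> R, (forall k, smg R 0 (r k)) /\
  flat R (fun s => rho s - \sum_(k < i) s ^+ k * r k (s ^+ i)).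
Proof.
move=> i0 sr.
have /choice[r rP] : forall k, exists g : R -> R, smg R 0 g /\
    forall n, coefT R g n = coefT R rho (n * i + k).
  by move=> k; exact: borel.
exists r; split=> [k|N]; first exact: (rP k).1.
apply: (ordO_le _ (i * N)); first by rewrite leq_pmull.
have H k : ordO R (i * N) (fun s => s ^+ k * (r k (s ^+ i) - (taylor R (r k) N).[s ^+ i])).
  apply: (ordO_le _ (k + i * N)); first exact: leq_addl.
  apply: ordOM; first exact: ordO_expr.
  apply: (ordO_comp_le N i (fun w => r k w - (taylor R (r k) N).[w])) => //.
    by move=> t; rewrite normrX.
  exact: taylor_ordO (rP k).1.
have HS m : ordO R (i * N) (fun s =>
    \sum_(k < m) s ^+ k * (r k (s ^+ i) - (taylor R (r k) N).[s ^+ i])).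
  elim: m => [|j IH].
    by exists 0; near=> s; rewrite big_ord0 normr0 mul0r.
  by apply: eq_ordO (ordOD _ _ _ _ IH (H j)) => s; rewrite big_ord_recr.
(* The Taylor polynomial of [N i] terms is regrouped into residue classes of [N] terms each. *)
have T s : (taylor R rho (N * i)).[s] = \sum_(k < i) s ^+ k * (taylor R (r k) N).[s ^+ i].
  elim: N {H HS} => [|N IH].
    rewrite /taylor horner_poly big_ord0 big1 // => k _.
    by rewrite horner_poly big_ord0 mulr0.
  move: IH; rewrite /taylor !horner_poly mulSnr big_split_ord /= => ->.
  rewrite -big_split /=; apply: eq_bigr => k _.
  rewrite !horner_poly big_ord_recr mulrDr /= (rP k).2; congr (_ + _).
  by rewrite -exprM exprD [(i * N)%N]mulnC; ring.
have := ordOB _ _ _ _ (taylor_ordO R (N * i) rho sr); rewrite mulnC => /(_ _ (HS i)).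
apply: eq_ordO => s; rewrite mulnC T.
have -> : \sum_(k < i) s ^+ k * (r k (s ^+ i) - (taylor R (r k) N).[s ^+ i]) =
    \sum_(k < i) s ^+ k * r k (s ^+ i) - \sum_(k < i) s ^+ k * (taylor R (r k) N).[s ^+ i].
  by rewrite -sumrB; apply: eq_bigr => k _; rewrite mulrBr.
by ring.
Unshelve. all: by end_near. Qed.

Lemma flat_comp_opp (F : R -> R) : flat R F -> flat R (fun t => F (- t)).
Proof.
move=> fF n; have := ordO_comp_le n 1 F (fun t => - t) _ isT (fF n).
by rewrite mul1n; apply => t; rewrite normrN expr1.
Qed.

Lemma smg_comp_opp (F : R -> R) : smg R 0 F -> smg R 0 (fun t => F (- t)).
Proof.
move=> sF; apply: (@smg_comp R R 0 F (fun t => - t)); first by rewrite oppr0.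
by apply: smgN; exact: smg_id.
Qed.

Lemma rootX i (s : R) : (0 < i)%N -> 0 < s -> root R i (s ^+ i) = s.
Proof.
move=> i0 s0; apply/eqP; rewrite -(@eqrXn2 _ i) //; first by rewrite rootK // exprn_gt0.
- by rewrite ltW // root_gt0 // exprn_gt0.
- exact: ltW.
Qed.

Lemma flat_root_comp_smg (F : R -> R) i : (0 < i)%N -> smg R 0 F -> flat R F ->
  smg R 0 (fun t => F (root R i t)).
Proof.
move=> i0 sF fF; apply: eq_smg (flat_root_smg F i 0 i0 sF fF) => t.
by rewrite expr0 divr1.
Qed.

(** The flat remainder is split into its even and odd parts. The even part is a function of [s^2]
    through the square root, and the odd part becomes one after division by the root; flatness keeps
    both smooth. *)
Lemma decomposition_mod2 (rho : R -> R) : smg R 0 rho ->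
  exists r0 r1 : R -> R, [/\ smg R 0 r0, smg R 0 r1 &
  forall s, rho s = r0 (s ^+ 2) + s * r1 (s ^+ 2)].
Proof.
move=> sr; have [r [rs fF]] := decomposition_mod 2 rho isT sr.
set F := fun s => _ in fF.
have sF : smg R 0 F.
  apply: smgB => //; apply: smg_sum => k; apply: smgM; first by apply: smgX; exact: smg_id.
  apply: (@smg_comp R R 0 (r k) (fun s => s ^+ 2)); first by rewrite expr0n.
  by apply: smgX; exact: smg_id.
pose Fe s := 2^-1 * (F s + F (- s)); pose Fo s := 2^-1 * (F s - F (- s)).
have sFe : smg R 0 Fe.
  by apply: smgM; [exact: smg_cst|apply: smgD => //; exact: smg_comp_opp].
have sFo : smg R 0 Fo.
  by apply: smgM; [exact: smg_cst|apply: smgB => //; exact: smg_comp_opp].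
have fFe : flat R Fe.
  by move=> n; apply/ordOZ/ordOD; [exact: fF|exact: flat_comp_opp].
have fFo : flat R Fo.
  by move=> n; apply/ordOZ/ordOB; [exact: fF|exact: flat_comp_opp].
exists (fun w => r 0%N w + Fe (root R 2 w)).
exists (fun w => r 1%N w + Fo (root R 2 w) / root R 2 w ^+ 1); split.
- by apply: smgD => //; exact: flat_root_comp_smg.
- by apply: smgD => //; exact: flat_root_smg.
move=> s.
have -> : rho s = r 0%N (s ^+ 2) + s * r 1%N (s ^+ 2) + F s.
  by rewrite /F !big_ord_recr big_ord0 /= expr0 expr1; ring.
suff -> : F s = Fe (root R 2 (s ^+ 2)) + s * (Fo (root R 2 (s ^+ 2)) / root R 2 (s ^+ 2) ^+ 1).
  by ring.
rewrite expr1; have [s0|s0|->] := ltgtP s 0.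
- rewrite -sqrrN rootX ?oppr_gt0 // /Fe /Fo opprK.
  by have sn0 : s != 0 by [rewrite lt_eqF]; field.
- by rewrite rootX // /Fe /Fo; have sn0 : s != 0 by [rewrite gt_eqF]; field.
- by rewrite expr0n root0 // mul0r addr0 !flat0.
Qed.

(** Cubing is a bijection of the line, so the whole flat remainder is a function of [s^3] and joins
    [r0]. Its values for negative arguments come from the reflected function [Fn], since [root]
    vanishes there. *)
Lemma decomposition_mod3 (rho : R -> R) : smg R 0 rho ->
  exists r0 r1 r2 : R -> R, [/\ smg R 0 r0, smg R 0 r1, smg R 0 r2 &
  forall s, rho s = r0 (s ^+ 3) + s * r1 (s ^+ 3) + s ^+ 2 * r2 (s ^+ 3)].
Proof.
move=> sr; have [r [rs fF]] := decomposition_mod 3 rho isT sr.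
set F := fun s => _ in fF.
have sF : smg R 0 F.
  apply: smgB => //; apply: smg_sum => k; apply: smgM; first by apply: smgX; exact: smg_id.
  apply: (@smg_comp R R 0 (r k) (fun s => s ^+ 3)); first by rewrite expr0n.
  by apply: smgX; exact: smg_id.
pose Fn s := F (- s).
have sFn : smg R 0 Fn by exact: smg_comp_opp.
have fFn : flat R Fn by exact: flat_comp_opp.
exists (fun w => r 0%N w + (F (root R 3 w) + Fn (root R 3 (- w)))), (r 1%N), (r 2%N).
split => //.
  apply: smgD => //; apply: smgD; first exact: flat_root_comp_smg.
  apply: (smg_comp_opp (fun w => Fn (root R 3 w))); exact: flat_root_comp_smg.
move=> s.
have -> : rho s = r 0%N (s ^+ 3) + s * r 1%N (s ^+ 3) + s ^+ 2 * r 2%N (s ^+ 3) + F s.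
  by rewrite /F !big_ord_recr big_ord0 /= expr0 expr1; ring.
suff -> : F s = F (root R 3 (s ^+ 3)) + Fn (root R 3 (- s ^+ 3)) by ring.
have E : - s ^+ 3 = (- s) ^+ 3 by ring.
have [s0|s0|->] := ltgtP s 0.
- rewrite [root R 3 (s ^+ 3)]root0 ?E ?rootX ?oppr_gt0 //.
    by rewrite flat0 // add0r /Fn opprK.
  by rewrite -oppr_ge0 E exprn_ge0 // oppr_ge0 ltW.
- rewrite rootX // [root R 3 (- _)]root0; last first.
    by rewrite oppr_le0 exprn_ge0 // ltW.
  by rewrite (flat0 _ _ fFn) addr0.
- by rewrite expr0n /= oppr0 root0 // !(flat0 _ _ fFn) (flat0 _ _ fF) addr0.
Qed.
End Division.

(** * Diffeomorphism germs of the plane and of the line *)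

Section PlanarDiffeos.
Variable R : realType.

Lemma smg_near_neq0 (V : normedModType R) (p : V) (f : V -> R) :
  smg R p f -> f p != 0 -> \forall x \near p, f x != 0.
Proof.
move=> sf f0.
exact: (smg_continuous _ _ _ sf _ (open_nbhs_nbhs (conj (@open_neq R 0) f0))).
Qed.

Lemma smg_near_gt0 (V : normedModType R) (p : V) (f : V -> R) :
  smg R p f -> 0 < f p -> \forall x \near p, 0 < f x.
Proof.
move=> sf f0.
exact: (smg_continuous _ _ _ sf _ (open_nbhs_nbhs (conj (@open_gt R 0) f0))).
Qed.

Definition smooth_map2 (N : R * R -> R * R) :=
  [/\ N 0 = 0, smg R 0 (fun p => (N p).1) & smg R 0 (fun p => (N p).2)].

(** The local inverse is carried as data: each change of the target used below has an explicit
    inverse, and the inverse is what the target diffeomorphism of space is later built from. *)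
Definition planar_diffeo (N M : R * R -> R * R) :=
  [/\ smooth_map2 N, smooth_map2 M, \forall p \near (0 : R * R), M (N p) = p
    & \forall p \near (0 : R * R), N (M p) = p].

Lemma smooth_map2_near N (P : set (R * R)) : smooth_map2 N ->
  (\forall p \near (0 : R * R), P p) -> \forall p \near (0 : R * R), P (N p).
Proof.
move=> [N0 s1 s2] HP.
have cN : {for 0, continuous N}.
  have -> : N = fun p => ((N p).1, (N p).2).
    by apply/funext => p; exact: surjective_pairing.
  exact: differentiable_continuous (differentiable_pair
    (smg_differentiable _ _ _ s1) (smg_differentiable _ _ _ s2)).
by apply: (cN P); rewrite N0.
Qed.

Lemma smooth_map2_comp N N' : smooth_map2 N -> smooth_map2 N' -> smooth_map2 (N' \o N).
Proof.
move=> [N0 s1 s2] [N'0 s1' s2'].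
have E (k : R * R -> R) : smg R 0 k -> smg R 0 (fun p => k (N p)).
  move=> sk; have := @smg_comp2 R (R * R)%type 0 k _ _ _ s1 s2.
  rewrite -surjective_pairing N0 => /(_ sk) H.
  by apply: eq_smg H => p; rewrite -surjective_pairing.
by split; [rewrite /= N0|exact: (E (fun p => (N' p).1))|exact: (E (fun p => (N' p).2))].
Qed.

Lemma planar_diffeo_comp N M N' M' : planar_diffeo N M -> planar_diffeo N' M' ->
  planar_diffeo (N' \o N) (M \o M').
Proof.
move=> [sN sM MN NM] [sN' sM' MN' NM']; split; try exact: smooth_map2_comp.
- by apply: filterS2 MN (smooth_map2_near _ _ sN MN') => p /= e ->.
- by apply: filterS2 NM' (smooth_map2_near _ _ sM' NM) => p /= e ->.
Qed.

Definition line_diffeo (s t : R -> R) :=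
  [/\ s 0 = 0, t 0 = 0, smg R 0 s & smg R 0 t] /\
  (\forall x \near (0 : R), t (s x) = x) /\ (\forall x \near (0 : R), s (t x) = x).

Lemma line_diffeo_comp s t s' t' : line_diffeo s t -> line_diffeo s' t' ->
  line_diffeo (s' \o s) (t \o t').
Proof.
move=> [[s0 t0 ss st] [ts st1]] [[s0' t0' ss' st'] [ts' st1']].
have near_comp (f : R -> R) (P : set R) : f 0 = 0 -> smg R 0 f ->
    (\forall x \near (0 : R), P x) -> \forall x \near (0 : R), P (f x).
  move=> f0 /smg_continuous cf HP; apply: (cf P); by rewrite f0.
split; first split; rewrite /= ?s0 ?s0' ?t0' ?t0 //.
- by apply: (@smg_comp R R 0 s' s) => //; rewrite s0.
- by apply: (@smg_comp R R 0 t t') => //; rewrite t0'.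
split.
- by apply: filterS2 ts (near_comp _ _ s0 ss ts') => x /= e ->.
- by apply: filterS2 st1' (near_comp _ _ t0' st' st1) => x /= e ->.
Qed.

Lemma line_diffeo_id : line_diffeo id id.
Proof.
split; split => //; try exact: smg_id; by near=> x.
Unshelve. all: by end_near. Qed.

Lemma line_diffeo_exists s : smg R 0 s -> s 0 = 0 -> derive1 s 0 != 0 ->
  exists t, line_diffeo s t.
Proof.
move=> ss s0 ds; have [t [st t0 ts st1]] := smg_inverse R s 0 ss ds.
by rewrite s0 in st t0 st1; exists t.
Qed.

Definition planar_cusp (i j : nat) (c : R -> R * R) :=
  exists N M s t, [/\ planar_diffeo N M, line_diffeo s t
    & \forall x \near (0 : R), N (c x) = (s x ^+ i, s x ^+ j)].

Lemma planar_cusp_model i j (c : R -> R * R) :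
  (\forall x \near (0 : R), c x = (x ^+ i, x ^+ j)) -> planar_cusp i j c.
Proof.
move=> H; exists id, id, id, id; split => //; last exact: line_diffeo_id.
have I : smooth_map2 id by split => //; [exact: smg_fst|exact: smg_snd].
by split => //; near=> p.
Unshelve. all: by end_near. Qed.

Lemma planar_cusp_left i j L L' (c : R -> R * R) : planar_diffeo L L' ->
  planar_cusp i j (L \o c) -> planar_cusp i j c.
Proof.
move=> dL [N [M [s [t [dN dst H]]]]]; exists (N \o L), (L' \o M), s, t; split => //.
exact: planar_diffeo_comp dN.
Qed.

Lemma planar_cusp_right i j s t (c c' : R -> R * R) : line_diffeo s t ->
  (\forall x \near (0 : R), c x = c' (s x)) -> planar_cusp i j c' -> planar_cusp i j c.
Proof.
move=> dst cc' [N [M [s' [t' [dN dst' H]]]]]; exists N, M, (s' \o s), (t \o t').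
split => //; first exact: line_diffeo_comp.
have := smg_continuous _ _ _ (let: conj (And4 _ _ ss _) _ := dst in ss).
have s0 : s 0 = 0 by case: dst => -[].
move=> /(_ (fun x => N (c' x) = (s' x ^+ i, s' x ^+ j))); rewrite s0 => /(_ H) H'.
by apply: filterS2 cc' H' => x -> /= ->.
Qed.

Lemma smg_fst_comp (A : R -> R) (p : R * R) : smg R p.1 A -> smg R p (fun p => A p.1).
Proof. by move=> sA; apply: (@smg_comp R _ p A fst) => //; exact: smg_fst. Qed.

(** This change removes from the second coordinate a function [A] of the first and divides out a
    unit [B]. *)
Lemma shear_diffeo (A B : R -> R) : smg R 0 A -> smg R 0 B -> A 0 = 0 -> B 0 != 0 ->
  planar_diffeo (fun p => (p.1, (p.2 - A p.1) / B p.1))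
                (fun p => (p.1, p.2 * B p.1 + A p.1)).
Proof.
move=> sA sB A0 B0.
have sA2 : smg R (0 : R * R) (fun p => A p.1) by exact: smg_fst_comp.
have sB2 : smg R (0 : R * R) (fun p => B p.1) by exact: smg_fst_comp.
have nB : \forall p \near (0 : R * R), B p.1 != 0 by exact: smg_near_neq0.
split.
- split => /=; [by rewrite A0 subrr mul0r|exact: smg_fst|].
  apply: smgM; last exact: smgV.
  by apply: smgB => //; exact: smg_snd.
- split => /=; [by rewrite A0 mul0r addr0|exact: smg_fst|].
  by apply: smgD => //; apply: smgM => //; exact: smg_snd.
- by apply: filterS nB => -[x y] /= Bx; rewrite divfK // subrK.
- by apply: filterS nB => -[x y] /= Bx; rewrite addrK mulfK.
Qed.

Lemma linear_diffeo (e k : R) : e != 0 ->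
  planar_diffeo (fun p => (e * p.1 + k * p.2, p.2)) (fun p => (e^-1 * (p.1 - k * p.2), p.2)).
Proof.
move=> e0.
have s1 (c : R) : smg R (0 : R * R) (fun p => c * p.1).
  by apply: smgM; [exact: smg_cst|exact: smg_fst].
have s2 (c : R) : smg R (0 : R * R) (fun p => c * p.2).
  by apply: smgM; [exact: smg_cst|exact: smg_snd].
split.
- by split; [rewrite /= !mulr0 addr0|exact: smgD|exact: smg_snd].
- split; [by rewrite /= !mulr0 subr0 mulr0|apply: smgM|exact: smg_snd].
    exact: smg_cst.
  by apply: smgB => //; exact: smg_fst.
- by near=> p; rewrite /= addrK mulKf //; case: (p).
- by near=> p; rewrite /= mulVKf // subrK; case: (p).
Unshelve. all: by end_near. Qed.

(* The right inverse solves the quadratic equation [Y - m Y^2 = q] in the form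
   [Y = 2 q / (1 + sqrt (1 - 4 m q))], which is smooth also where [m] vanishes. *)
Lemma quadratic_diffeo (m : R -> R) j : (0 < j)%N -> smg R 0 m ->
  exists M, planar_diffeo (fun p => (p.1,
    (p.2 - m p.1 * p.2 ^+ 2 + 2 * m p.1 ^+ 2 * p.1 ^+ j) / (1 - m p.1 ^+ 3 * p.1 ^+ j))) M.
Proof.
move=> j0 sm0.
have sm2 : smg R (0 : R * R) (fun p => m p.1) by exact: smg_fst_comp.
have sX : smg R (0 : R * R) (fun p => p.1 ^+ j) by apply: smgX; exact: smg_fst.
have sY : smg R (0 : R * R) snd by exact: smg_snd.
pose D (p : R * R) := 1 - m p.1 ^+ 3 * p.1 ^+ j.
have sD : smg R 0 D.
  by apply: smgB; [exact: smg_cst|apply: smgM => //; exact: smgX].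
have D0 : D 0 != 0 by rewrite /D /= expr0n gtn_eqF // mulr0 subr0 oner_neq0.
pose E (p : R * R) := 2 * m p.1 ^+ 2 * p.1 ^+ j.
have sE : smg R 0 E.
  by apply: smgM => //; apply: smgM; [exact: smg_cst|exact: smgX].
have E0 : E 0 = 0 by rewrite /E /= expr0n gtn_eqF // mulr0.
pose q p := p.2 * D p - E p.
have sq : smg R 0 q by apply: smgB => //; exact: smgM.
have q0 : q 0 = 0 by rewrite /q E0 mul0r subr0.
pose disc p := 1 - 4 * m p.1 * q p.
have sdisc : smg R 0 disc.
  by apply: smgB; [exact: smg_cst|apply: smgM => //; apply: smgM => //; exact: smg_cst].
have disc0 : disc 0 = 1 by rewrite /disc q0 mulr0 subr0.
pose S p := root R 2 (disc p).
have sS : smg R 0 S by apply: (@smg_comp R _ 0 (root R 2)) => //; apply: smg_root; rewrite disc0.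
have S0 : 0 < S 0 by apply: root_gt0; rewrite disc0.
exists (fun p => (p.1, 2 * q p / (1 + S p))).
pose L (p : R * R) := (p.1, (p.2 - m p.1 * p.2 ^+ 2 + E p) / D p).
have sL : smooth_map2 L.
  split; [by rewrite /L /= E0 expr0n mulr0 subr0 addr0 mul0r|exact: smg_fst|].
  apply: smgM; last exact: smgV.
  by apply: smgD => //; apply: smgB => //; apply: smgM => //; exact: smgX.
have nD : \forall p \near (0 : R * R), D p != 0 by exact: smg_near_neq0.
have ndisc : \forall p \near (0 : R * R), 0 < disc p.
  by apply: smg_near_gt0 => //; rewrite disc0.
split => //.
- split; [by rewrite /= q0 mulr0 mul0r|exact: smg_fst|].
  apply: smgM; first by apply: smgM => //; exact: smg_cst.
  apply: smgV; first by rewrite gt_eqF // addr_gt0.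
  by apply: smgD => //; exact: smg_cst.
(* Positivity selects the square root [1 - 2 m y] of the discriminant, and not its opposite. *)
- have npos : \forall p \near (0 : R * R), 0 < 1 - 2 * m p.1 * p.2.
    apply: smg_near_gt0; last by rewrite /= mulr0 subr0.
    by apply: smgB; [exact: smg_cst|apply: smgM => //; apply: smgM => //; exact: smg_cst].
  apply: filterS2 nD npos => -[x y]; rewrite /S /disc /q /E /D /= => Dp np.
  set mm := m x in Dp np *; set X := x ^+ j in Dp *.
  rewrite divfK // addrK.
  have -> : 1 - 4 * mm * (y - mm * y ^+ 2) = (1 - 2 * mm * y) ^+ 2 by ring.
  rewrite rootX //; congr pair.
  have n1 : 1 - mm * y != 0.
    by apply/eqP => e; move: np; rewrite -mulrA (_ : mm * y = 1) ?mulr1; lra.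
  have -> : 1 + (1 - 2 * mm * y) = 2 * (1 - mm * y) by ring.
  by field; rewrite n1.
- apply: filterS2 nD ndisc => -[x y] Dp dp.
  have S2 : S (x, y) ^+ 2 = disc (x, y) by apply: rootK.
  have Sp : 0 < S (x, y) by exact: root_gt0.
  move: S2 Sp; rewrite /disc /=; move: (S (x, y)) => s S2 Sp.
  have s1 : 1 + s != 0 by rewrite gt_eqF // addr_gt0.
  congr pair; move: S2 Dp; rewrite /q /D /E /=.
  set mm := m x; set X := x ^+ j => S2 Dp.
  set Q := y * _ - _ in S2 *.
  apply: (canLR (mulfK Dp)).
  have E1 : mm * (2 * Q / (1 + s)) ^+ 2 = Q * (1 - s) / (1 + s).
    have -> : mm * (2 * Q / (1 + s)) ^+ 2 = (4 * mm * Q) * Q / (1 + s) ^+ 2 by field.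
    have -> : 4 * mm * Q = 1 - s ^+ 2 by rewrite S2; ring.
    by field.
  rewrite E1; have -> : 2 * Q / (1 + s) - Q * (1 - s) / (1 + s) = Q by field.
  by rewrite /Q; ring.
Qed.
End PlanarDiffeos.

(** * Normal forms of plane curves of order two *)

Section PlanarNormalForms.
Variable R : realType.

Lemma smg_comp_line (s t f : R -> R) : line_diffeo R s t -> smg R 0 f ->
  smg R 0 (fun x : R => f (t x)).
Proof. by move=> [[s0 t0 ss st] _] sf; apply: (@smg_comp R R 0 f t) => //; rewrite t0. Qed.

Lemma smg_mulid (w : R -> R) : smg R 0 w -> smg R 0 (fun x : R => x * w x).
Proof. by move=> sw; apply: smgM => //; exact: smg_id. Qed.

(** The new parameter is [s = x w] with [w] the i-th root of [g], so that [s^i = x^i g x]; its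
    derivative at 0 is [w 0], which is positive. *)
Lemma straighten i (g : R -> R) : (0 < i)%N -> smg R 0 g -> 0 < g 0 ->
  exists w t : R -> R, [/\ smg R 0 w, line_diffeo R (fun x => x * w x) t,
    w = (fun x => root R i (g x)) & \forall x \near (0 : R), 0 < w x /\ w x ^+ i = g x].
Proof.
move=> i0 sg g0; pose w x := root R i (g x).
have sw : smg R 0 w by apply: (@smg_comp R R 0 (root R i)) => //; exact: smg_root.
have [|t Ht] := line_diffeo_exists R _ (smg_mulid _ sw) (mul0r _).
  have dw := smg_is_derive _ _ _ sw.
  have dm := is_deriveM (is_derive_id (0 : R) 1) dw.
  rewrite derive1E (_ : (fun x : R => x * w x) = id * w) //.
  by rewrite (@derive_val _ _ _ _ _ _ _ dm) /GRing.scale /= mul0r add0r mulr1 gt_eqF // root_gt0.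
exists w, t; split => //.
have ng := smg_near_gt0 _ _ _ _ sg g0.
by apply: filterS ng => x gx; split; [exact: root_gt0|exact: rootK].
Qed.

Lemma planar_cusp_eq i j (c c' : R -> R * R) : (\forall x \near (0 : R), c x = c' x) ->
  planar_cusp R i j c' -> planar_cusp R i j c.
Proof.
move=> cc'; apply: (planar_cusp_right R i j id id) => //; exact: line_diffeo_id.
Qed.

(** The witnesses [w] and [t] stay visible because the treatment of order three has to expand
    [w]. *)
Lemma planar_cusp_straighten i j (c : R -> R * R) (g h : R -> R) : (0 < i)%N ->
  smg R 0 g -> smg R 0 h -> 0 < g 0 ->
  (\forall x \near (0 : R), c x = (x ^+ i * g x, x ^+ j * h x)) ->
  exists w t : R -> R, [/\ smg R 0 w, line_diffeo R (fun x => x * w x) t,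
    w = (fun x => root R i (g x)) &
    planar_cusp R i j (fun s : R => (s ^+ i, s ^+ j * (h (t s) / w (t s) ^+ j))) ->
    planar_cusp R i j c].
Proof.
move=> i0 sg sh g0 cE; have [w [t [sw dt wE nw]]] := straighten i g i0 sg g0.
exists w, t; split => //; apply: (planar_cusp_right _ _ _ _ _ _ _ dt).
have [_ [ts _]] := dt; near=> x.
have -> : c x = (x ^+ i * g x, x ^+ j * h x) by near: x.
have tsx : t (x * w x) = x by near: x.
have [wx wg] : 0 < w x /\ w x ^+ i = g x by near: x.
have wj : w x ^+ j != 0 by rewrite expf_neq0 // gt_eqF.
by rewrite tsx !exprMn wg -mulrA [w x ^+ j * _]mulrC divfK.
Unshelve. all: by end_near. Qed.

Lemma smg_X (P : R -> R) n : (0 < n)%N -> smg R 0 P -> smg R 0 (fun x : R => P (x ^+ n)).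
Proof.
move=> n0 sP; apply: (@smg_comp R R 0 P (fun x => x ^+ n)).
  by rewrite expr0n gtn_eqF.
by apply: smgX; exact: smg_id.
Qed.

(** Roots are available for positive numbers only, so a leading coefficient of unknown sign is first
    divided out by a linear change of the target. *)
Lemma planar_cusp_scale i j (c : R -> R * R) (g h : R -> R) : g 0 != 0 ->
  (\forall x \near (0 : R), c x = (x ^+ i * g x, x ^+ j * h x)) ->
  planar_cusp R i j (fun x : R => (x ^+ i * ((g 0)^-1 * g x), x ^+ j * h x)) ->
  planar_cusp R i j c.
Proof.
move=> g0 cE H; apply: (planar_cusp_left R i j _ _ _ (linear_diffeo R _ 0 (invr_neq0 g0))).
apply: planar_cusp_eq H; apply: filterS cE => x /= -> /=.
by rewrite mul0r addr0 mulrCA.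
Qed.

(** Once the first coordinate is [X = s^2], write the cofactor as [a (X) + s b (X)]. The second
    coordinate is then [s^(2m+1) a (X) + X^(m+1) b (X)], and one shear brings it to [s^(2m+1)]. *)
Lemma planar_cusp2 m (c : R -> R * R) (g h : R -> R) :
  smg R 0 g -> smg R 0 h -> g 0 != 0 -> h 0 != 0 ->
  (\forall x \near (0 : R), c x = (x ^+ 2 * g x, x ^+ m.*2.+1 * h x)) ->
  planar_cusp R 2 m.*2.+1 c.
Proof.
move=> sg sh g0 h0 cE; apply: (planar_cusp_scale _ _ _ _ _ g0 cE).
have sg1 : smg R 0 (fun x : R => (g 0)^-1 * g x) by apply: smgM => //; exact: smg_cst.
have g1 : 0 < (g 0)^-1 * g 0 by rewrite mulVf.
set c' := fun x => (_, _).
have [|w [t [sw dt wE]]] := planar_cusp_straighten 2 m.*2.+1 c' _ h isT sg1 sh g1.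
  by near=> x.
apply.
have w0 : w 0 != 0 by rewrite wE gt_eqF // root_gt0.
pose H s := h (t s) / w (t s) ^+ m.*2.+1.
have sH : smg R 0 H.
  apply: (smg_comp_line _ _ (fun x => h x / w x ^+ m.*2.+1) dt).
  by apply: smgM => //; apply: smgV; [rewrite expf_neq0|exact: smgX].
have t0 : t 0 = 0 by case: dt => -[].
have H0 : H 0 != 0 by rewrite /H t0 mulf_neq0 // invr_neq0 // expf_neq0.
have [a [b [sa sb HE]]] := decomposition_mod2 R H sH.
have a0 : a 0 != 0 by move: H0; rewrite HE expr0n mul0r addr0.
have sA : smg R 0 (fun x : R => x ^+ m.+1 * b x).
  by apply: smgM => //; apply: smgX; exact: smg_id.
have A0 : (0 : R) ^+ m.+1 * b 0 = 0 by rewrite expr0n mul0r.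
apply: (planar_cusp_left R _ _ _ _ _ (shear_diffeo R _ _ sA sa A0 a0)).
apply: planar_cusp_model.
have na := smg_near_neq0 _ _ _ _ (smg_X a 2 isT sa).
rewrite expr0n in na.
apply: filterS (na a0) => s sa0 /=; congr pair.
rewrite -/(H s) HE; apply: (canLR (mulfK sa0)).
rewrite mulrDr -exprM mul2n doubleS.
by rewrite [s ^+ m.*2.+2]exprS; ring.
Unshelve. all: by end_near. Qed.
End PlanarNormalForms.

(** * Normal forms of plane curves of order three *)

Section PlanarNormalForms3.
Variable R : realType.

Lemma taylor0 (f : R -> R) (t : R) : (taylor R f 0).[t] = 0.
Proof. by rewrite horner_poly big_ord0. Qed.

Lemma taylorS (f : R -> R) n (t : R) :
  (taylor R f n.+1).[t] = (taylor R f n).[t] + coefT R f n * t ^+ n.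
Proof. by rewrite !horner_poly big_ord_recr. Qed.

Lemma smg_1D (V : normedModType R) (p : V) (f : V -> R) : smg R p f -> smg R p (fun x => 1 + f x).
Proof. by move=> sf; apply: smgD => //; exact: smg_cst. Qed.

Lemma smg_mono (f : R -> R) n : smg R 0 f -> smg R 0 (fun s : R => s ^+ n * f s).
Proof. by move=> sf; apply: smgM => //; apply: smgX; exact: smg_id. Qed.

Lemma smgZ (c : R) (f : R -> R) : smg R 0 f -> smg R 0 (fun s : R => c * f s).
Proof. by move=> sf; apply: smgM => //; exact: smg_cst. Qed.

(** The coefficient is [a = - j / i]; that it is nonzero is what allows the gap term to be
    cancelled. *)
Lemma negative_power_expansion i j : (0 < i)%N -> (0 < j)%N ->
  exists (a : R) (E : R -> R), [/\ a != 0, smg R 0 E &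
    \forall y \near (0 : R), root R i (1 + y) ^- j = 1 + a * y + y ^+ 2 * E y].
Proof.
move=> i0 j0; pose c : R := - (j%:R / i%:R).
pose F (y : R) := expR (c * ln (1 + y)).
have s1 : smg R 0 (fun y : R => 1 + y) by apply: smg_1D; exact: smg_id.
have sF : smg R 0 F.
  apply: (@smg_comp R R 0 expR (fun y => c * ln (1 + y))); first exact: smg_expR.
  by apply/smgZ/(@smg_comp R R 0 (@ln R)) => //; apply: smg_ln; rewrite addr0.
have [E [sE FE]] := smooth_taylor R 2 F sF.
have F0 : F 0 = 1 by rewrite /F addr0 ln1 mulr0 expR0.
have F1 : derive1 F 0 = c.
  have d0 : is_derive (0 : R) 1 (fun y : R => 1 + y) 1.
    have := is_deriveD (is_derive_cst (1 : R) (0 : R) 1) (is_derive_id (0 : R) 1).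
    by rewrite add0r.
  have d1 : is_derive (0 : R) 1 (fun y : R => ln (1 + y)) 1.
    have dl : is_derive ((fun y : R => 1 + y) 0) 1 (@ln R) (1 + 0)^-1.
      by apply: is_derive1_ln; rewrite addr0.
    have := @is_derive1_comp R _ _ _ _ _ dl d0.
    by rewrite addr0 invr1 mulr1.
  have d2 : is_derive (0 : R) 1 (fun y : R => c * ln (1 + y)) c.
    by apply: (is_derive_eq (is_deriveZ c d1)); rewrite /GRing.scale /= mulr1.
  have := @is_derive1_comp R expR _ _ _ _ (is_derive_expR _) d2.
  by rewrite addr0 ln1 mulr0 expR0 mul1r derive1E => D; rewrite (@derive_val _ _ _ _ _ _ _ D).
exists c, E; split => //.
  by rewrite oppr_eq0 mulf_neq0 ?invr_eq0 ?pnatr_eq0 -?lt0n.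
have n1 : \forall y \near (0 : R), 0 < 1 + y by apply: (smg_near_gt0 R R 0) => //; rewrite addr0.
apply: filterS n1 => y y1.
have := FE y; rewrite !taylorS taylor0 add0r /coefT derive1n0 derive1n1 F0 F1 !divr1 mul1r expr0 expr1 => <-.
rewrite /F /root y1 -expRM_natl -expRN; congr expR.
by rewrite /c; ring.
Qed.

Lemma root_expansion i : (0 < i)%N ->
  exists W : R -> R, smg R 0 W /\ forall y, root R i (1 + y) = 1 + y * W y.
Proof.
move=> i0.
have sw : smg R 0 (fun y : R => root R i (1 + y)).
  apply: (@smg_comp R R 0 (root R i) (fun y => 1 + y)); first by apply: smg_root; rewrite addr0.
  by apply: smg_1D; exact: smg_id.
have [W [sW WE]] := smooth_taylor R 1 _ sw.
exists W; split => // y; rewrite WE taylorS taylor0 add0r coefT0 addr0 expr0 mulr1 expr1.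
by rewrite /root ltr01 ln1 mul0r expR0.
Qed.

(** After the shear the curve is [(X, Y) = (s^3, S + m S^2)] with [S = s^j], hence [S^3 = X^j]. Then
    [Y - m Y^2 = S (1 - m^3 X^j) - 2 m^2 X^j], so [quadratic_diffeo] is exactly the map that returns
    [S]. *)
Lemma planar_cusp3_gapfree j (A B C : R -> R) (c : R -> R * R) : (0 < j)%N ->
  smg R 0 A -> smg R 0 B -> smg R 0 C -> A 0 = 0 -> B 0 != 0 ->
  (\forall s \near (0 : R), c s =
    (s ^+ 3, A (s ^+ 3) + s ^+ j * B (s ^+ 3) + s ^+ (j * 2) * C (s ^+ 3))) ->
  planar_cusp R 3 j c.
Proof.
move=> j0 sA sB sC A0 B0 cE.
apply: (planar_cusp_left R _ _ _ _ _ (shear_diffeo R _ _ sA sB A0 B0)).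
pose m x := C x / B x.
have sm0 : smg R 0 m by apply: smgM => //; exact: smgV.
have [M dM] := quadratic_diffeo R m j j0 sm0.
apply: (planar_cusp_left R _ _ _ _ _ dM); apply: planar_cusp_model.
have nB := smg_near_neq0 _ _ _ _ (smg_X R B 3 isT sB).
rewrite expr0n in nB.
have nD : \forall s \near (0 : R), 1 - m (s ^+ 3) ^+ 3 * (s ^+ 3) ^+ j != 0.
  apply: (smg_near_neq0 R R 0 (fun s : R => 1 - m (s ^+ 3) ^+ 3 * (s ^+ 3) ^+ j)); last first.
    by rewrite [X in X ^+ j]expr0n [X in _ * X]expr0n gtn_eqF // mulr0 subr0 oner_neq0.
  apply: smgB; first exact: smg_cst.
  apply: smgM; first by apply: smgX; apply: smg_X.
  by apply: smgX; apply: smgX; exact: smg_id.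
apply: filterS3 cE (nB B0) nD => s cs Bs Ds; rewrite /= cs /=.
move: Ds; rewrite /m; set b := B _ in Bs *; set a := A _; set c0 := C _ => Ds.
congr pair; apply: (canLR (mulfK Ds)).
have -> : (s ^+ 3) ^+ j = (s ^+ j) ^+ 3 by rewrite -!exprM mulnC.
rewrite exprM; set S := s ^+ j.
by field.
Qed.

(** [he] is the coefficient that produces the gap exponent [3 + 2 e]. A lower coefficient [p1]
    occurs only for [e = 2], where it produces [s^6], a function of [s^3]. *)
Lemma exists_coefficients e (H : R -> R) : (e == 1)%N || (e == 2)%N -> smg R 0 H ->
  exists (p1 he : R) (q : R -> R), [/\ e = 1%N -> p1 = 0, smg R 0 q &
    forall s, H s = H 0 + p1 * s + he * s ^+ e + s ^+ e.+1 * q s].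
Proof.
move=> /orP[] /eqP -> sH.
- have [q [sq HE]] := smooth_taylor R 2 H sH.
  exists 0, (coefT R H 1), q; split => // s.
  by rewrite {1}HE !taylorS taylor0 coefT0 expr0 mulr1; ring.
- have [q [sq HE]] := smooth_taylor R 3 H sH.
  exists (coefT R H 1), (coefT R H 2), q; split => // s.
  by rewrite {1}HE !taylorS taylor0 coefT0 expr0 mulr1; ring.
Qed.

(** Adding [kap] times the second coordinate to the first turns [s^3] into [s^3 (1 + kap s^e H)].
    Straightening again multiplies the second coordinate by a power [- (3 + e) / 3] of that factor,
    which changes the coefficient of [s^e] in the cofactor by a multiple of [kap]. *)
Lemma planar_cusp3_reduced e (c : R -> R * R) (H : R -> R) : (e == 1)%N || (e == 2)%N ->
  smg R 0 H -> H 0 != 0 ->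
  (\forall s \near (0 : R), c s = (s ^+ 3, s ^+ (3 + e) * H s)) ->
  planar_cusp R 3 (3 + e) c.
Proof.
move=> e12 sH H0 cE.
have e0 : (0 < e)%N by case/orP: e12 => /eqP ->.
have [p1 [he [q [p10 sq HE]]]] := exists_coefficients e H e12 sH.
have [H1 [sH1 H1E']] := smooth_taylor R 1 H sH.
have H1E s : H s = H 0 + s * H1 s.
  by rewrite {1}H1E' taylorS taylor0 coefT0 expr0 mulr1 add0r expr1.
have [a [E [a0 sE EE]]] := negative_power_expansion 3 (3 + e) isT isT.
have [W [sW WE]] := root_expansion 3 isT.
(* This solves [he + a kap (H 0)^2 = 0]. *)
pose kap := - he / (a * H 0 ^+ 2).
pose y s := kap * (s ^+ e * H s).
have sy : smg R 0 y by apply/smgZ/smg_mono.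
have y0 : y 0 = 0 by rewrite /y expr0n gtn_eqF // mul0r mulr0.
pose g s := 1 + y s.
have sg : smg R 0 g by exact: smg_1D.
have g0 : 0 < g 0 by rewrite /g y0 addr0.
apply: (planar_cusp_left R _ _ _ _ _ (linear_diffeo R 1 kap (oner_neq0 R))).
have [|w [t [sw dt wE]]] := planar_cusp_straighten R 3 (3 + e)
    (fun s : R => (s ^+ 3 * g s, s ^+ (3 + e) * H s)) g H isT sg sH g0.
  by near=> s.
move=> PC; apply: (planar_cusp_eq R _ _ _ (fun s : R => (s ^+ 3 * g s, s ^+ (3 + e) * H s))).
  apply: filterS cE => s /= ->; rewrite mul1r /= /g /y exprD.
  by congr pair; ring.
apply: PC.
pose om s := kap * H s * W (y s).
have som : smg R 0 om.
  apply: smgM; first exact: smgZ.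
  by apply: (@smg_comp R R 0 W y) => //; rewrite y0.
have wom s : w s = 1 + s ^+ e * om s.
  by rewrite wE /g WE /om /y; ring.
(* [Q] collects what is left of order at least [e + 1], divided by [s^(e+1)]: the tail of [H], the
   variation of [H^2] in the linear correction, and the quadratic correction, where
   [s^(2e) = s^(e+1) s^(e-1)]. *)
pose Q s := q s + a * kap * (2 * H 0 * H1 s + s * H1 s ^+ 2)
   + s ^+ e.-1 * (kap ^+ 2 * (H s ^+ 3 * E (y s))).
have sEy : smg R 0 (fun s : R => E (y s)) by apply: (@smg_comp R R 0 E y) => //; rewrite y0.
have sQ : smg R 0 Q.
  apply: smgD; last first.
    by apply/smg_mono/smgZ/smgM => //; exact: smgX.
  apply: smgD => //; apply: smgZ; apply: smgD; first exact: smgZ.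
  by apply: smgM; [exact: smg_id|exact: smgX].
have w0 : w 0 != 0 by rewrite wE gt_eqF // root_gt0.
(* The term [p1 s] is rewritten in the new parameter [s w]; as [w = 1 + s^e om], the difference is
   [- p1 s^(e+1) om]. *)
pose rho0 s := (Q s - p1 * om s) / w s ^+ e.+1.
have srho : smg R 0 (fun s : R => rho0 (t s)).
  apply: (smg_comp_line R _ _ _ dt); apply: smgM.
    by apply: smgB => //; exact: smgZ.
  by apply: smgV; [rewrite expf_neq0|exact: smgX].
have nE : \forall s \near (0 : R), H s / w s ^+ (3 + e) =
    H 0 + p1 * (s * w s) + (s * w s) ^+ e.+1 * rho0 s.
  have ny : \forall s \near (0 : R), root R 3 (1 + y s) ^- (3 + e) = 1 + a * y s + y s ^+ 2 * E (y s).
    by apply: (smg_continuous _ _ _ sy (fun y => root R 3 (1 + y) ^- (3 + e) = 1 + a * y + y ^+ 2 * E y)); rewrite y0.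
  have nw := smg_near_neq0 _ _ _ _ sw w0.
  apply: filterS2 ny nw => s Ey ws.
  have -> : H s / w s ^+ (3 + e) = H s * (1 + a * y s + y s ^+ 2 * E (y s)).
    by rewrite -Ey wE.
  have -> : (s * w s) ^+ e.+1 * rho0 s = s ^+ e.+1 * (Q s - p1 * om s).
    rewrite /rho0 exprMn -mulrA [w s ^+ _ * _]mulrC divfK //.
    by rewrite expf_neq0.
  rewrite {1}wom /Q.
  have -> : H s * (1 + a * y s + y s ^+ 2 * E (y s)) =
      H s + a * kap * s ^+ e * H s ^+ 2 + s ^+ e * s ^+ e * (kap ^+ 2 * (H s ^+ 3 * E (y s))).
    by rewrite /y; ring.
  have -> : H s ^+ 2 = H 0 ^+ 2 + s * (2 * H 0 * H1 s + s * H1 s ^+ 2).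
    by rewrite H1E; ring.
  rewrite {1}HE.
  have he0 : he = - (a * kap * H 0 ^+ 2).
    by rewrite /kap; field; rewrite a0 H0.
  rewrite he0; have -> : s ^+ e.+1 = s * (s * s ^+ e.-1) by rewrite -!exprS prednK.
  have -> : s ^+ e = s * s ^+ e.-1 by rewrite -exprS prednK.
  by ring.
apply: (planar_cusp_eq R _ _ _ (fun s : R => (s ^+ 3,
   s ^+ (3 + e) * (H 0 + p1 * s + s ^+ e.+1 * rho0 (t s))))).
  have [[_ t0 _ st] [_ wt]] := dt.
  have ct (P : set R) : (\forall x \near (0 : R), P x) -> \forall x \near (0 : R), P (t x).
    by move=> HP; apply: (smg_continuous _ _ _ st P); rewrite t0.
  have nE' := ct _ nE.
  by apply: filterS2 nE' wt => s /= -> ->.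
have [r0 [r1 [r2 [sr0 sr1 sr2 rE]]]] := decomposition_mod3 R _ srho.
case/orP: e12 => /eqP e1; move: p10; rewrite e1 => p10.
(* For [j = 4] the remainder is [s^6 r0 + s^7 r1 + s^8 r2], that is, a function of [s^3], a multiple
   of [s^4] and a multiple of [(s^4)^2]. *)
- apply: (planar_cusp3_gapfree 4 (fun x => x ^+ 2 * r0 x) (fun x => H 0 + x ^+ 1 * r1 x) r2) => //.
  + exact: smg_mono.
  + by apply: smgD; [exact: smg_cst|exact: smg_mono].
  + by rewrite expr0n mul0r.
  + by rewrite expr1 mul0r addr0.
  + by near=> s; rewrite rE p10 //; congr pair; ring.
(* For [j = 5] the remainder is [s^8 r0 + s^9 r1 + s^10 r2], so [r0] joins the unit and [r1] the
   function of [s^3]. *)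
- apply: (planar_cusp3_gapfree 5 (fun x => x ^+ 2 * (p1 + x ^+ 1 * r1 x)) (fun x => H 0 + x ^+ 1 * r0 x) r2) => //.
  + by apply/smg_mono/smgD; [exact: smg_cst|exact: smg_mono].
  + by apply: smgD; [exact: smg_cst|exact: smg_mono].
  + by rewrite expr0n mul0r.
  + by rewrite expr1 mul0r addr0.
  + by near=> s; rewrite rE; congr pair; ring.
Unshelve. all: by end_near. Qed.
End PlanarNormalForms3.

(** * From the plane curve to the helicoidal surface *)

Section Suspension.
Variable R : realType.

Lemma planar_cusp3 e (c : R -> R * R) (g h : R -> R) : (e == 1)%N || (e == 2)%N ->
  smg R 0 g -> smg R 0 h -> g 0 != 0 -> h 0 != 0 ->
  (\forall x \near (0 : R), c x = (x ^+ 3 * g x, x ^+ (3 + e) * h x)) ->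
  planar_cusp R 3 (3 + e) c.
Proof.
move=> e12 sg sh g0 h0 cE; apply: (planar_cusp_scale _ _ _ _ _ _ g0 cE).
have sg1 : smg R 0 (fun x => (g 0)^-1 * g x) by apply: smgM => //; exact: smg_cst.
have g1 : 0 < (g 0)^-1 * g 0 by rewrite mulVf.
set c' := fun x => (_, _).
have [|w [t [sw dt wE]]] := planar_cusp_straighten R 3 (3 + e) c' _ h isT sg1 sh g1.
  by near=> x.
apply.
have w0 : w 0 != 0 by rewrite wE gt_eqF // root_gt0.
have t0 : t 0 = 0 by case: dt => -[].
apply: (planar_cusp3_reduced R e _ (fun s => h (t s) / w (t s) ^+ (3 + e)) e12).
- apply: (smg_comp_line R _ _ (fun x => h x / w x ^+ (3 + e)) dt).
  by apply: smgM => //; apply: smgV; [rewrite expf_neq0|exact: smgX].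
- by rewrite t0 mulf_neq0 // invr_neq0 // expf_neq0.
- by near=> s.
Unshelve. all: by end_near. Qed.

Lemma derivable_pair (V W1 W2 : normedModType R) (f : V -> W1) (g : V -> W2) (x v : V) :
  derivable f x v -> derivable g x v ->
  derivable (fun y => (f y, g y)) x v /\ 'D_v (fun y => (f y, g y)) x = ('D_v f x, 'D_v g x).
Proof.
move=> df dg.
have H : (fun h : R => h^-1 *: ((f (h *: v + x), g (h *: v + x)) - (f x, g x))) @ 0^' -->
    ('D_v f x, 'D_v g x).
  exact: (cvg_pair df dg).
by split; [apply/cvg_ex; exists ('D_v f x, 'D_v g x)|exact: cvg_lim].
Qed.

Lemma smooth_on_pair (V W1 W2 : normedModType R) (U : set V) (f : V -> W1) (g : V -> W2) :
  open U -> smooth_on U f -> smooth_on U g -> smooth_on U (fun y => (f y, g y)).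
Proof.
move=> oU sf sg vs.
have E x : U x -> Defs.iterD vs (fun y => (f y, g y)) x = (Defs.iterD vs f x, Defs.iterD vs g x).
  elim: vs x => // v vs IH x Ux /=.
  have [_ <-] := derivable_pair _ _ _ _ _ _ _ ((sf vs x Ux).2 v) ((sg vs x Ux).2 v).
  by apply: near_eq_derive; apply: filterS IH _; exact: open_nbhs_nbhs.
move=> x Ux.
have nE : \forall y \near x, (Defs.iterD vs f y, Defs.iterD vs g y) = Defs.iterD vs (fun y => (f y, g y)) y.
  by apply: filterS (open_nbhs_nbhs (conj oU Ux)) => y /E.
have [cf df] := sf vs x Ux; have [cg dg] := sg vs x Ux.
split=> [|v].
  apply: cvg_trans (near_eq_cvg nE) _.
  rewrite E //; exact: (cvg_pair cf cg).
apply: near_eq_derivable nE _.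
exact: (derivable_pair _ _ _ _ _ _ _ (df v) (dg v)).1.
Qed.

Lemma sm_smooth_on (V : normedModType R) (U : set V) (f : V -> R) : sm R U f -> smooth_on U f.
Proof.
move=> sf vs x Ux.
have s : sm R U (Defs.iterD vs f).
  by elim: vs => //= v vs IH n; exact: (IH n.+1).2.
have d := (s 1%N).1 x Ux.
split=> [|v]; [exact: differentiable_continuous|exact: diff_derivable].
Qed.

Lemma smg_smooth_at2 (V : normedModType R) (p : V) (f : V -> R * R) :
  smg R p (fun x => (f x).1) -> smg R p (fun x => (f x).2) -> smooth_at p f.
Proof.
move=> [U [oU Up sU]] [W [oW Wp sW]]; exists (U `&` W); split => //; first exact: openI.
have -> : f = fun x => ((f x).1, (f x).2).
  by apply/funext => x; exact: surjective_pairing.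
apply: smooth_on_pair; first exact: openI.
- by apply: sm_smooth_on => n; apply: diff_n_sub (sU n); exact: subIsetl.
- by apply: sm_smooth_on => n; apply: diff_n_sub (sW n); exact: subIsetr.
Qed.

Lemma smg_smooth_at3 (V : normedModType R) (p : V) (f : V -> R * R * R) :
  smg R p (fun x => (f x).1.1) -> smg R p (fun x => (f x).1.2) ->
  smg R p (fun x => (f x).2) -> smooth_at p f.
Proof.
move=> s1 s2 [W [oW Wp sW]].
have [U [oU Up sU]] := smg_smooth_at2 _ p (fun x => (f x).1) s1 s2.
exists (U `&` W); split => //; first exact: openI.
have -> : f = fun x => ((f x).1, (f x).2).
  by apply/funext => x; exact: surjective_pairing.
apply: smooth_on_pair; first exact: openI.
- by move=> vs x [Ux _]; exact: sU.
- by apply: sm_smooth_on => n; apply: diff_n_sub (sW n); exact: subIsetr.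
Qed.

Lemma smg_near_comp (V : normedModType R) (p : V) (a : R) (f : V -> R) (P : set R) :
  smg R p f -> f p = a -> (\forall t \near a, P t) -> \forall x \near p, P (f x).
Proof. by move=> sf fp HP; apply: (smg_continuous _ _ _ sf P); rewrite fp. Qed.

Lemma smg_near_comp2 (V : normedModType R) (p : V) (f g : V -> R) (P : set (R * R)) :
  smg R p f -> smg R p g -> f p = 0 -> g p = 0 ->
  (\forall q \near (0 : R * R), P q) -> \forall x \near p, P (f x, g x).
Proof.
move=> sf sg f0 g0 HP.
have H := differentiable_continuous (differentiable_pair
  (smg_differentiable _ _ _ sf) (smg_differentiable _ _ _ sg)).
by apply: H; rewrite f0 g0.
Qed.

Variables (x z : R -> R) (u0 lam : R).

(* The helicoidal surface is the image of [line * profile] under the screw motion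
   [(w, q) |-> rotation of q by w / lam, raised by w]. *)
Definition profile (t : R) : R * R :=
  (x (u0 + t) * cos ((z (u0 + t) - z u0) / lam),
   - (x (u0 + t) * sin ((z (u0 + t) - z u0) / lam))).

Hypothesis sx : smg R u0 x.
Hypothesis sz : smg R u0 z.
Hypothesis x0 : x u0 = 0.
Hypothesis lam0 : lam != 0.

(** A point at height [Z0 + w] is rotated back by the angle [w / lam + v0]. For the surface point
    [(u, v)] this angle is [zeta + v], so the result is the profile at [u - u0], to which the planar
    equivalence applies. In the source, [w] replaces [v] as coordinate because [lam] is nonzero. *)
Lemma profile_A_equiv i j v0 : (0 < i)%N -> (0 < j)%N -> planar_cusp R i j profile ->
  A_equiv (helicoidal x z lam) (u0, v0) (cusp_model i j) 0.
Proof.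
move=> i0 j0 [N [M [s [t [[sN sM MN NM] [[s0 t0 ss st] [ts st1]] H]]]]].
pose Z0 := z u0 + lam * v0.
pose th w := w / lam + v0.
pose P (p : R * R * R) := p.1.1 * cos (th (p.2 - Z0)) + p.1.2 * sin (th (p.2 - Z0)).
pose Q (p : R * R * R) := - p.1.1 * sin (th (p.2 - Z0)) + p.1.2 * cos (th (p.2 - Z0)).
pose Phi p := (p.2 - Z0, (N (P p, Q p)).1, (N (P p, Q p)).2).
pose X (q : R * R * R) := (M (q.1.2, q.2)).1 * cos (th q.1.1) - (M (q.1.2, q.2)).2 * sin (th q.1.1).
pose Y (q : R * R * R) := (M (q.1.2, q.2)).1 * sin (th q.1.1) + (M (q.1.2, q.2)).2 * cos (th q.1.1).
pose Psi q := (X q, Y q, q.1.1 + Z0).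
pose phi (p : R * R) := (z p.1 - z u0 + lam * (p.2 - v0), s (p.1 - u0)).
pose psi (q : R * R) := (u0 + t q.2, v0 + (q.1 - (z (u0 + t q.2) - z u0)) / lam).
pose f := helicoidal x z lam.
have [N0 sN1 sN2] := sN; have [M0 sM1 sM2] := sM.
have fp : f (u0, v0) = (0, 0, Z0) by rewrite /f /helicoidal /= x0 !mul0r.
have smth (V : normedModType R) (p : V) g : smg R p g -> smg R p (fun y => cos (th (g y))) /\
    smg R p (fun y => sin (th (g y))).
  move=> sg.
  have sth : smg R p (fun y => th (g y)).
    apply: smgD; last exact: smg_cst.
    by apply: smgM => //; exact: smg_cst.
  split; [apply: (@smg_comp R V p cos) => //; exact: smg_cos|].
  by apply: (@smg_comp R V p sin) => //; exact: smg_sin.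
have sZ : smg R (0, 0, Z0) (fun p : R * R * R => p.2 - Z0).
  by apply: smgB; [exact: smg_thd3|exact: smg_cst].
have [sc ssn] := smth _ _ _ sZ.
have sP : smg R (0, 0, Z0) P.
  by apply: smgD; apply: smgM => //; [exact: smg_fst3|exact: smg_snd3].
have sQ : smg R (0, 0, Z0) Q.
  by apply: smgD; apply: smgM => //; [apply: smgN; exact: smg_fst3|exact: smg_snd3].
have P0 : P (0, 0, Z0) = 0 by rewrite /P /= !mul0r addr0.
have Q0 : Q (0, 0, Z0) = 0 by rewrite /Q /= oppr0 !mul0r addr0.
have sN' (k : R * R -> R) : smg R 0 k -> smg R (0, 0, Z0) (fun p => k (P p, Q p)).
  by move=> sk; apply: (@smg_comp2 R _ _ k) => //; rewrite P0 Q0.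
have sY1 : smg R (0 : R * R * R) (fun q => q.1.2) by exact: smg_snd3.
have sY2 : smg R (0 : R * R * R) (fun q => q.2) by exact: smg_thd3.
have sY0 : smg R (0 : R * R * R) (fun q => q.1.1) by exact: smg_fst3.
have [sc' ss'] := smth _ _ _ sY0.
have sM' (k : R * R -> R) : smg R 0 k -> smg R (0 : R * R * R) (fun q => k (q.1.2, q.2)).
  by move=> sk; apply: (@smg_comp2 R _ _ k).
have sM1' := sM' _ sM1; have sM2' := sM' _ sM2.
have Phi0 : Phi (0, 0, Z0) = 0 by rewrite /Phi P0 Q0 /= N0 subrr.
have Psi0 : Psi 0 = (0, 0, Z0) by rewrite /Psi /X /Y /= M0 !mul0r subr0 addr0 add0r.
have sfst0 : smg R (u0, v0) (fun p : R * R => p.1 - u0).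
  by apply: smgB; [exact: smg_fst|exact: smg_cst].
have sphi1 : smg R (u0, v0) (fun p => (phi p).1).
  apply: smgD.
    apply: smgB; last exact: smg_cst.
    by apply: (@smg_comp R _ (u0, v0) z fst) => //; exact: smg_fst.
  apply: smgM; first exact: smg_cst.
  by apply: smgB; [exact: smg_snd|exact: smg_cst].
have sphi2 : smg R (u0, v0) (fun p => (phi p).2).
  by apply: (@smg_comp R _ (u0, v0) s) => //=; rewrite subrr.
have spsi1 : smg R (0 : R * R) (fun q => (psi q).1).
  apply: smgD; first exact: smg_cst.
  by apply: (@smg_comp R _ 0 t snd) => //; exact: smg_snd.
have spsi2 : smg R (0 : R * R) (fun q => (psi q).2).
  apply: smgD; first exact: smg_cst.
  apply: smgM; last exact: smg_cst.
  apply: smgB; first exact: smg_fst.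
  apply: smgB; last exact: smg_cst.
  by apply: (@smg_comp R _ 0 z) => //; rewrite /psi /= t0 addr0.
have nts : \forall p \near (u0, v0), t (s (p.1 - u0)) = p.1 - u0.
  by apply: (smg_near_comp _ _ 0 _ (fun x => t (s x) = x) sfst0) => //=; rewrite subrr.
have nst : \forall q \near (0 : R * R), s (t q.2) = q.2.
  by apply: (smg_near_comp _ _ 0 _ (fun x => s (t x) = x) (smg_snd R 0)).
have nMN : \forall p \near (0, 0, Z0), M (N (P p, Q p)) = (P p, Q p).
  exact: (smg_near_comp2 _ _ _ _ (fun p => M (N p) = p) sP sQ).
have nNM : \forall q \near (0 : R * R * R), N (M (q.1.2, q.2)) = (q.1.2, q.2).
  exact: (smg_near_comp2 _ _ _ _ (fun p => N (M p) = p) sY1 sY2).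
have nH : \forall p \near (u0, v0), N (profile (p.1 - u0)) = (s (p.1 - u0) ^+ i, s (p.1 - u0) ^+ j).
  by apply: (smg_near_comp _ _ 0 _ (fun x => N (profile x) = (s x ^+ i, s x ^+ j)) sfst0) => //=; rewrite subrr.
exists phi, Phi; split.
- split.
  + by rewrite /phi /= !subrr s0 mulr0 addr0.
  + apply: smg_smooth_at2 => /=; [exact: sphi1|exact: sphi2].
  + exists psi; split.
    * by rewrite /psi /= t0 addr0 subrr subr0 mul0r addr0.
    * apply: smg_smooth_at2 => /=; [exact: spsi1|exact: spsi2].
    * apply: filterS nts => -[u v] /= e; rewrite /psi /phi /= e.
      have -> : u0 + (u - u0) = u by ring.
      by congr pair; field.
    * apply: filterS nst => -[w y] /= e; rewrite /psi /phi /=.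
      have -> : u0 + t y - u0 = t y by ring.
      by rewrite e; congr pair; field.
- have -> : cusp_model i j (0 : R * R) = 0 :> R * R * R.
    by rewrite /cusp_model /= !expr0n !gtn_eqF.
  rewrite -/f fp; split => //.
  + apply: smg_smooth_at3 => /=; [exact: sZ|exact: (sN' _ sN1)|exact: (sN' _ sN2)].
  + exists Psi; split => //.
    * apply: smg_smooth_at3 => /=.
      - by apply: smgB; apply: smgM.
      - by apply: smgD; apply: smgM.
      - by apply: smgD => //; exact: smg_cst.
    * apply: filterS nMN => -[[X0 Y0] Z1] e; rewrite /Psi /X /Y /= -surjective_pairing e /=.
      rewrite subrK /P /Q /=; move: (cos2Dsin2 (th (Z1 - Z0))).
      set c := cos _; set sn := sin _ => cs.
      by congr (_, _, _); [transitivity (X0 * (c ^+ 2 + sn ^+ 2))|transitivity (Y0 * (c ^+ 2 + sn ^+ 2))];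
        by [ring|rewrite cs mulr1].
    * apply: filterS nNM => -[[w a] b] /= e; rewrite /Phi /=.
      have PE : P (Psi (w, a, b)) = (M (a, b)).1.
        rewrite /P /Psi /X /Y /= addrK; move: (cos2Dsin2 (th w)).
        set c := cos _; set sn := sin _ => cs.
        by transitivity ((M (a, b)).1 * (c ^+ 2 + sn ^+ 2)); by [ring|rewrite cs mulr1].
      have QE : Q (Psi (w, a, b)) = (M (a, b)).2.
        rewrite /Q /Psi /X /Y /= addrK; move: (cos2Dsin2 (th w)).
        set c := cos _; set sn := sin _ => cs.
        by transitivity ((M (a, b)).2 * (c ^+ 2 + sn ^+ 2)); by [ring|rewrite cs mulr1].
      by rewrite PE QE -surjective_pairing e addrK.
- apply: filterS nH => -[u v] /= e; rewrite /cusp_model /Phi /=.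
  have PQ : (P (f (u, v)), Q (f (u, v))) = profile (u - u0).
    rewrite /profile [u0 + _]addrC subrK /P /Q /f /helicoidal /=.
    have -> : th (z u + lam * v - Z0) = (z u - z u0) / lam + v.
      by rewrite /th /Z0; field.
    set ze := (z u - z u0) / lam.
    have cE : cos ze = cos (ze + v) * cos v + sin (ze + v) * sin v by rewrite -cosB addrK.
    have sE : sin ze = sin (ze + v) * cos v - cos (ze + v) * sin v by rewrite -sinB addrK.
    by rewrite cE sE; congr pair; ring.
  by rewrite PQ e /f /helicoidal /= /Z0; congr (_, _, _); ring.
Qed.
End Suspension.

(** * From directional derivatives to Fréchet differentiability *)

Section SmoothOn.
Variable R : realType.

Lemma smooth_on_derive (V W : normedModType R) (U : set V) (f : V -> W) v :
  smooth_on U f -> smooth_on U ('D_v f).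
Proof. by move=> sf vs; have := sf (rcons vs v); rewrite /Defs.iterD foldr_rcons. Qed.

Lemma is_derive_line (V : normedModType R) (f : V -> R) (y v : V) (c : R) :
  derivable f (c *: v + y) v ->
  is_derive c 1 (fun t : R => f (t *: v + y)) ('D_v f (c *: v + y)).
Proof.
move=> df.
have E : (fun h : R => h^-1 *: (f ((h *: 1 + c) *: v + y) - f (c *: v + y))) =
    (fun h : R => h^-1 *: (f (h *: v + (c *: v + y)) - f (c *: v + y))).
  by apply/funext => h; rewrite scalerDl addrA /GRing.scale /= mulr1.
by apply: DeriveDef; rewrite /derivable /derive E.
Qed.

(** The estimate is uniform in the base point [y], by continuity of ['D_v f] at [p]; this allows
    increments along different axes to be chained. *)
Lemma directional_increment (V : normedModType R) (U : set V) (f : V -> R) (p v : V) :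
  open U -> U p -> smooth_on U f -> forall e : R, 0 < e ->
  exists2 d : R, 0 < d & forall y t, `|y - p| < d -> `|t| < d ->
    `|f (t *: v + y) - f y - t * 'D_v f p| <= e * `|t|.
Proof.
move=> oU Up sf e e0.
have nU : \forall z \near p, U z /\ `|'D_v f z - 'D_v f p| <= e.
  apply: filterI; first exact: open_nbhs_nbhs.
  have [/cvgrPdist_le/(_ e e0) H _] := smooth_on_derive _ _ _ _ v sf [::] p Up.
  by apply: filterS H => z; rewrite distrC.
have /nbhs_ballP[r /= r0 rU] := nU.
have v1 : 0 < 1 + `|v| by rewrite ltr_pwDl.
exists (r / (1 + `|v|)); first by rewrite divr_gt0.
move=> y t yd td.
have H c : `|c - 0| <= `|t| -> U (c *: v + y) /\ `|'D_v f (c *: v + y) - 'D_v f p| <= e.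
  rewrite subr0 => ct; apply: rU; rewrite -ball_normE /= distrC -addrA.
  apply: le_lt_trans (ler_normD _ _) _; rewrite normrZ.
  have -> : r = (r / (1 + `|v|)) * `|v| + r / (1 + `|v|).
    by field; rewrite gt_eqF.
  by rewrite ler_ltD // ler_wpM2r // ltW // (le_lt_trans ct).
have [|||c [ct _ _]] := mean_value R (fun s => f (s *: v + y)) (fun s => 'D_v f (s *: v + y)) 0 `|t|
    _ 0 t.
- move=> c ct; apply: is_derive_line; have [Uc _] := H c ct.
  exact: (sf [::] _ Uc).2.
- by rewrite subrr normr0.
- by rewrite subr0.
rewrite scale0r add0r subr0 => ->; rewrite [_ * t]mulrC -mulrBr normrM mulrC ler_wpM2r //.
exact: (H c ct).2.
Qed.

Lemma differentiable_vanishing (V : normedModType R) (f : V -> R) (p : V) :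
  (forall e : R, 0 < e -> \forall h \near (0 : V), `|f (h + p) - f p| <= e * `|h|) ->
  differentiable f p.
Proof.
move=> H; apply: (proj1 (@differentiable_bound R V R f p \0 _ _)).
  by move=> x; exact: cvg_cst.
by move=> e e0; apply: filterS (H e e0) => h; rewrite subr0.
Qed.

Lemma norm_pair (V W : normedModType R) (a : V) (b : W) : `|(a, b)| = Num.max `|a| `|b|.
Proof. by []. Qed.

(** Continuous partial derivatives give differentiability: the increment is split along the axes.
    Subtracting the candidate differential [g] first reduces the claim to a zero differential. *)
Lemma smooth_on_differentiable2 (U : set (R * R)) (f : R * R -> R) p :
  open U -> U p -> smooth_on U f -> differentiable f p.
Proof.
move=> oU Up sf; pose e1 : R * R := (1, 0); pose e2 : R * R := (0, 1).
pose g (y : R * R) := y.1 * 'D_e1 f p + y.2 * 'D_e2 f p.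
have dg : differentiable g p.
  apply: smg_differentiable.
  by apply: smgD; apply: smgM; [exact: smg_fst|exact: smg_cst|exact: smg_snd|exact: smg_cst].
rewrite (_ : f = (fun y => f y - g y) + g); last by apply/funext => y /=; rewrite subrK.
apply: differentiableD => //; apply: differentiable_vanishing => e e0.
have e20 : 0 < e / 2 by rewrite divr_gt0.
have [d1 d10 H1] := directional_increment _ U f p e1 oU Up sf _ e20.
have [d2 d20 H2] := directional_increment _ U f p e2 oU Up sf _ e20.
apply/nbhs_ballP; exists (Num.min d1 d2); first by rewrite /= lt_min d10.
move=> [a b]; rewrite -ball_normE /= sub0r normrN lt_min => /andP[hd1 hd2].
have [ha hb] : `|a| <= `|(a, b)| /\ `|b| <= `|(a, b)|.
  by rewrite norm_pair !le_max !lexx orbT.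
have E2 := H2 p b; rewrite subrr normr0 in E2.
have {}E2 := E2 d20 (le_lt_trans hb hd2).
have E1 := H1 (b *: e2 + p) a.
have n2 : `|b *: e2 + p - p| < d1.
  rewrite addrK; apply: le_lt_trans hd1; apply: le_trans hb.
  by rewrite normrZ /e2 norm_pair normr0 normr1 maxEle ler01 mulr1.
have {}E1 := E1 n2 (le_lt_trans ha hd1).
have abE : (a, b) + p = a *: e1 + (b *: e2 + p).
  by case: p {Up dg H1 H2 E1 E2 n2 g} => p1 p2; rewrite /e1 /e2; congr pair; rewrite /= /GRing.scale /= ?mulr0 ?mulr1 ?add0r.
have -> : f ((a, b) + p) - g ((a, b) + p) - (f p - g p) =
    (f (a *: e1 + (b *: e2 + p)) - f (b *: e2 + p) - a * 'D_e1 f p) +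
    (f (b *: e2 + p) - f p - b * 'D_e2 f p).
  have gE : g ((a, b) + p) = g p + (a * 'D_e1 f p + b * 'D_e2 f p).
    rewrite /g; move: ('D_e1 f p) ('D_e2 f p) => D1 D2.
    by move: (p) => [p1 p2] /=; ring.
  rewrite -abE gE; move: (f ((a, b) + p)) (f (b *: e2 + p)) => F1 F2.
  by move: (f p) (g p) ('D_e1 f p) ('D_e2 f p) => *; ring.
apply: le_trans (ler_normD _ _) _; apply: le_trans (lerD E1 E2) _.
rewrite -mulrDr mulrAC ler_pdivrMr // -mulrA ler_wpM2l //; first exact: ltW.
by rewrite mulrC mulr_natl mulr2n lerD.
Qed.

Lemma smooth_on_differentiable3 (U : set (R * R * R)) (f : R * R * R -> R) p :
  open U -> U p -> smooth_on U f -> differentiable f p.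
Proof.
move=> oU Up sf; pose e1 : R * R * R := (1, 0, 0); pose e2 : R * R * R := (0, 1, 0).
pose e3 : R * R * R := (0, 0, 1).
pose g (y : R * R * R) := y.1.1 * 'D_e1 f p + y.1.2 * 'D_e2 f p + y.2 * 'D_e3 f p.
have dg : differentiable g p.
  apply: smg_differentiable.
  by apply: smgD; first apply: smgD; apply: smgM;
    [exact: smg_fst3|exact: smg_cst|exact: smg_snd3|exact: smg_cst|exact: smg_thd3|exact: smg_cst].
rewrite (_ : f = (fun y => f y - g y) + g); last by apply/funext => y /=; rewrite subrK.
apply: differentiableD => //; apply: differentiable_vanishing => e e0.
have e30 : 0 < e / 3 by rewrite divr_gt0.
have [d1 d10 H1] := directional_increment _ U f p e1 oU Up sf _ e30.
have [d2 d20 H2] := directional_increment _ U f p e2 oU Up sf _ e30.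
have [d3 d30 H3] := directional_increment _ U f p e3 oU Up sf _ e30.
apply/nbhs_ballP; exists (Num.min d1 (Num.min d2 d3)); first by rewrite /= !lt_min d10 d20.
move=> [[a b] c]; rewrite -ball_normE /= sub0r normrN !lt_min => /and3P[hd1 hd2 hd3].
set N := `|(a, b, c)| in hd1 hd2 hd3 *.
have [ha hb hc] : [/\ `|a| <= N, `|b| <= N & `|c| <= N].
  by rewrite /N !norm_pair !le_max !lexx !orbT.
have n3 : `|c *: e3| <= N.
  by rewrite normrZ /e3 !norm_pair !normr0 normr1 maxxx maxEle ler01 mulr1.
have n2 : `|b *: e2 + c *: e3| <= N.
  have -> : b *: e2 + c *: e3 = (0, b, c).
    by rewrite /e2 /e3; congr (_, _, _); rewrite /= /GRing.scale /= ?mulr0 ?mulr1 ?add0r ?addr0.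
  by rewrite !norm_pair normr0 !ge_max hb hc andbT normr_ge0.
have E3 := H3 p c; rewrite subrr normr0 in E3.
have {}E3 := E3 d30 (le_lt_trans hc hd3).
have E2 := H2 (c *: e3 + p) b.
rewrite addrK in E2; have {}E2 := E2 (le_lt_trans n3 hd2) (le_lt_trans hb hd2).
have E1 := H1 (b *: e2 + (c *: e3 + p)) a.
rewrite addrA addrK in E1; have {}E1 := E1 (le_lt_trans n2 hd1) (le_lt_trans ha hd1).
have abE : (a, b, c) + p = a *: e1 + (b *: e2 + c *: e3 + p).
  case: p {Up dg H1 H2 H3 E1 E2 E3 g} => [[p1 p2] p3]; rewrite /e1 /e2 /e3.
  by congr (_, _, _); rewrite /= /GRing.scale /= ?mulr0 ?mulr1 ?add0r ?addr0 ?add0r.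
have -> : f ((a, b, c) + p) - g ((a, b, c) + p) - (f p - g p) =
    (f (a *: e1 + (b *: e2 + c *: e3 + p)) - f (b *: e2 + c *: e3 + p) - a * 'D_e1 f p) +
    (f (b *: e2 + (c *: e3 + p)) - f (c *: e3 + p) - b * 'D_e2 f p) +
    (f (c *: e3 + p) - f p - c * 'D_e3 f p).
  have gE : g ((a, b, c) + p) = g p + (a * 'D_e1 f p + b * 'D_e2 f p + c * 'D_e3 f p).
    rewrite /g; move: ('D_e1 f p) ('D_e2 f p) ('D_e3 f p) => D1 D2 D3.
    by move: (p) => [[p1 p2] p3] /=; ring.
  rewrite -abE gE [b *: e2 + (c *: e3 + p)]addrA; move: (f ((a, b, c) + p)) (f (b *: e2 + c *: e3 + p)) => F1 F2.
  by move: (f (c *: e3 + p)) (f p) (g p) ('D_e1 f p) ('D_e2 f p) ('D_e3 f p) => *; ring.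
apply: le_trans (ler_normD _ _) _; apply: le_trans (lerD (ler_normD _ _) E3) _.
apply: le_trans (lerD (lerD E1 E2) (lexx _)) _.
have : e / 3 * `|a| + e / 3 * `|b| + e / 3 * `|c| <= e / 3 * (N + N + N).
  by rewrite !mulrDr !lerD // ler_wpM2l // ltW.
by move/le_trans; apply; rewrite le_eqVlt; apply/orP; left; apply/eqP; field.
Qed.

Lemma smooth_on_sm (V : normedModType R) (U : set V) (f : V -> R) :
  (forall (g : V -> R) p, U p -> smooth_on U g -> differentiable g p) ->
  smooth_on U f -> sm R U f.
Proof.
move=> HV sf n; elim: n f sf => // n IH f sf; split=> [x Ux|v]; first exact: HV.
by apply: IH; exact: smooth_on_derive.
Qed.

Lemma smooth_on_sm1 (U : set R) (f : R -> R) : smooth_on U f -> sm R U f.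
Proof.
apply: smooth_on_sm => g p Up sg; apply/derivable1_diffP.
exact: (sg [::] p Up).2.
Qed.

Lemma derivable_proj (V W1 W2 : normedModType R) (f : V -> W1 * W2) (x v : V) :
  derivable f x v ->
  [/\ derivable (fun y => (f y).1) x v, derivable (fun y => (f y).2) x v,
   'D_v (fun y => (f y).1) x = ('D_v f x).1 & 'D_v (fun y => (f y).2) x = ('D_v f x).2].
Proof.
move=> df.
have H1 : (fun h : R => h^-1 *: ((f (h *: v + x)).1 - (f x).1)) @ 0^' --> ('D_v f x).1.
  exact: (cvg_comp _ _ df (@cvg_fst _ _ _ _ _)).
have H2 : (fun h : R => h^-1 *: ((f (h *: v + x)).2 - (f x).2)) @ 0^' --> ('D_v f x).2.
  exact: (cvg_comp _ _ df (@cvg_snd _ _ _ _ _)).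
by split; [apply/cvg_ex; exists ('D_v f x).1|apply/cvg_ex; exists ('D_v f x).2
          |exact: cvg_lim|exact: cvg_lim].
Qed.

Lemma smooth_on_proj (V W1 W2 : normedModType R) (U : set V) (f : V -> W1 * W2) :
  open U -> smooth_on U f ->
  smooth_on U (fun y => (f y).1) /\ smooth_on U (fun y => (f y).2).
Proof.
move=> oU sf.
have E vs x : U x -> Defs.iterD vs (fun y => (f y).1) x = (Defs.iterD vs f x).1 /\
    Defs.iterD vs (fun y => (f y).2) x = (Defs.iterD vs f x).2.
  elim: vs x => // v vs IH x Ux /=.
  have [_ _ <- <-] := derivable_proj _ _ _ _ _ _ ((sf vs x Ux).2 v).
  by split; apply: near_eq_derive; apply: filterS (open_nbhs_nbhs (conj oU Ux)) => y /IH[].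
split=> vs x Ux.
- have nE : \forall y \near x, (Defs.iterD vs f y).1 = Defs.iterD vs (fun y => (f y).1) y.
    by apply: filterS (open_nbhs_nbhs (conj oU Ux)) => y /(E vs)[].
  have [cf df] := sf vs x Ux; split=> [|v].
    apply: cvg_trans (near_eq_cvg nE) _; rewrite (E vs x Ux).1.
    exact: (cvg_comp _ _ cf (@cvg_fst _ _ _ _ _)).
  apply: near_eq_derivable nE _.
  by have [] := derivable_proj _ _ _ _ _ _ (df v).
- have nE : \forall y \near x, (Defs.iterD vs f y).2 = Defs.iterD vs (fun y => (f y).2) y.
    by apply: filterS (open_nbhs_nbhs (conj oU Ux)) => y /(E vs)[].
  have [cf df] := sf vs x Ux; split=> [|v].
    apply: cvg_trans (near_eq_cvg nE) _; rewrite (E vs x Ux).2.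
    exact: (cvg_comp _ _ cf (@cvg_snd _ _ _ _ _)).
  apply: near_eq_derivable nE _.
  by have [] := derivable_proj _ _ _ _ _ _ (df v).
Qed.

Lemma smooth_at2_smg (p : R * R) (f : R * R -> R * R) : smooth_at p f ->
  smg R p (fun y => (f y).1) /\ smg R p (fun y => (f y).2).
Proof.
move=> [U [oU Up sU]]; have [s1 s2] := smooth_on_proj _ _ _ _ _ oU sU.
have HV g q (Uq : U q) := smooth_on_differentiable2 U g q oU Uq.
split; exists U; split => //.
  exact: (smooth_on_sm _ U (fun y => (f y).1) HV s1).
exact: (smooth_on_sm _ U (fun y => (f y).2) HV s2).
Qed.

Lemma smooth_at3_smg (p : R * R * R) (f : R * R * R -> R * R * R) : smooth_at p f ->
  [/\ smg R p (fun y => (f y).1.1), smg R p (fun y => (f y).1.2) & smg R p (fun y => (f y).2)].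
Proof.
move=> [U [oU Up sU]]; have [s12 s3] := smooth_on_proj _ _ _ _ _ oU sU.
have [s1 s2] := smooth_on_proj _ _ _ _ _ oU s12.
have HV g q (Uq : U q) := smooth_on_differentiable3 U g q oU Uq.
split; exists U; split => //.
- exact: (smooth_on_sm _ U (fun y => (f y).1.1) HV s1).
- exact: (smooth_on_sm _ U (fun y => (f y).1.2) HV s2).
- exact: (smooth_on_sm _ U (fun y => (f y).2) HV s3).
Qed.
End SmoothOn.

(** * Local estimates for smooth functions *)

Section Necessity.
Variable R : realType.

Lemma lipschitz_at (V : normedModType R) (f : V -> R) (p : V) : differentiable f p ->
  exists2 C : R, 0 < C & \forall y \near p, `|f y - f p| <= C * `|y - p|.
Proof.
move=> df; have [k k0 kP] := linear_lipschitz (diff_continuous df).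
exists (k + 1); first exact: addr_gt0.
have H := differentiable_boundP R _ _ df 1 ltr01.
rewrite (near_shift p 0) sub0r in H.
apply: filterS H => y; rewrite /= subrK mul1r => yH.
rewrite -[f y - f p](subrK ('d f p (y - p))).
apply: le_trans (ler_normD _ _) _; rewrite addrC mulrDl mul1r.
exact: lerD.
Qed.

Lemma smg_line (V : normedModType R) (p v : V) (f : V -> R) : smg R p f ->
  smg R 0 (fun t : R => f (t *: v + p)).
Proof.
move=> [U [oU Up sU]].
have cl : continuous (fun t : R => t *: v + p).
  by move=> t; apply: cvgD; [exact: scalel_continuous|exact: cvg_cst].
exists ((fun t : R => t *: v + p) @^-1` U); split => [|/=|n].
- by move/continuousP: cl; apply.
- by rewrite scale0r add0r.
elim: n f sU => // n IH f sU.
apply: (diff_n_derive1 _ _ _ _ (fun t : R => 'D_v f (t *: v + p))).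
- by move/continuousP: cl; apply.
- move=> t Ut; apply: is_derive_line; apply: diff_derivable; exact: (sU 1%N).1.
- by apply: (IH ('D_v f)) => m; exact: (sU m.+1).2.
Qed.

Lemma derive1_line (V : normedModType R) (p v : V) (f : V -> R) : smg R p f ->
  derive1 (fun t : R => f (t *: v + p)) 0 = 'd f p v.
Proof.
move=> sf; have df := smg_differentiable _ _ _ sf.
have D : derivable f ((0 : R) *: v + p) v by rewrite scale0r add0r; exact: diff_derivable.
have H := is_derive_line R _ f p v 0 D.
by rewrite derive1E (@derive_val _ _ _ _ _ _ _ H) scale0r add0r deriveE.
Qed.

(** Along [e1] this is Taylor's formula to order three; the step along [e2] is a mean value with
    Lipschitz derivative. Of the quadratic terms only [X^2] is kept, the others being absorbed by
    the [|Y|] part of the error. *)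
Lemma planar_taylor (V : normedModType R) (p e1 e2 : V) (f : V -> R) : smg R p f -> f p = 0 ->
  exists k K d : R, [/\ 0 < d, 0 < K & forall X Y : R, `|X| <= d -> `|Y| <= d ->
    `|f (X *: e1 + Y *: e2 + p) - ('d f p e1 * X + k * X ^+ 2 + 'd f p e2 * Y)|
      <= K * (`|X| ^+ 3 + `|Y| * (`|X| + `|Y|))].
Proof.
move=> sf fp; have df := smg_differentiable _ _ _ sf.
pose g (t : R) := f (t *: e1 + p).
have sg : smg R 0 g by exact: smg_line.
have [K1 K10 gK] := ordO_pos _ _ _ (taylor_ordO R 3 g sg).
pose k := coefT R g 2.
have [d1 d10 H1] := near_le R _ _ gK.
have sD : smg R p ('D_e2 f) by exact: smg_derive.
have [C C0 HC] := lipschitz_at _ _ _ (smg_differentiable _ _ _ sD).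
have nD : \forall y \near p, smg R y f /\ `|'D_e2 f y - 'D_e2 f p| <= C * `|y - p|.
  by apply: filterI HC; exact: smg_near.
have /nbhs_ballP[r /= r0 rH] := nD.
pose M := `|e1| + `|e2| + 1.
have M0 : 0 < M by rewrite ltr_wpDl.
(* The second bound keeps the point within [M (|X| + |Y|) <= 2 M d < r] of [p]. *)
pose d := Num.min d1 (r / (3 * M)).
have d0 : 0 < d by rewrite lt_min d10 divr_gt0 // mulr_gt0.
exists k, (K1 + C * M), d; split => //; first by rewrite addr_gt0 // mulr_gt0.
move=> X Y Xd Yd; have Xd1 : `|X| <= d1 by apply: le_trans Xd _; rewrite ge_min lexx.
have gX : `|g X - ('d f p e1 * X + k * X ^+ 2)| <= K1 * `|X| ^+ 3.
  have := H1 X; rewrite subr0 => /(_ Xd1).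
  have g0 : g 0 = 0 by rewrite /g scale0r add0r.
  rewrite !taylorS taylor0 coefT0 g0 mul0r !add0r expr1.
  by rewrite {1}/coefT derive1n1 divr1 (derive1_line _ _ _ _ sf).
have ball_in c : `|c| <= `|Y| -> smg R (c *: e2 + (X *: e1 + p)) f /\
    `|'D_e2 f (c *: e2 + (X *: e1 + p)) - 'D_e2 f p| <= C * (M * (`|X| + `|Y|)).
  move=> cY.
  have yp : c *: e2 + (X *: e1 + p) - p = c *: e2 + X *: e1 by rewrite addrA addrK.
  have yn : `|c *: e2 + X *: e1| <= M * (`|X| + `|Y|).
    apply: le_trans (ler_normD _ _) _; rewrite !normrZ addrC mulrDr.
    rewrite lerD // mulrC ler_pM // /M.
      by rewrite -addrA lerDl addr_ge0.
    by rewrite [`|e1| + _]addrC -addrA lerDl addr_ge0.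
  have [|s1 s2] := rH (c *: e2 + (X *: e1 + p)).
    rewrite -ball_normE /= distrC yp; apply: le_lt_trans yn _.
    have h2 : M * (`|X| + `|Y|) <= M * (d + d) by rewrite ler_wpM2l ?(ltW M0) // lerD.
    apply: le_lt_trans h2 _.
    have hd : d < r / (2 * M).
      apply: (@le_lt_trans _ _ (r / (3 * M))); first by rewrite /d ge_min lexx orbT.
      by rewrite ltr_pM2l // ltf_pV2 ?posrE ?mulr_gt0 // ltr_pM2r // ltr_nat.
    have -> : r = M * (r / (2 * M) + r / (2 * M)) by field; rewrite gt_eqF.
    by rewrite ltr_pM2l // ltrD.
  split => //; apply: le_trans s2 _; rewrite yp ler_wpM2l //; exact: ltW.
have hY : `|f (X *: e1 + Y *: e2 + p) - g X - 'd f p e2 * Y| <= C * M * (`|Y| * (`|X| + `|Y|)).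
  have [|||c [cY _ _]] := mean_value R (fun s => f (s *: e2 + (X *: e1 + p)))
    (fun s => 'D_e2 f (s *: e2 + (X *: e1 + p))) 0 `|Y| _ 0 Y.
  - move=> c; rewrite subr0 => cY; apply: is_derive_line.
    by apply/diff_derivable/smg_differentiable; exact: (ball_in c cY).1.
  - by rewrite subrr normr0.
  - by rewrite subr0.
  rewrite scale0r add0r subr0 -/(g X) => E.
  have -> : X *: e1 + Y *: e2 + p = Y *: e2 + (X *: e1 + p).
    by rewrite addrA [X *: e1 + _]addrC.
  rewrite E; set D := 'D_e2 f _.
  have -> : D * Y - 'd f p e2 * Y = (D - 'd f p e2) * Y by ring.
  rewrite normrM /D.
  rewrite subr0 in cY; rewrite -deriveE // mulrC.
  have := (ball_in c cY).2 => /(ler_wpM2l (normr_ge0 Y)) /le_trans; apply.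
  by rewrite le_eqVlt; apply/orP; left; apply/eqP; ring.
have -> : f (X *: e1 + Y *: e2 + p) - ('d f p e1 * X + k * X ^+ 2 + 'd f p e2 * Y) =
    (f (X *: e1 + Y *: e2 + p) - g X - 'd f p e2 * Y) + (g X - ('d f p e1 * X + k * X ^+ 2)).
  by ring.
apply: le_trans (ler_normD _ _) _; apply: le_trans (lerD hY gX) _.
rewrite mulrDl addrC lerD //.
  by rewrite ler_wpM2l ?(ltW K10) // lerDl mulr_ge0 // addr_ge0.
by rewrite ler_wpM2l ?mulr_ge0 ?(ltW C0) ?(ltW M0) // lerDr exprn_ge0.
Qed.
End Necessity.

(** * Jet relations forced by an equivalence *)

Section NecessaryConditions.
Variable R : realType.

Lemma ordOX a f n : ordO R a f -> ordO R (n * a) (fun t => f t ^+ n).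
Proof.
move=> fa; elim: n => [|n IH].
  by apply: (eq_ordO _ _ (fun _ => 1)); [move=> t; rewrite expr0|apply/smg_ordO0/smg_cst].
rewrite mulSn; apply: (eq_ordO _ _ (fun t => f t * f t ^+ n)); last exact: ordOM.
by move=> t; rewrite exprS.
Qed.

Lemma ordO2_is_derive (f : R -> R) : ordO R 2 f -> f 0 = 0 -> is_derive (0 : R) 1 f 0.
Proof.
move=> [K fK] f0; apply: (is_derive_bound R _ _ _ K).
by apply: filterS fK => t; rewrite addr0 f0 subr0 mulr0 subr0.
Qed.

Lemma ordO_norm_le n (f g : R -> R) : (\forall t \near (0 : R), `|f t| <= `|g t|) ->
  ordO R n g -> ordO R n f.
Proof.
by move=> fg [K gK]; exists K; apply: filterS2 fg gK => t; exact: le_trans.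
Qed.

Lemma ordO_norm n (f : R -> R) : ordO R n f -> ordO R n (fun t => `|f t|).
Proof. by move=> [K fK]; exists K; apply: filterS fK => t; rewrite normr_id. Qed.

Lemma ordO_near_le a (f : R -> R) (d : R) : ordO R a.+1 f -> 0 < d ->
  \forall t \near (0 : R), `|f t| <= d.
Proof.
move=> /(ordO_le R _ 1 _ (ltn0Sn a)) /ordO_pos [K K0 fK] d0.
near=> t; have ft : `|f t| <= K * `|t| ^+ 1 by near: t.
apply: le_trans ft _; rewrite expr1 mulrC -ler_pdivlMr //; near: t.
apply: (lt_near R _ (d / K)); first exact: divr_gt0.
by move=> t; rewrite subr0; exact: ltW.
Unshelve. all: by end_near. Qed.

(* The trace of "[r] is a smooth function of [(c1, c2)]": the bounds on [n] make every
   Taylor monomial other than [c1], [c1^2], [c2] negligible. *)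
Definition jet_relation (c1 c2 r : R -> R) (g1 g2 k : R) :=
  forall n a b, (0 < a)%N -> (0 < b)%N -> ordO R a c1 -> ordO R b c2 ->
    (n <= a * 3)%N -> (n <= a + b)%N -> (n <= b * 2)%N ->
    ordO R n (fun t => r t - (g1 * c1 t + k * c1 t ^+ 2 + g2 * c2 t)).

(** [q] is the second source coordinate along the plane section. The two final clauses are traces of
    the invertible differential of the target diffeomorphism. *)
Definition cusp_jets (i j : nat) (c1 c2 : R -> R) :=
  exists (q : R -> R) (kap f1 f2 kf h1 h2 kh : R),
  [/\ ordO R 1 q, 0 < kap, \forall t \near (0 : R), kap * `|t| <= `|q t|,
      jet_relation c1 c2 (fun t => q t ^+ i) f1 f2 kf &
      jet_relation c1 c2 (fun t => q t ^+ j) h1 h2 kh] /\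
  ~ (f1 = 0 /\ h1 = 0) /\ ~ (h1 = 0 /\ h2 = 0).

Lemma planar_taylor_jet (V : normedModType R) (p e1 e2 : V) (f : V -> R) (c1 c2 r : R -> R) :
  smg R p f -> f p = 0 -> (\forall t \near (0 : R), r t = f (c1 t *: e1 + c2 t *: e2 + p)) ->
  exists k, jet_relation c1 c2 r ('d f p e1) ('d f p e2) k.
Proof.
move=> sf fp rE; have [k [K [d [d0 K0 H]]]] := planar_taylor R V p e1 e2 f sf fp.
exists k => n a b a0 b0 ca cb na nab nb.
pose g t := K * (`|c1 t| ^+ 3 + `|c2 t| * (`|c1 t| + `|c2 t|)).
apply: (ordO_norm_le _ _ g); last first.
  apply: ordOZ; apply: ordOD.
    by apply: ordO_le na _; rewrite mulnC; apply: ordOX; exact: ordO_norm.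
  apply: (eq_ordO _ _ (fun t => `|c1 t| * `|c2 t| + `|c2 t| ^+ 2)); first by move=> t; ring.
  apply: ordOD.
    by apply: ordO_le nab _; apply: ordOM; exact: ordO_norm.
  by apply: ordO_le nb _; rewrite mulnC; apply: ordOX; exact: ordO_norm.
have n1 : \forall t \near (0 : R), `|c1 t| <= d.
  by apply: (ordO_near_le a.-1) => //; rewrite prednK.
have n2 : \forall t \near (0 : R), `|c2 t| <= d.
  by apply: (ordO_near_le b.-1) => //; rewrite prednK.
apply: filterS3 n1 n2 rE => t t1 t2 ->.
apply: le_trans (H _ _ t1 t2) _; rewrite /g [leRHS]ger0_norm //.
by rewrite mulr_ge0 ?(ltW K0) // addr_ge0 ?exprn_ge0 // mulr_ge0 // addr_ge0.
Qed.

Lemma differentiable_triple (V : normedModType R) (p : V) (f : V -> R * R * R) :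
  differentiable (fun y => (f y).1.1) p -> differentiable (fun y => (f y).1.2) p ->
  differentiable (fun y => (f y).2) p ->
  differentiable f p /\ (forall d, 'd f p d =
    ('d (fun y => (f y).1.1) p d, 'd (fun y => (f y).1.2) p d, 'd (fun y => (f y).2) p d)).
Proof.
move=> d1 d2 d3.
have fE : f = fun y => ((f y).1.1, (f y).1.2, (f y).2).
  by apply/funext => y; rewrite -!surjective_pairing.
have d12 := differentiable_pair d1 d2.
split; first by rewrite fE; exact: (differentiable_pair d12 d3).
by move=> d; rewrite {1}fE (diff_pair d12 d3) /= (diff_pair d1 d2).
Qed.

Lemma diff_comp_near (V W : normedModType R) (F : V -> W) (k : W -> R) (l : V -> R) (p d : V) :
  differentiable F p -> differentiable k (F p) -> differentiable l p ->
  (\forall y \near p, k (F y) = l y) -> 'd k (F p) ('d F p d) = 'd l p d.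
Proof.
move=> dF dk dl kl; rewrite -(deriveE _ dl) -(near_eq_derive d kl) deriveE.
  by rewrite (diff_comp dF dk).
exact: differentiable_comp.
Qed.

Lemma diff_snd (p d : R * R * R) : 'd (snd : R * R * R -> R) p d = d.2.
Proof. by rewrite diff_lin // => y; exact: cvg_snd. Qed.

Lemma diff_fst_fst (p d : R * R * R) : 'd (fst \o fst : R * R * R -> R) p d = d.1.1.
Proof. by rewrite diff_lin // => y; apply: continuous_comp; exact: cvg_fst. Qed.

Lemma diff_snd_fst (p d : R * R * R) : 'd (snd \o fst : R * R * R -> R) p d = d.1.2.
Proof.
by rewrite diff_lin // => y; apply: continuous_comp; [exact: cvg_fst|exact: cvg_snd].
Qed.

Lemma diffeo_immersion (Phi Psi : R * R * R -> R * R * R) P0 d : Phi P0 = 0 ->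
  smg R P0 (fun y => (Phi y).1.1) -> smg R P0 (fun y => (Phi y).1.2) ->
  smg R P0 (fun y => (Phi y).2) -> smg R 0 (fun y => (Psi y).1.1) ->
  smg R 0 (fun y => (Psi y).1.2) -> smg R 0 (fun y => (Psi y).2) ->
  (\forall y \near P0, Psi (Phi y) = y) ->
  'd (fun y => (Phi y).1.1) P0 d = 0 -> 'd (fun y => (Phi y).1.2) P0 d = 0 ->
  'd (fun y => (Phi y).2) P0 d = 0 -> d = 0.
Proof.
move=> PhiP /smg_differentiable d1 /smg_differentiable d2 /smg_differentiable d3.
move=> /smg_differentiable s1 /smg_differentiable s2 /smg_differentiable s3 PsiK z1 z2 z3.
have [dPhi PhiE] := differentiable_triple _ P0 Phi d1 d2 d3.
have dPhid : 'd Phi P0 d = 0 :> R * R * R by rewrite PhiE z1 z2 z3.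
have coord (k l : R * R * R -> R) : differentiable k 0 -> differentiable l P0 ->
    (\forall y \near P0, k (Phi y) = l y) -> 'd l P0 d = 0.
  move=> dk dl kl; rewrite -PhiP in dk.
  by rewrite -(diff_comp_near _ _ _ _ _ _ d dPhi dk dl kl) dPhid linear0.
have sl1 := smg_differentiable _ _ _ (smg_fst3 R P0).
have sl2 := smg_differentiable _ _ _ (smg_snd3 R P0).
have sl3 := smg_differentiable _ _ _ (smg_thd3 R P0).
have r1 := coord _ (fst \o fst) s1 sl1.
have r2 := coord _ (snd \o fst) s2 sl2.
have r3 := coord _ snd s3 sl3.
have e1 : d.1.1 = 0 by rewrite -(diff_fst_fst P0) r1 //; apply: filterS PsiK => y ->.
have e2 : d.1.2 = 0 by rewrite -(diff_snd_fst P0) r2 //; apply: filterS PsiK => y ->.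
have e3 : d.2 = 0 by rewrite -(diff_snd P0) r3 //; apply: filterS PsiK => y ->.
by rewrite [d]surjective_pairing [d.1]surjective_pairing e1 e2 e3.
Qed.

(** When the triple of linear forms is injective, the common kernel of the last two has dimension at
    most one. *)
Lemma collinear_of_injective (V : normedModType R) (D1 D2 D3 : {linear V -> R}) (e1 e3 : V) :
  (forall d, D1 d = 0 -> D2 d = 0 -> D3 d = 0 -> d = 0) ->
  D2 e1 = 0 -> D3 e1 = 0 -> D2 e3 = 0 -> D3 e3 = 0 -> D1 e3 *: e1 = D1 e1 *: e3.
Proof.
move=> inj a1 a2 v2 v3; apply/eqP; rewrite -subr_eq0; apply/eqP.
by apply: inj; rewrite linearB !linearZ /= ?v2 ?v3 ?a1 ?a2 /GRing.scale /=; ring.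
Qed.

Lemma linear_comb_zero (V : normedModType R) (D : {linear V -> R}) (e1 e2 e3 : V) (a b c : R) :
  D e1 = 0 -> D e2 = 0 -> D e3 = 0 -> D (a *: e1 + b *: e2 + c *: e3) = 0.
Proof. by move=> z1 z2 z3; rewrite !linearD !linearZ /= z1 z2 z3 !scaler0 !addr0. Qed.

Lemma diffeo_submersion (Phi Psi : R * R * R -> R * R * R) P0 :
  (\forall y \near (0 : R * R * R), Phi (Psi y) = y) ->
  [/\ smg R 0 (fun y => (Psi y).1.1), smg R 0 (fun y => (Psi y).1.2) & smg R 0 (fun y => (Psi y).2)] ->
  smg R P0 (fun y => (Phi y).2) -> Psi 0 = P0 ->
  exists w, 'd (fun y => (Phi y).2) P0 w = 1.
Proof.
move=> PhiK [/smg_differentiable s1 /smg_differentiable s2 /smg_differentiable s3].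
move=> /smg_differentiable dk P0E.
have [dPsi _] := differentiable_triple _ 0 Psi s1 s2 s3.
pose e : R * R * R := (0, 0, 1); exists ('d Psi 0 e); rewrite -P0E in dk *.
have sl3 := smg_differentiable _ _ _ (smg_thd3 R 0).
have nk : \forall y \near (0 : R * R * R), (Phi (Psi y)).2 = snd y.
  by apply: filterS PhiK => y ->.
by rewrite (diff_comp_near _ _ _ _ _ _ e dPsi dk sl3 nk) diff_snd.
Qed.

Variables (x z : R -> R) (u0 lam v0 : R).
Hypothesis sx : smg R u0 x.
Hypothesis sz : smg R u0 z.
Hypothesis x0 : x u0 = 0.
Hypothesis lam0 : lam != 0.

Let zeta t := (z (u0 + t) - z u0) / lam.
Let c1 t := (profile R x z u0 lam t).1.
Let c2 t := (profile R x z u0 lam t).2.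

(** Over [u = u0] the surface is the vertical axis, because [x u0 = 0]. Along it the last two model
    coordinates are powers of exponent at least two of a function vanishing at the base point, so
    their vertical derivatives are zero. *)
Lemma vertical_derivatives (phi : R * R -> R * R) (Phi : R * R * R -> R * R * R) i j Z0 :
  (1 < i)%N -> (1 < j)%N -> Z0 = z u0 + lam * v0 ->
  phi (u0, v0) = 0 -> smg R (u0, v0) (fun y => (phi y).2) ->
  smg R (0, 0, Z0) (fun y => (Phi y).1.2) -> smg R (0, 0, Z0) (fun y => (Phi y).2) ->
  Phi (0, 0, Z0) = 0 ->
  (\forall y \near (u0, v0), cusp_model i j (phi y) = Phi (helicoidal x z lam y)) ->
  'd (fun y => (Phi y).1.2) ((0, 0, Z0) : R * R * R) ((0, 0, 1) : R * R * R) = 0 /\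
  'd (fun y => (Phi y).2) ((0, 0, Z0) : R * R * R) ((0, 0, 1) : R * R * R) = 0.
Proof.
move=> i1 j1 Z0E phip sphi2 s2 s3 PhiP eqv.
pose P0 : R * R * R := (0, 0, Z0); pose e3 : R * R * R := (0, 0, 1).
pose q t := (phi (t *: ((0, 1) : R * R) + (u0, v0))).2.
have nE : \forall t \near (0 : R), q t ^+ i = (Phi (t *: (lam *: e3) + P0)).1.2 /\
    q t ^+ j = (Phi (t *: (lam *: e3) + P0)).2.
  have ct : {for 0, continuous (fun t : R => t *: ((0, 1) : R * R) + (u0, v0))}.
    by apply: cvgD; [exact: scalel_continuous|exact: cvg_cst].
  have : \forall t \near (0 : R), cusp_model i j (phi (t *: ((0, 1) : R * R) + (u0, v0))) =
      Phi (helicoidal x z lam (t *: ((0, 1) : R * R) + (u0, v0))).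
    apply: (ct (fun y => cusp_model i j (phi y) = Phi (helicoidal x z lam y))).
    by rewrite scale0r add0r.
  apply: filterS => t; rewrite /cusp_model -/(q t).
  have -> : helicoidal x z lam (t *: ((0, 1) : R * R) + (u0, v0)) = t *: (lam *: e3) + P0.
    rewrite /helicoidal /= /GRing.scale /= mulr0 mulr1 add0r x0.
    by congr (_, _, _); rewrite /= /GRing.scale /= ?mulr0 ?mul0r ?addr0 // Z0E mulr1; ring.
  by move=> <-.
have q1 : ordO R 1 q.
  have sq : smg R 0 q by exact: (smg_line R _ (u0, v0) (0, 1) (fun y => (phi y).2) sphi2).
  have := taylor_ordO R 1 q sq; apply: eq_ordO => t.
  have q0 : q 0 = 0 by rewrite /q scale0r add0r phip.
  by rewrite taylorS taylor0 coefT0 q0 mul0r addr0 subr0.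
have vanish (G : R * R * R -> R) n : (1 < n)%N -> smg R P0 G -> G P0 = 0 ->
    (\forall t \near (0 : R), q t ^+ n = G (t *: (lam *: e3) + P0)) -> 'd G P0 e3 = 0.
  move=> n1 sG G0 GE.
  have o2 : ordO R 2 (fun t : R => G (t *: (lam *: e3) + P0)).
    apply: (ordO_eq _ _ _ _ GE); apply: (ordO_le _ (n * 1)); first by rewrite muln1.
    exact: ordOX.
  have D := ordO2_is_derive _ o2.
  rewrite scale0r add0r in D; have {}D := D G0.
  have := derive1_line R _ P0 (lam *: e3) G sG.
  rewrite derive1E (@derive_val _ _ _ _ _ _ _ D) linearZ => /esym/eqP.
  by rewrite mulf_eq0 (negbTE lam0) => /eqP.
split; [apply: (vanish _ i) => //|apply: (vanish _ j) => //].
- by rewrite PhiP.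
- by apply: filterS nE => t [].
- by rewrite PhiP.
- by apply: filterS nE => t [].
Qed.

Lemma A_equiv_profile i j : (1 < i)%N -> (1 < j)%N -> ordO R 2 c1 -> ordO R 2 c2 ->
  A_equiv (helicoidal x z lam) (u0, v0) (cusp_model i j) 0 ->
  cusp_jets i j c1 c2.
Proof.
move=> i1 j1 oc1 oc2 [phi [Phi [[phip sphi [psi [psi0 spsi psiK phiK]]]]]].
set f := helicoidal x z lam.
have m0 : cusp_model i j (0 : R * R) = 0 :> R * R * R.
  by rewrite /cusp_model /= !expr0n !gtn_eqF // ltnW.
pose Z0 := z u0 + lam * v0.
have fp : f (u0, v0) = (0, 0, Z0) by rewrite /f /helicoidal /= x0 !mul0r.
rewrite m0 fp => -[PhiP sPhi [Psi [Psi0 sPsi PsiK PhiK]]] eqv.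
have [sphi1 sphi2] := smooth_at2_smg R _ _ sphi.
have [spsi1 spsi2] := smooth_at2_smg R _ _ spsi.
have [s1 s2 s3] := smooth_at3_smg R _ _ sPhi.
have [t1 t2 t3] := smooth_at3_smg R _ _ sPsi.
pose P0 : R * R * R := (0, 0, Z0).
pose e1 : R * R * R := (cos v0, sin v0, 0); pose e2 : R * R * R := (- sin v0, cos v0, 0).
pose e3 : R * R * R := (0, 0, 1).
(* The path in the surface lying over the plane [Z = Z0]. *)
have sz' : smg R 0 zeta.
  apply: smgM; last exact: smg_cst.
  apply: smgB; last exact: smg_cst.
  apply: (@smg_comp R R 0 z (fun t => u0 + t)); first by rewrite addr0.
  by apply: smgD; [exact: smg_cst|exact: smg_id].
have zeta0 : zeta 0 = 0 by rewrite /zeta addr0 subrr mul0r.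
pose path t : R * R := (u0 + t, v0 - zeta t).
have dpath : differentiable path 0.
  apply: differentiable_pair; apply: smg_differentiable.
    by apply: smgD; [exact: smg_cst|exact: smg_id].
  by apply: smgB => //; exact: smg_cst.
have path0 : path 0 = (u0, v0) by rewrite /path zeta0 addr0 subr0.
have pathN (P : set (R * R)) : (\forall y \near (u0, v0), P y) -> \forall t \near (0 : R), P (path t).
  by move=> HP; have cp := differentiable_continuous dpath; apply: cp; rewrite path0.
have pathE t : f (path t) = c1 t *: e1 + c2 t *: e2 + P0.
  rewrite /f /helicoidal /path /= cosB sinB /c1 /c2 /profile /= -/(zeta t).
  congr (_, _, _); rewrite /= /GRing.scale /=; last by rewrite /zeta /Z0; field.
    by ring.
  by ring.
pose q t := (phi (path t)).2; pose p t := (phi (path t)).1.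
have nE : \forall t \near (0 : R), (p t, q t ^+ i, q t ^+ j) = Phi (c1 t *: e1 + c2 t *: e2 + P0).
  by have := pathN _ eqv; apply: filterS => t; rewrite pathE.
have path_le : exists2 C : R, 0 < C & \forall t \near (0 : R), `|path t - (u0, v0)| <= C * `|t|.
  have [C C0 HC] := lipschitz_at _ _ _ _ (smg_differentiable _ _ _ sz').
  exists (1 + C); first exact: addr_gt0.
  apply: filterS HC => t; rewrite zeta0 !subr0 => zt.
  have -> : path t - (u0, v0) = (t, - zeta t).
    by rewrite /path; congr pair; rewrite /=; ring.
  rewrite norm_pair normrN ge_max mulrDl mul1r lerDl mulr_ge0 ?(ltW C0) //=.
  by apply: le_trans zt _; rewrite lerDr.
have [Cp Cp0 pathC] := path_le.
have q1 : ordO R 1 q.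
  have [C C0 HC] := lipschitz_at _ _ _ _ (smg_differentiable _ _ _ sphi2).
  exists (C * Cp); apply: filterS2 (pathN _ HC) pathC => t Ht pt.
  have : `|(phi (path t)).2 - (phi (u0, v0)).2| <= C * (Cp * `|t|).
    by apply: le_trans Ht _; rewrite ler_wpM2l // ltW.
  by rewrite phip subr0 expr1 mulrA.
(* [p] is a component of [Phi] along a path in the plane [Z = Z0] that leaves the base point only at
   order two. *)
have p2 : ordO R 2 p.
  have [C C0 HC] := lipschitz_at _ _ _ _ (smg_differentiable _ _ _ s1).
  apply: (ordO_norm_le _ _ (fun t => C * (`|e1| * `|c1 t| + `|e2| * `|c2 t|))); last first.
    by apply: ordOZ; apply: ordOD; apply: ordOZ; exact: ordO_norm.
  have cf : {for (u0, v0), continuous f}.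
    have sxu : smg R (u0, v0) (fun y : R * R => x y.1).
      by apply: (@smg_comp R _ (u0, v0) x fst) => //; exact: smg_fst.
    apply: differentiable_continuous; apply: differentiable_pair.
      apply: differentiable_pair; apply: smg_differentiable; apply: smgM => //.
        by apply: (@smg_comp R _ (u0, v0) cos snd); [exact: smg_cos|exact: smg_snd].
      by apply: (@smg_comp R _ (u0, v0) sin snd); [exact: smg_sin|exact: smg_snd].
    apply: smg_differentiable; apply: smgD.
      by apply: (@smg_comp R _ (u0, v0) z fst) => //; exact: smg_fst.
    by apply: smgM; [exact: smg_cst|exact: smg_snd].
  have nf : \forall y \near (u0, v0), `|(Phi (f y)).1.1 - (Phi P0).1.1| <= C * `|f y - P0|.
    by apply: (cf (fun y => `|(Phi y).1.1 - (Phi P0).1.1| <= C * `|y - P0|)); rewrite fp.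
  have := pathN _ nf.
  apply: filterS2 nE => t e; rewrite pathE -e PhiP subr0 /= addrK => Ht.
  apply: le_trans Ht _; rewrite [leRHS]ger0_norm; last first.
    by rewrite mulr_ge0 ?(ltW C0) // addr_ge0 // mulr_ge0.
  rewrite ler_wpM2l ?(ltW C0) //; apply: le_trans (ler_normD _ _) _.
  by rewrite !normrZ lerD // mulrC.
(* The inverse of [phi] recovers [t] from [(p, q)], so [|t| <= L max (|p|, |q|)]; since [p] is
   quadratic, the maximum is [|q|] for small nonzero [t]. *)
have [kap kap0 qlow] : exists2 kap : R, 0 < kap & \forall t \near (0 : R), kap * `|t| <= `|q t|.
  have [L L0 HL] := lipschitz_at _ _ _ _ (smg_differentiable _ _ _ spsi1).
  have [K K0 pK] := ordO_pos _ _ _ p2.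
  exists L^-1; first by rewrite invr_gt0.
  have nphi : \forall y \near (u0, v0), `|(psi (phi y)).1 - (psi 0).1| <= L * `|phi y - 0|.
    have cphi : {for (u0, v0), continuous phi}.
      rewrite (_ : phi = fun y => ((phi y).1, (phi y).2)); last first.
        by apply/funext => y; exact: surjective_pairing.
      exact/differentiable_continuous/differentiable_pair/smg_differentiable/sphi2/smg_differentiable.
    by apply: (cphi (fun y => `|(psi y).1 - (psi 0).1| <= L * `|y - 0|)); rewrite phip.
  have tsmall : \forall t \near (0 : R), `|t| < (L * K)^-1.
    by apply: (lt_near R _ (L * K)^-1); [rewrite invr_gt0 mulr_gt0|move=> t; rewrite subr0].
  have nK : \forall t \near (0 : R), `|p t| <= K * `|t| ^+ 2 /\ `|t| < (L * K)^-1.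
    exact: filterI.
  apply: filterS3 (pathN _ nphi) (pathN _ psiK) nK => t H1 H2 [H3 H4].
  rewrite mulrC ler_pdivrMr //.
  move: H1; rewrite H2 psi0 /= addrC addKr subr0.
  rewrite [phi (path t)]surjective_pairing norm_pair -/(p t) -/(q t) mulrC => H1.
  have [pq|qp] := leP `|p t| `|q t|; first by move: H1; rewrite max_r.
  move: H1; rewrite max_l ?(ltW qp) // => H1.
  have [->|tn0] := eqVneq t 0; first by rewrite normr0 mulr_ge0 // ltW.
  have tpos : 0 < `|t| by rewrite normr_gt0.
  have : `|t| <= (L * K * `|t|) * `|t|.
    by apply: le_trans H1 _; rewrite mulrC -!mulrA ler_wpM2l ?(ltW L0) // -expr2.
  rewrite -[X in X <= _]mul1r ler_pM2r // leNgt -ltr_pdivlMl ?mulr_gt0 //.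
  by rewrite mulr1 H4.
pose G1 (y : R * R * R) := (Phi y).1.1; pose G2 (y : R * R * R) := (Phi y).1.2.
pose G3 (y : R * R * R) := (Phi y).2.
have d1 : differentiable G1 P0 by exact: smg_differentiable.
have d2 : differentiable G2 P0 by exact: smg_differentiable.
have d3 : differentiable G3 P0 by exact: smg_differentiable.
have G20 : G2 P0 = 0 by rewrite /G2 PhiP.
have G30 : G3 P0 = 0 by rewrite /G3 PhiP.
have [k2 J2] : exists k, jet_relation c1 c2 (fun t => q t ^+ i) ('d G2 P0 e1) ('d G2 P0 e2) k.
  by apply: planar_taylor_jet => //; apply: filterS nE => t e; rewrite /G2 -e.
have [k3 J3] : exists k, jet_relation c1 c2 (fun t => q t ^+ j) ('d G3 P0 e1) ('d G3 P0 e2) k.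
  by apply: planar_taylor_jet => //; apply: filterS nE => t e; rewrite /G3 -e.
exists q, kap, ('d G2 P0 e1), ('d G2 P0 e2), k2, ('d G3 P0 e1), ('d G3 P0 e2), k3.
split => //.
have [v2 v3] : 'd G2 P0 e3 = 0 /\ 'd G3 P0 e3 = 0.
  exact: (vertical_derivatives phi Phi i j Z0).
have cs : cos v0 ^+ 2 + sin v0 ^+ 2 = 1 by exact: cos2Dsin2.
split.
(* If the last two differentials killed [e1] as well as [e3], these two independent vectors would be
   collinear. *)
- case=> a1 a2.
  have inj d : 'd G1 P0 d = 0 -> 'd G2 P0 d = 0 -> 'd G3 P0 d = 0 -> d = 0.
    exact: (diffeo_immersion Phi Psi P0 d PhiP s1 s2 s3 t1 t2 t3 PsiK).
  have E := collinear_of_injective _ ('d G1 P0) ('d G2 P0) ('d G3 P0) e1 e3 inj a1 a2 v2 v3.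
  have g10 : 'd G1 P0 e1 = 0.
    have := congr1 snd E; move: ('d G1 P0 e1) ('d G1 P0 e3) => g g'.
    by rewrite /= /GRing.scale /= mulr0 mulr1.
  have E1 := inj e1 g10 a1 a2.
  have c0 := congr1 (fun y => y.1.1) E1; have s0 := congr1 (fun y => y.1.2) E1.
  by move: cs; rewrite [cos v0]c0 [sin v0]s0 /= expr0n addr0 => /eqP; rewrite eq_sym oner_eq0.
(* If the last differential killed [e1], [e2] and [e3] it would be zero, contrary to
   [diffeo_submersion]. *)
- case=> a1 a2.
  have zero w : 'd G3 P0 w = 0.
    have -> : w = (w.1.1 * cos v0 + w.1.2 * sin v0) *: e1 +
        (- w.1.1 * sin v0 + w.1.2 * cos v0) *: e2 + w.2 *: e3.
      case: w => [[wa wb] wc]; congr (_, _, _); rewrite /= /GRing.scale /=.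
      + by rewrite mulr0 addr0; transitivity (wa * (cos v0 ^+ 2 + sin v0 ^+ 2)); [rewrite cs mulr1|ring].
      + by rewrite mulr0 addr0; transitivity (wb * (cos v0 ^+ 2 + sin v0 ^+ 2)); [rewrite cs mulr1|ring].
      + by rewrite !mulr0 !add0r mulr1.
    exact: (linear_comb_zero _ ('d G3 P0)).
  have := diffeo_submersion Phi Psi P0 PhiK.
  move=> /(_ (And3 t1 t2 t3) s3 Psi0) [w].
  by rewrite zero => /eqP; rewrite eq_sym oner_eq0.
Qed.
End NecessaryConditions.

(** * Factoring out powers and integrating *)

Section OrderOfVanishing.
Variable R : realType.

Lemma smooth_factor (f : R -> R) : smg R 0 f -> f 0 = 0 ->
  exists g : R -> R, [/\ smg R 0 g, forall t, f t = t * g t & g 0 = derive1 f 0].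
Proof.
move=> sf f0; have [g [sg fE]] := smooth_taylor R 2 f sf.
exists (fun t => derive1 f 0 + t * g t); split => [||].
- by apply: smgD; [exact: smg_cst|apply: smgM => //; exact: smg_id].
- move=> t; rewrite fE !taylorS taylor0 coefT0 f0 /coefT derive1n1 divr1.
  by ring.
- by rewrite mul0r addr0.
Qed.

Lemma smooth_primitive n (f k : R -> R) : smg R 0 f -> f 0 = 0 -> smg R 0 k ->
  (\forall t \near (0 : R), derive1 f t = t ^+ n * k t) ->
  exists g : R -> R, [/\ smg R 0 g, forall t, f t = t ^+ n.+1 * g t & g 0 = k 0 / n.+1%:R].
Proof.
move=> sf f0 sk fk; have [g [sg fE]] := smooth_taylor R n.+1 f sf.
have odf : ordO R n (derive1 f).
  have fk' : \forall t \near (0 : R), t ^+ n * k t = derive1 f t by apply: filterS fk => t ->.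
  by apply: (ordO_eq _ _ _ _ fk'); exact: ordO_Xn.
have of' : ordO R n.+1 f.
  apply: (ordO_primitive _ _ _ (derive1 f)) => //.
  by apply: filterS (smg_near _ _ _ sf) => t; exact: smg_is_derive.
have {}fE t : f t = t ^+ n.+1 * g t.
  rewrite fE /taylor horner_poly big1 ?add0r // => i _.
  by rewrite (ordO_coefT R n.+1) // mul0r.
exists g; split => //; apply: (canRL (mulfK _)); first by rewrite pnatr_eq0.
have [g1 [sg1 gE _]] := smooth_factor (fun t => g t - g 0) (smgB R 0 _ _ sg (smg_cst R 0 _)) (subrr _).
have [k1 [sk1 kE _]] := smooth_factor (fun t => k t - k 0) (smgB R 0 _ _ sk (smg_cst R 0 _)) (subrr _).
apply/eqP; rewrite -subr_eq0; apply/eqP; apply: (ordO_leading R n).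
(* By the product rule for [f = t^(n+1) g], the multiple [(n+1) g 0 - k 0] of [t^n] equals
   [t^(n+1) r]. *)
pose r t := k1 t - n.+1%:R * g1 t - derive1 g t.
have sr : smg R 0 r.
  apply: smgB; last exact: smg_derive1.
  by apply: smgB => //; apply: smgM => //; exact: smg_cst.
apply: (ordO_eq _ _ (fun t => t ^+ n.+1 * r t)); last exact: ordO_Xn.
apply: filterS2 fk (smg_near _ _ _ sg) => t ft /smg_is_derive gt.
have D : is_derive t 1 f (t ^+ n.+1 * derive1 g t + g t * (n.+1%:R * t ^+ n)).
  have -> : f = (fun t : R => t ^+ n.+1 * g t) by exact/funext.
  have dX := is_deriveX n.+1 (is_derive_id t 1).
  rewrite exprfctE in dX.
  by apply: (is_derive_eq (is_deriveM dX gt)); rewrite /GRing.scale /= mulr1.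
move: ft; rewrite derive1E (@derive_val _ _ _ _ _ _ _ D) => ft.
have gt0 : g t = g 0 + t * g1 t by rewrite -gE; ring.
have kt0 : k t = k 0 + t * k1 t by rewrite -kE; ring.
have : t ^+ n * k t - n.+1%:R * t ^+ n * g t = t ^+ n.+1 * derive1 g t by rewrite -ft; ring.
have -> : t ^+ n.+1 * r t =
    t ^+ n.+1 * k1 t - n.+1%:R * (t ^+ n.+1 * g1 t) - t ^+ n.+1 * derive1 g t by rewrite /r; ring.
by move=> <-; rewrite kt0 gt0 exprS; ring.
Qed.
End OrderOfVanishing.

(** * Orders of vanishing in the jet relations *)

Section JetObstructions.
Variable R : realType.
Variables (c1 c2 q : R -> R) (kap : R).
Hypothesis kap0 : 0 < kap.
Hypothesis q_low : \forall t \near (0 : R), kap * `|t| <= `|q t|.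
Hypothesis q_high : ordO R 1 q.

Lemma ordO_qX n : ordO R n (fun t => q t ^+ n).
Proof. by have := ordOX R 1 q n q_high; rewrite muln1. Qed.

Lemma ordO_qXS n : ~ ordO R n.+1 (fun t => q t ^+ n).
Proof.
move=> qn; suff : kap ^+ n = 0.
  by move/eqP; rewrite expf_eq0 gt_eqF // andbF.
apply: (ordO_leading R n); apply: (ordO_norm_le R n.+1 _ (fun t => q t ^+ n)) => //.
apply: filterS q_low => t qt; rewrite normrM !normrX (gtr0_norm kap0) -exprMn.
by apply: lerXn2r => //; rewrite nnegrE // mulr_ge0 // ltW.
Qed.

Lemma ordO_lead (g : R -> R) (c : R) k : smg R 0 g -> g 0 != 0 ->
  ordO R k.+1 (fun t => c * (t ^+ k * g t)) -> c = 0.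
Proof.
move=> sg g0 ok; have [g1 [sg1 gE _]] :=
  smooth_factor R (fun t => g t - g 0) (smgB R 0 _ _ sg (smg_cst R 0 _)) (subrr _).
suff /eqP : c * g 0 = 0 by rewrite mulf_eq0 (negbTE g0) orbF => /eqP.
apply: (ordO_leading R k).
have := ordOB _ _ _ _ ok (ordOZ _ _ c _ (ordO_Xn R k.+1 g1 sg1)).
apply: eq_ordO => t.
have -> : g t = g 0 + t * g1 t by rewrite -gE; ring.
by rewrite exprS; ring.
Qed.

(** Each remaining term on the right of the relation has order above [n], whereas [q^n] has order
    exactly [n]. *)
Lemma jet_ordO n a b g1 g2 k : jet_relation R c1 c2 (fun t => q t ^+ n) g1 g2 k ->
  (0 < a)%N -> (0 < b)%N -> ordO R a c1 -> ordO R b c2 ->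
  (g1 = 0 \/ (n < a)%N) -> (n < a * 2)%N -> (g2 = 0 \/ (n < b)%N) ->
  (n < b * 2)%N -> False.
Proof.
move=> J a0 b0 o1 o2 H1 H2 H3 H4; apply: (ordO_qXS n).
have r := J n.+1 a b a0 b0 o1 o2.
have {}r : ordO R n.+1 (fun t => q t ^+ n - (g1 * c1 t + k * c1 t ^+ 2 + g2 * c2 t)).
  by apply: r; lia.
have ok : ordO R n.+1 (fun t => k * c1 t ^+ 2).
  by apply: ordOZ; apply: ordO_le H2 _; rewrite mulnC; exact: ordOX.
have zero : ordO R n.+1 (fun _ => 0).
  by apply: (eq_ordO _ _ (fun t => t ^+ n.+1 * 0)); [move=> t; rewrite mulr0|apply/ordO_Xn/smg_cst].
have o1' : ordO R n.+1 (fun t => g1 * c1 t).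
  case: H1 => [->|na]; last by apply: ordOZ; exact: ordO_le o1.
  by apply: eq_ordO zero => t; rewrite mul0r.
have o2' : ordO R n.+1 (fun t => g2 * c2 t).
  case: H3 => [->|nb]; last by apply: ordOZ; exact: ordO_le o2.
  by apply: eq_ordO zero => t; rewrite mul0r.
by apply: eq_ordO (ordOD _ _ _ _ r (ordOD _ _ _ _ (ordOD _ _ _ _ o1' ok) o2')) => t; ring.
Qed.

(** At order [k] only [g1 c1] survives in the relation, and [c1] has order exactly [k]. *)
Lemma jet_first_coef n k (g : R -> R) g1 g2 k2 :
  jet_relation R c1 c2 (fun t => q t ^+ n) g1 g2 k2 -> smg R 0 g -> g 0 != 0 ->
  (forall t, c1 t = t ^+ k * g t) -> ordO R k.+1 c2 -> (0 < k)%N -> (k < n)%N -> g1 = 0.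
Proof.
move=> J sg g0 c1E o2 k0 kn; apply: (ordO_lead g g1 k sg g0).
have o1 : ordO R k c1 by apply: eq_ordO (ordO_Xn R k g sg) => t; rewrite c1E.
have r : ordO R k.+1 (fun t => q t ^+ n - (g1 * c1 t + k2 * c1 t ^+ 2 + g2 * c2 t)).
  by apply: (J _ k k.+1) => //; lia.
have ok : ordO R k.+1 (fun t => k2 * c1 t ^+ 2).
  by apply: ordOZ; apply: (ordO_le _ (2 * k)); [lia|exact: ordOX].
have oq : ordO R k.+1 (fun t => q t ^+ n) by apply: ordO_le kn _; exact: ordO_qX.
apply: eq_ordO (ordOB _ _ _ _ (ordOB _ _ _ _ oq r) (ordOD _ _ _ _ ok (ordOZ _ _ g2 _ o2))) => t.
by rewrite -c1E; ring.
Qed.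

Lemma jet_second_coef n k (h : R -> R) g2 k2 :
  jet_relation R c1 c2 (fun t => q t ^+ n) 0 g2 k2 -> smg R 0 h -> h 0 != 0 ->
  (forall t, c2 t = t ^+ k.+1 * h t) -> ordO R k c1 -> (1 < k)%N -> (k.+1 < n)%N -> g2 = 0.
Proof.
move=> J sh h0 c2E o1 k1 kn; apply: (ordO_lead h g2 k.+1 sh h0).
have o2 : ordO R k.+1 c2 by apply: eq_ordO (ordO_Xn R k.+1 h sh) => t; rewrite c2E.
have r : ordO R k.+2 (fun t => q t ^+ n - (0 * c1 t + k2 * c1 t ^+ 2 + g2 * c2 t)).
  by apply: (J _ k k.+1) => //; lia.
have ok : ordO R k.+2 (fun t => k2 * c1 t ^+ 2).
  by apply: ordOZ; apply: (ordO_le _ (2 * k)); [lia|exact: ordOX].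
have oq : ordO R k.+2 (fun t => q t ^+ n) by apply: ordO_le kn _; exact: ordO_qX.
apply: eq_ordO (ordOB _ _ _ _ (ordOB _ _ _ _ oq r) ok) => t.
by rewrite -c2E; ring.
Qed.

(** If the curve agrees with a parabola up to order six, the relation reads [q^5 = (k + g2 m) c1^2]
    modulo order six. The order four of [c1^2] forces the coefficient to vanish, and then [q^5]
    would have order six. *)
Lemma jet_parabola (g : R -> R) g1 g2 k m :
  jet_relation R c1 c2 (fun t => q t ^+ 5) g1 g2 k -> smg R 0 g -> g 0 != 0 ->
  (forall t, c1 t = t ^+ 2 * g t) -> ordO R 6 (fun t => c2 t - m * c1 t ^+ 2) -> False.
Proof.
move=> J sg g0 c1E o6.
have o1 : ordO R 2 c1 by apply: eq_ordO (ordO_Xn R 2 g sg) => t; rewrite c1E.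
have o11 : ordO R 4 (fun t => c1 t ^+ 2) by exact: (ordOX R 2 c1 2).
have o2 : ordO R 4 c2.
  have o6' : ordO R 4 (fun t => c2 t - m * c1 t ^+ 2) by apply: ordO_le o6.
  by apply: eq_ordO (ordOD _ _ _ _ o6' (ordOZ _ _ m _ o11)) => t; ring.
have g10 : g1 = 0.
  by apply: (jet_first_coef 5 2 g g1 g2 k J sg g0 c1E) => //; apply: ordO_le o2.
have r : ordO R 6 (fun t => q t ^+ 5 - (g1 * c1 t + k * c1 t ^+ 2 + g2 * c2 t)).
  by apply: (J _ 2%N 4%N).
have r' : ordO R 6 (fun t => q t ^+ 5 - (k + g2 * m) * c1 t ^+ 2).
  by apply: eq_ordO (ordOD _ _ _ _ r (ordOZ _ _ g2 _ o6)) => t; rewrite g10; ring.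
have k0 : k + g2 * m = 0.
  apply: (ordO_lead (fun t => g t ^+ 2) _ 4); [exact: smgX|by rewrite expf_neq0|].
  have r5 : ordO R 5 (fun t => q t ^+ 5 - (k + g2 * m) * c1 t ^+ 2) by apply: ordO_le r'.
  by apply: eq_ordO (ordOB _ _ _ _ (ordO_qX 5) r5) => t; rewrite c1E; ring.
by apply: (ordO_qXS 5); apply: eq_ordO r' => t; rewrite k0; ring.
Qed.
End JetObstructions.

(** * Structure equations of the Legendre curve *)

Section MovingFrame.
Variable R : realType.

Lemma smg_shift (u0 : R) (f : R -> R) : smg R u0 f -> smg R 0 (fun t : R => f (u0 + t)).
Proof.
move=> sf; apply: (@smg_comp R R 0 f (fun t => u0 + t)); first by rewrite addr0.
by apply: smgD; [exact: smg_cst|exact: smg_id].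
Qed.

Lemma near_shift_at (u0 : R) (P : set R) : (\forall u \near u0, P u) ->
  \forall t \near (0 : R), P (u0 + t).
Proof. by move=> /near_shift0; apply: filterS => t; rewrite addrC. Qed.

Lemma derive1_shift (u0 : R) (f : R -> R) : smg R u0 f ->
  \forall t \near (0 : R), derive1 (fun t => f (u0 + t)) t = derive1 f (u0 + t).
Proof.
move=> sf; have := near_shift_at _ _ (smg_near R _ _ sf).
apply: filterS => t /smg_is_derive ft.
have ds : is_derive t 1 (fun t : R => u0 + t) 1.
  by have := is_deriveD (is_derive_cst u0 t 1) (is_derive_id t 1); rewrite add0r.
have D := @is_derive1_comp R f (fun t => u0 + t) t _ _ ft ds.
by rewrite derive1E (@derive_val _ _ _ _ _ _ _ D) mulr1.
Qed.

Lemma derive1_of (f : R -> R) (t l : R) : is_derive t 1 f l -> derive1 f t = l.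
Proof. by move=> D; rewrite derive1E (@derive_val _ _ _ _ _ _ _ D). Qed.

(** Both [(x', z')] and, by differentiating [a^2 + b^2 = 1], [(a', b')] are orthogonal to [(a, b)];
    each is therefore its component along [(-b, a)]. *)
Lemma smg_frame (I : set R) (x z a b : R -> R) u0 : open I -> I u0 -> legendre I x z a b ->
  [/\ smg R u0 x, smg R u0 z, smg R u0 a & smg R u0 b] /\
  [/\ smg R u0 (curv_ell a b), smg R u0 (curv_beta x z a b) &
  \forall u \near u0, [/\ a u ^+ 2 + b u ^+ 2 = 1,
    derive1 x u = - curv_beta x z a b u * b u, derive1 z u = curv_beta x z a b u * a u,
    derive1 a u = - curv_ell a b u * b u & derive1 b u = curv_ell a b u * a u]].
Proof.
move=> oI Iu [[sx sz sa sb] [unit orth]].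
have S (f : R -> R) : smooth_on I f -> smg R u0 f.
  by move=> sf; exists I; split => //; exact: smooth_on_sm1.
have {}sx := S _ sx; have {}sz := S _ sz; have {}sa := S _ sa; have {}sb := S _ sb.
have dx := smg_derive1 _ _ _ sx; have dz := smg_derive1 _ _ _ sz.
have da := smg_derive1 _ _ _ sa; have db := smg_derive1 _ _ _ sb.
split => //; split.
- by apply: smgD; apply: smgM => //; exact: smgN.
- by apply: smgD; apply: smgM => //; exact: smgN.
have nI := open_nbhs_nbhs (conj oI Iu).
apply: filterS3 (smg_near R _ _ sa) (smg_near R _ _ sb) nI => u sau sbu Iu'.
have ab := unit u Iu'; have xz := orth u Iu'.
have abd : a u * derive1 a u + b u * derive1 b u = 0.
  have Da := smg_is_derive R _ _ sau; have Db := smg_is_derive R _ _ sbu.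
  have D := is_deriveD (is_deriveM Da Da) (is_deriveM Db Db).
  have nc : \forall w \near u, (a * a + b * b) w = cst (1 : R) w.
    apply: filterS (open_nbhs_nbhs (conj oI Iu')) => w /unit <-.
    by rewrite !expr2.
  have E := @near_eq_derive _ _ _ (a * a + b * b) (cst (1 : R)) u (1 : R) nc; rewrite derive_cst (@derive_val _ _ _ _ _ _ _ D) in E.
  by move: E; rewrite /GRing.scale /= => E; lra.
rewrite /curv_beta /curv_ell; move: ab xz abd.
move: (a u) (b u) (derive1 x u) (derive1 z u) (derive1 a u) (derive1 b u).
move=> A B x' z' a' b' ab xz abd.
have E1 : x' = x' * (A ^+ 2 + B ^+ 2) by rewrite ab mulr1.
have E2 : z' = z' * (A ^+ 2 + B ^+ 2) by rewrite ab mulr1.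
have E3 : a' = a' * (A ^+ 2 + B ^+ 2) by rewrite ab mulr1.
have E4 : b' = b' * (A ^+ 2 + B ^+ 2) by rewrite ab mulr1.
split => //.
- rewrite {1}E1; transitivity (x' * B ^+ 2 - z' * A * B + A * (x' * A + z' * B)); first by ring.
  by rewrite xz; ring.
- rewrite {1}E2; transitivity (z' * A ^+ 2 - x' * A * B + B * (x' * A + z' * B)); first by ring.
  by rewrite xz; ring.
- rewrite {1}E3; transitivity (a' * B ^+ 2 - b' * A * B + A * (A * a' + B * b')); first by ring.
  by rewrite abd; ring.
- rewrite {1}E4; transitivity (b' * A ^+ 2 - a' * A * B + B * (A * a' + B * b')); first by ring.
  by rewrite abd; ring.
Qed.
End MovingFrame.

(** * Orders of vanishing of the profile *)

Section ProfileOrders.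
Variable R : realType.
Variables (X ze a b be el : R -> R) (lam : R).
Hypotheses (sX : smg R 0 X) (sze : smg R 0 ze) (sa : smg R 0 a) (sb : smg R 0 b)
  (sbe : smg R 0 be) (sel : smg R 0 el).
Hypotheses (X0 : X 0 = 0) (ze0 : ze 0 = 0) (lam0 : lam != 0).
Hypothesis frame : \forall t \near (0 : R), [/\ a t ^+ 2 + b t ^+ 2 = 1,
  derive1 X t = - be t * b t, derive1 ze t = be t * a t / lam,
  derive1 a t = - el t * b t & derive1 b t = el t * a t].

Let c1 t := X t * cos (ze t).
Let c2 t := - (X t * sin (ze t)).

Lemma smg_cos_ze : smg R 0 (fun t : R => cos (ze t)).
Proof. by apply: (@smg_comp R R 0 cos ze) => //; exact: smg_cos. Qed.

Lemma profile_orders n m (xi eta : R -> R) : smg R 0 xi -> smg R 0 eta ->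
  (forall t, X t = t ^+ n * xi t) -> (forall t, ze t = t ^+ m * eta t) ->
  exists g h : R -> R, [/\ smg R 0 g, smg R 0 h, forall t, c1 t = t ^+ n * g t,
    forall t, c2 t = t ^+ (n + m) * h t & g 0 = xi 0 /\ h 0 = - (xi 0 * eta 0)].
Proof.
move=> sxi seta XE zE.
have [S [sS SE S0]] := smooth_factor R sin (smg_sin R 0) (sin0 R).
have S1 : S 0 = 1.
  by rewrite S0 (derive1_of R _ _ _ (is_derive_sin 0)) cos0.
have sSz : smg R 0 (fun t : R => S (ze t)) by apply: (@smg_comp R R 0 S ze) => //; rewrite ze0.
exists (fun t => xi t * cos (ze t)), (fun t => - (xi t * eta t * S (ze t))); split.
- by apply: smgM => //; exact: smg_cos_ze.
- by apply: smgN; apply: smgM => //; exact: smgM.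
- by move=> t; rewrite /c1 XE mulrA.
- by move=> t; rewrite /c2 SE XE {1}zE exprD; ring.
- by rewrite ze0 cos0 S1 !mulr1.
Qed.

Lemma ab_unit : a 0 ^+ 2 + b 0 ^+ 2 = 1.
Proof. by have [] := nbhs_singleton frame. Qed.

Lemma derive1_b0 : derive1 b 0 = el 0 * a 0.
Proof. by have [] := nbhs_singleton frame. Qed.

Lemma a_neq0 : b 0 = 0 -> a 0 != 0.
Proof.
move=> b0; have := ab_unit; rewrite b0 expr0n addr0 => a1.
by apply/eqP => a0; move: a1; rewrite a0 expr0n => /eqP; rewrite eq_sym oner_eq0.
Qed.

(** Integration of [x' = - beta b] and [zeta' = beta a / lam]: if [t^i] divides [beta] and [t^j]
    divides [b], then [x] gains order [i + j + 1] and [zeta] order [i + 1]. *)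
Lemma integrate_frame i j (B D : R -> R) : smg R 0 B -> smg R 0 D ->
  (\forall t \near (0 : R), be t = t ^+ i * B t) -> (\forall t \near (0 : R), b t = t ^+ j * D t) ->
  exists xi eta : R -> R, [/\ smg R 0 xi, smg R 0 eta,
    forall t, X t = t ^+ (i + j).+1 * xi t, forall t, ze t = t ^+ i.+1 * eta t &
    xi 0 = - (B 0 * D 0) / (i + j).+1%:R /\ eta 0 = B 0 * a 0 / lam / i.+1%:R].
Proof.
move=> sB sD bE dE.
have [xi [sxi XE xi0]] : exists g : R -> R, [/\ smg R 0 g, forall t, X t = t ^+ (i + j).+1 * g t &
    g 0 = - (B 0 * D 0) / (i + j).+1%:R].
  apply: (smooth_primitive R (i + j) X (fun t => - (B t * D t))) => //.
    by apply: smgN; exact: smgM.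
  by apply: filterS3 frame bE dE => t [_ -> _ _ _] -> ->; rewrite exprD; ring.
have [eta [seta zE eta0]] : exists g : R -> R, [/\ smg R 0 g, forall t, ze t = t ^+ i.+1 * g t &
    g 0 = B 0 * a 0 / lam / i.+1%:R].
  apply: (smooth_primitive R i ze (fun t => B t * a t / lam)) => //.
    by apply: smgM; [exact: smgM|exact: smg_cst].
  by apply: filterS2 frame bE => t [_ _ -> _ _] ->; rewrite -!mulrA.
by exists xi, eta; split.
Qed.

Lemma profile_frame i j (B D : R -> R) : smg R 0 B -> smg R 0 D ->
  (\forall t \near (0 : R), be t = t ^+ i * B t) -> (\forall t \near (0 : R), b t = t ^+ j * D t) ->
  exists g h : R -> R, [/\ smg R 0 g, smg R 0 h, forall t, c1 t = t ^+ (i + j).+1 * g t,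
    forall t, c2 t = t ^+ ((i + j).+1 + i.+1) * h t &
    g 0 = - (B 0 * D 0) / (i + j).+1%:R /\
    h 0 = - (g 0 * (B 0 * a 0 / lam / i.+1%:R))].
Proof.
move=> sB sD bE dE.
have [xi [eta [sxi seta XE zE [xi0 eta0]]]] := integrate_frame i j B D sB sD bE dE.
have [g [h [sg sh c1E c2E [g0 h0]]]] := profile_orders _ _ xi eta sxi seta XE zE.
by exists g, h; split => //; rewrite g0 h0 xi0 eta0.
Qed.
End ProfileOrders.

(** * Exclusion of cusp types by the order of the profile *)

Section CuspObstructions.
Variable R : realType.
Variables (c1 c2 : R -> R) (i j : nat).
Hypothesis J : cusp_jets R i j c1 c2.

Lemma no_cusp_small : (0 < i)%N -> ordO R i.+1 c1 -> ordO R i.+1 c2 -> False.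
Proof.
move=> i0 o1 o2; have [q [kap [f1 [f2 [kf [h1 [h2 [kh [[q1 ka0 ql Jf Jh] _]]]]]]]]] := J.
by apply: (jet_ordO R c1 c2 q kap ka0 ql i i.+1 i.+1 f1 f2 kf Jf) => //;
  first [lia|by left|by right].
Qed.

(** If [k] is below both exponents, both coefficients of [c1] vanish, against the first
    nondegeneracy clause. *)
Lemma no_cusp_low k (g : R -> R) : smg R 0 g -> g 0 != 0 -> (forall t, c1 t = t ^+ k * g t) ->
  ordO R k.+1 c2 -> (0 < k)%N -> (k < i)%N -> (k < j)%N -> False.
Proof.
move=> sg g0 c1E o2 k0 ki kj.
have [q [kap [f1 [f2 [kf [h1 [h2 [kh [[q1 ka0 ql Jf Jh] [nz _]]]]]]]]]] := J.
apply: nz; split.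
- exact: (jet_first_coef R c1 c2 q kap ka0 q1 i k g f1 f2 kf).
- exact: (jet_first_coef R c1 c2 q kap ka0 q1 j k g h1 h2 kh).
Qed.

(** A curve of orders [k] and [k + 1] with [j] above both loses its whole linear part in the
    relation for [q^j], against the second clause. *)
Lemma no_cusp_mid k (g h : R -> R) : smg R 0 g -> g 0 != 0 -> (forall t, c1 t = t ^+ k * g t) ->
  smg R 0 h -> h 0 != 0 -> (forall t, c2 t = t ^+ k.+1 * h t) -> (1 < k)%N -> (k.+1 < j)%N ->
  False.
Proof.
move=> sg g0 c1E sh h0 c2E k1 kj.
have [q [kap [f1 [f2 [kf [h1 [h2 [kh [[q1 ka0 ql Jf Jh] [_ nz]]]]]]]]]] := J.
have o1 : ordO R k c1 by apply: eq_ordO (ordO_Xn R k g sg) => t; rewrite c1E.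
have o2 : ordO R k.+1 c2 by apply: eq_ordO (ordO_Xn R k.+1 h sh) => t; rewrite c2E.
have z1 : h1 = 0 by apply: (jet_first_coef R c1 c2 q kap ka0 q1 j k g h1 h2 kh) => //; lia.
apply: nz; split => //; rewrite z1 in Jh.
exact: (jet_second_coef R c1 c2 q kap ka0 q1 j k h h2 kh).
Qed.

(** An exponent strictly between [k] and [2 k], and below [b], cannot be the order of any
    combination of [c1], [c1^2] and [c2]: the term in [c1] must vanish and the others start too
    late. *)
Lemma no_cusp_high k b (g : R -> R) : smg R 0 g -> g 0 != 0 -> (forall t, c1 t = t ^+ k * g t) ->
  ordO R b c2 -> (0 < k)%N -> (k < b)%N ->
  [&& (k < i)%N, (i < k * 2)%N & (i < b)%N] || [&& (k < j)%N, (j < k * 2)%N & (j < b)%N] -> False.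
Proof.
move=> sg g0 c1E ob k0 kb H.
have [q [kap [f1 [f2 [kf [h1 [h2 [kh [[q1 ka0 ql Jf Jh] _]]]]]]]]] := J.
have o1 : ordO R k c1 by apply: eq_ordO (ordO_Xn R k g sg) => t; rewrite c1E.
have o2 : ordO R k.+1 c2 by exact: ordO_le ob.
case/orP: H => /and3P[kn n2k nb].
- have z1 : f1 = 0 by exact: (jet_first_coef R c1 c2 q kap ka0 q1 i k g f1 f2 kf).
  apply: (jet_ordO R c1 c2 q kap ka0 ql i k b f1 f2 kf Jf) => //;
    first [lia|by left|by right].
- have z1 : h1 = 0 by exact: (jet_first_coef R c1 c2 q kap ka0 q1 j k g h1 h2 kh).
  apply: (jet_ordO R c1 c2 q kap ka0 ql j k b h1 h2 kh Jh) => //;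
    first [lia|by left|by right].
Qed.

Lemma no_cusp_parabola (g : R -> R) m : j = 5 -> smg R 0 g -> g 0 != 0 ->
  (forall t, c1 t = t ^+ 2 * g t) -> ordO R 6 (fun t => c2 t - m * c1 t ^+ 2) -> False.
Proof.
move=> j5 sg g0 c1E o6.
have [q [kap [f1 [f2 [kf [h1 [h2 [kh [[q1 ka0 ql Jf Jh] _]]]]]]]]] := J.
rewrite j5 in Jh.
exact: (jet_parabola R c1 c2 q kap ka0 ql q1 g h1 h2 kh m).
Qed.
End CuspObstructions.

(** * The profile in each of the three cases *)

Section ProfileCusps.
Variable R : realType.
Variables (X ze a b be el : R -> R) (lam : R).
Hypotheses (sX : smg R 0 X) (sze : smg R 0 ze) (sa : smg R 0 a) (sb : smg R 0 b)
  (sbe : smg R 0 be) (sel : smg R 0 el).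
Hypotheses (X0 : X 0 = 0) (ze0 : ze 0 = 0) (lam0 : lam != 0).
Hypothesis frame : \forall t \near (0 : R), [/\ a t ^+ 2 + b t ^+ 2 = 1,
  derive1 X t = - be t * b t, derive1 ze t = be t * a t / lam,
  derive1 a t = - el t * b t & derive1 b t = el t * a t].

Let c1 t := X t * cos (ze t).
Let c2 t := - (X t * sin (ze t)).
Let c t := (c1 t, c2 t).

Lemma ordO_vanishing n (f g : R -> R) : smg R 0 g -> g 0 = 0 ->
  (forall t, f t = t ^+ n * g t) -> ordO R n.+1 f.
Proof.
move=> sg g0 fE; have [k [sk gE _]] := smooth_factor R g sg g0.
by apply: eq_ordO (ordO_Xn R n.+1 k sk) => t; rewrite fE gE exprSr mulrA.
Qed.

Lemma ordO_mono n (f g : R -> R) : smg R 0 g -> (forall t, f t = t ^+ n * g t) -> ordO R n f.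
Proof. by move=> sg fE; apply: eq_ordO (ordO_Xn R n g sg) => t; rewrite fE. Qed.

Let pf := profile_frame R X ze a b be el lam sX sze sa X0 ze0 frame.

Let near_pow0 (f : R -> R) : \forall t \near (0 : R), f t = t ^+ 0 * f t.
Proof. by near=> t; rewrite expr0 mul1r. Unshelve. all: by end_near. Qed.

Let near_pow1 (f g : R -> R) : (forall t, f t = t * g t) ->
  \forall t \near (0 : R), f t = t ^+ 1 * g t.
Proof. by move=> fg; near=> t; rewrite expr1. Unshelve. all: by end_near. Qed.

Lemma profile_II_regular : b 0 = 0 -> be 0 != 0 -> el 0 != 0 ->
  exists g h : R -> R, [/\ smg R 0 g, smg R 0 h, forall t, c1 t = t ^+ 2 * g t,
    forall t, c2 t = t ^+ 3 * h t & g 0 != 0 /\ h 0 != 0].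
Proof.
move=> b0 be0 el0; have a0 := a_neq0 R X ze a b be el lam frame b0.
have [D [sD bE D0]] := smooth_factor R b sb b0.
have [g [h [sg sh c1E c2E [g0 h0]]]] := pf 0 1 be D sbe sD (near_pow0 _) (near_pow1 _ _ bE).
have D0' : D 0 != 0.
  by rewrite D0 (derive1_b0 R X ze a b be el lam frame) mulf_neq0.
have gn : g 0 != 0.
  by rewrite g0 mulf_neq0 ?oppr_eq0 ?invr_eq0 ?pnatr_eq0 // mulf_neq0.
exists g, h; split => //; split => //.
by rewrite h0 oppr_eq0 !mulf_neq0 ?invr_eq0 ?pnatr_eq0.
Qed.

(** Here [b' = ell a] vanishes at 0 along with [b], so [t^2] divides [b]; its leading coefficient is
    governed by [ell']. *)
Lemma profile_II_singular : b 0 = 0 -> be 0 != 0 -> el 0 = 0 ->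
  exists g h : R -> R, [/\ smg R 0 g, smg R 0 h, forall t, c1 t = t ^+ 3 * g t,
    forall t, c2 t = t ^+ 4 * h t &
    (derive1 el 0 = 0 -> g 0 = 0) /\ (derive1 el 0 != 0 -> g 0 != 0 /\ h 0 != 0)].
Proof.
move=> b0 be0 el0; have a0 := a_neq0 R X ze a b be el lam frame b0.
have [E [sE elE E0]] := smooth_factor R el sel el0.
have [D [sD bE D0]] : exists D : R -> R, [/\ smg R 0 D, forall t, b t = t ^+ 2 * D t &
    D 0 = E 0 * a 0 / 2].
  apply: (smooth_primitive R 1 b (fun t => E t * a t)) => //; first exact: smgM.
  by apply: filterS frame => t [_ _ _ _ ->]; rewrite elE expr1 mulrA.
have bE' : \forall t \near (0 : R), b t = t ^+ 2 * D t by near=> t.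
have [g [h [sg sh c1E c2E [g0 h0]]]] := pf 0 2 be D sbe sD (near_pow0 _) bE'.
exists g, h; split => //; split => [e0|e0].
  by rewrite g0 D0 E0 e0 !mul0r mulr0 oppr0 mul0r.
have gn : g 0 != 0.
  rewrite g0 mulf_neq0 ?oppr_eq0 ?invr_eq0 ?pnatr_eq0 // mulf_neq0 // D0.
  by rewrite E0 !mulf_neq0 ?invr_eq0 ?pnatr_eq0.
split => //.
by rewrite h0 oppr_eq0 !mulf_neq0 ?invr_eq0 ?pnatr_eq0.
Unshelve. all: by end_near. Qed.

(** Both [beta] and [b] are divisible by [t]; their leading coefficients are [beta'] and [ell a],
    with [a] nonzero. *)
Lemma profile_III : b 0 = 0 -> be 0 = 0 ->
  exists g h : R -> R, [/\ smg R 0 g, smg R 0 h, forall t, c1 t = t ^+ 3 * g t,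
    forall t, c2 t = t ^+ 5 * h t &
    (derive1 be 0 * el 0 = 0 -> g 0 = 0) /\
    (derive1 be 0 * el 0 != 0 -> g 0 != 0 /\ h 0 != 0)].
Proof.
move=> b0 be0; have a0 := a_neq0 R X ze a b be el lam frame b0.
have [D [sD bE D0]] := smooth_factor R b sb b0.
have [B [sB beE B0]] := smooth_factor R be sbe be0.
have [g [h [sg sh c1E c2E [g0 h0]]]] := pf 1 1 B D sB sD (near_pow1 _ _ beE) (near_pow1 _ _ bE).
have BD : B 0 * D 0 = derive1 be 0 * el 0 * a 0.
  by rewrite B0 D0 (derive1_b0 R X ze a b be el lam frame) mulrA.
exists g, h; split => //; split => [e0|e0].
  by rewrite g0 BD e0 mul0r oppr0 mul0r.
have gn : g 0 != 0.
  by rewrite g0 BD mulf_neq0 ?oppr_eq0 ?invr_eq0 ?pnatr_eq0 // mulf_neq0.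
split => //; move: e0; rewrite mulf_eq0 negb_or -B0 => /andP[B0' _].
by rewrite h0 oppr_eq0 !mulf_neq0 ?invr_eq0 ?pnatr_eq0.
Qed.

Lemma profile_I_flat : be 0 = 0 -> derive1 be 0 = 0 ->
  exists g h : R -> R, [/\ smg R 0 g, smg R 0 h, forall t, c1 t = t ^+ 3 * g t &
    forall t, c2 t = t ^+ 6 * h t].
Proof.
move=> be0 be1; have [B [sB beE B0]] := smooth_factor R be sbe be0.
rewrite be1 in B0; have [B2 [sB2 BE _]] := smooth_factor R B sB B0.
have beE' : \forall t \near (0 : R), be t = t ^+ 2 * B2 t.
  by near=> t; rewrite beE BE mulrA.
have [g [h [sg sh c1E c2E _]]] := pf 2 0 B2 b sB2 sb beE' (near_pow0 _).
by exists g, h.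
Unshelve. all: by end_near. Qed.

(* To order five the profile deviates from a parabola by [- beta'^2 l t^5 / (6 lam)]. *)
Lemma profile_I_regular : be 0 = 0 -> b 0 != 0 -> derive1 be 0 != 0 ->
  exists (m : R) (g h k : R -> R), [/\ smg R 0 g, smg R 0 h & smg R 0 k] /\
  [/\ forall t, c1 t = t ^+ 2 * g t, forall t, c2 t = t ^+ 4 * h t,
    forall t, c2 t + m * c1 t ^+ 2 = t ^+ 5 * k t, g 0 != 0 &
    k 0 = - (derive1 be 0 ^+ 2 * el 0 / (6 * lam))].
Proof.
move=> be0 b0 be1; have [B [sB beE B0]] := smooth_factor R be sbe be0.
have [xi [eta [sxi seta XE zE [xi0 eta0]]]] :=
  integrate_frame R X ze a b be el lam sX sze sa X0 ze0 frame 1 0 B b sB sb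
    (near_pow1 _ _ beE) (near_pow0 _).
have [g [h [sg sh c1E c2E [g0 h0]]]] := profile_orders R X ze sze ze0 _ _ xi eta sxi seta XE zE.
(* The derivative of [ze - m X] is [beta w]; this [m] makes [w] vanish at 0, which raises the order
   of [ze - m X] from two to three. *)
pose m := - (a 0 / (lam * b 0)).
pose w t := a t / lam + m * b t.
have sw : smg R 0 w by apply: smgD; [apply: smgM => //; exact: smg_cst|exact: smgZ].
have w0 : w 0 = 0 by rewrite /w /m; field; rewrite lam0 b0.
have [W [sW wE W0]] := smooth_factor R w sw w0.
have W0' : W 0 = - (el 0 / (lam * b 0)).
  have [ab _ _ da db] := nbhs_singleton frame.
  have Da := smg_is_derive R _ _ sa; have Db := smg_is_derive R _ _ sb.
  have D := is_deriveD (is_deriveZ lam^-1 Da) (is_deriveZ m Db).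
  have wfun : w = (lam^-1 *: a + m *: b)%R.
    by apply/funext => t; rewrite /w mulrC.
  rewrite W0 wfun (derive1_of R _ _ _ D) da db /GRing.scale /= /m.
  (* The unit relation [a^2 + b^2 = 1] reduces [w' (0)] to a multiple of [ell]. *)
  transitivity (- (el 0 / (lam * b 0)) * (a 0 ^+ 2 + b 0 ^+ 2)); last by rewrite ab mulr1.
  by field; rewrite lam0 b0.
pose F t := ze t - m * X t.
have sF : smg R 0 F by apply: smgB => //; exact: smgZ.
have F0 : F 0 = 0 by rewrite /F ze0 X0 mulr0 subr0.
have [N [sN FE N0]] : exists N : R -> R, [/\ smg R 0 N, forall t, F t = t ^+ 3 * N t &
    N 0 = B 0 * W 0 / 3].
  apply: (smooth_primitive R 2 F (fun t => B t * W t)) => //; first exact: smgM.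
  apply: filterS3 frame (smg_near R _ _ sX) (smg_near R _ _ sze) => t [_ dX dz _ _].
  move=> /smg_is_derive DX /smg_is_derive Dz.
  have D := is_deriveB Dz (is_deriveZ m DX).
  rewrite (derive1_of R _ _ _ D) dX dz /GRing.scale /= beE.
  transitivity (t * B t * w t); first by rewrite /w; ring.
  by rewrite wE; ring.
have [S [sS SE]] := smooth_taylor R 2 sin (smg_sin R 0).
have {}SE y : sin y = y + y ^+ 2 * S y.
  rewrite {1}SE !taylorS taylor0 coefT0 sin0 /coefT derive1n1 divr1.
  by rewrite (derive1_of R _ _ _ (is_derive_sin 0)) cos0; ring.
have sSz : smg R 0 (fun t : R => S (ze t)) by apply: (@smg_comp R R 0 S ze) => //; rewrite ze0.
exists m, g, h, (fun t => - (xi t * N t) - t * (xi t * eta t ^+ 2 * S (ze t)) - m * (t ^+ 3 * h t ^+ 2)).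
split; split => //.
- apply: smgB; last by apply/smgZ/smg_mono/smgX.
  apply: smgB; first by apply: smgN; exact: smgM.
  apply: smgM; first exact: smg_id.
  by apply: smgM => //; apply: smgM => //; exact: smgX.
- move=> t.
  (* After this substitution, [m X^2] cancels against the part [m X] of [ze], leaving
     [- X (ze - m X)] at order five; the square of [c2] has order eight. *)
  have -> : c1 t ^+ 2 = X t ^+ 2 - c2 t ^+ 2.
    rewrite /c1 /c2 -[X t ^+ 2]mulr1 -(cos2Dsin2 (ze t)); ring.
  rewrite [c2 t ^+ 2](_ : _ = (t ^+ 4 * h t) ^+ 2); last by rewrite -c2E.
  have FEt : ze t = t ^+ 3 * N t + m * X t by rewrite -FE /F; ring.
  rewrite /c2 SE; have -> : X t * (ze t + ze t ^+ 2 * S (ze t)) =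
     X t * (t ^+ 3 * N t + m * X t) + X t * ze t ^+ 2 * S (ze t) by rewrite {1}FEt; ring.
  by rewrite !XE {1}zE; ring.
- by rewrite g0 xi0 mulf_neq0 ?invr_eq0 ?pnatr_eq0 // oppr_eq0 mulf_neq0 // B0.
- rewrite !mul0r expr0n !mul0r mulr0 !subr0 xi0 N0 W0' B0.
  by field; rewrite lam0 b0.
Qed.
End ProfileCusps.

(** * The three cases, by comparison of orders *)

Theorem theorem4p3 (R : realType) (I : set R) (x z a b : R -> R) (u0 lam : R) :
  open I -> is_interval I -> legendre I x z a b -> I u0 -> x u0 = 0 -> lam != 0 ->
  let r := helicoidal x z lam in
  let ell := curv_ell a b in
  let beta := curv_beta x z a b in
  (* (I) *)
  (beta u0 = 0 -> b u0 != 0 -> forall v : R,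
     (cuspidal_edge 5 2 r (u0, v) <-> derive1 beta u0 * ell u0 != 0) /\
     ~ cuspidal_edge 3 2 r (u0, v) /\ ~ cuspidal_edge 4 3 r (u0, v) /\
     ~ cuspidal_edge 5 3 r (u0, v)) /\
  (* (II) *)
  (beta u0 != 0 -> b u0 = 0 -> forall v : R,
     (cuspidal_edge 3 2 r (u0, v) <-> ell u0 != 0) /\
     (cuspidal_edge 4 3 r (u0, v) <-> ell u0 = 0 /\ derive1 ell u0 != 0) /\
     ~ cuspidal_edge 5 2 r (u0, v) /\ ~ cuspidal_edge 5 3 r (u0, v)) /\
  (* (III) *)
  (beta u0 = 0 -> b u0 = 0 -> forall v : R,
     (cuspidal_edge 5 3 r (u0, v) <-> derive1 beta u0 * ell u0 != 0) /\
     ~ cuspidal_edge 3 2 r (u0, v) /\ ~ cuspidal_edge 5 2 r (u0, v) /\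
     ~ cuspidal_edge 4 3 r (u0, v)).
Proof.
move=> oI _ leg Iu x0 lam0 r ell beta.
have [[sx sz sa sb] [sel sbe nf]] := smg_frame R I x z a b u0 oI Iu leg.
rewrite -/ell -/beta in sel sbe nf.
pose X t := x (u0 + t); pose ze t := (z (u0 + t) - z u0) / lam.
pose a' t := a (u0 + t); pose b' t := b (u0 + t).
pose be t := beta (u0 + t); pose el t := ell (u0 + t).
have sX : smg R 0 X by exact: smg_shift.
have sze : smg R 0 ze.
  by apply: smgM; [apply: smgB; [exact: smg_shift|exact: smg_cst]|exact: smg_cst].
have sa' : smg R 0 a' by exact: smg_shift.
have sb' : smg R 0 b' by exact: smg_shift.
have sbe' : smg R 0 be by exact: smg_shift.
have sel' : smg R 0 el by exact: smg_shift.
have X0 : X 0 = 0 by rewrite /X addr0.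
have ze0 : ze 0 = 0 by rewrite /ze addr0 subrr mul0r.
have b0E : b' 0 = b u0 by rewrite /b' addr0.
have be0E : be 0 = beta u0 by rewrite /be addr0.
have el0E : el 0 = ell u0 by rewrite /el addr0.
have be1E : derive1 be 0 = derive1 beta u0.
  by rewrite (nbhs_singleton (derive1_shift R u0 beta sbe)) addr0.
have el1E : derive1 el 0 = derive1 ell u0.
  by rewrite (nbhs_singleton (derive1_shift R u0 ell sel)) addr0.
have frame : \forall t \near (0 : R), [/\ a' t ^+ 2 + b' t ^+ 2 = 1,
    derive1 X t = - be t * b' t, derive1 ze t = be t * a' t / lam,
    derive1 a' t = - el t * b' t & derive1 b' t = el t * a' t].
  have n0 := near_shift_at R u0 _ nf.
  have n1 := derive1_shift R u0 x sx.
  have n2 : \forall t \near (0 : R), derive1 ze t = derive1 z (u0 + t) / lam.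
    apply: filterS2 (derive1_shift R u0 z sz) (smg_near R _ _ (smg_shift R u0 z sz)) => t <- st.
    have D := is_deriveB (smg_is_derive R _ _ st) (is_derive_cst (z u0) (t : R) (1 : R)).
    have zeE : ze = (lam^-1 *: ((fun t => z (u0 + t)) - cst (z u0)))%R.
      by apply/funext => s; rewrite /ze mulrC.
    by rewrite zeE (derive1_of R _ _ _ (is_deriveZ lam^-1 D)) subr0 /GRing.scale /= mulrC.
  have n3 := derive1_shift R u0 a sa; have n4 := derive1_shift R u0 b sb.
  have n34 : \forall t \near (0 : R), derive1 a' t = derive1 a (u0 + t) /\
    derive1 b' t = derive1 b (u0 + t) by exact: filterI.
  have n12 : \forall t \near (0 : R), derive1 X t = derive1 x (u0 + t) /\
    derive1 ze t = derive1 z (u0 + t) / lam by exact: filterI.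
  by apply: filterS3 n0 n12 n34 => t [e1 e2 e3 e4 e5] [-> ->] [-> ->]; rewrite e2 e3 e4 e5.
pose c1 t := X t * cos (ze t); pose c2 t := - (X t * sin (ze t)).
have sufficient i j v : (0 < i)%N -> (0 < j)%N -> planar_cusp R i j (fun t => (c1 t, c2 t)) ->
    cuspidal_edge j i r (u0, v).
  by move=> i0 j0; exact: (profile_A_equiv R x z u0 lam sz x0 lam0 i j v i0 j0).
have necessary i j v : (1 < i)%N -> (1 < j)%N -> ordO R 2 c1 -> ordO R 2 c2 ->
    cuspidal_edge j i r (u0, v) -> cusp_jets R i j c1 c2.
  by move=> i1 j1; exact: (A_equiv_profile R x z u0 lam v sx sz x0 lam0 i j i1 j1).
rewrite -be0E -b0E -be1E -el0E -el1E.
split; [|split].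
- move=> be0 b0 v.
  have [be1|be1] := eqVneq (derive1 be 0) 0.
    have [g [h [sg sh c1E c2E]]] := profile_I_flat R X ze a' b' be el lam sX sze sa' sb' sbe'
      X0 ze0 frame be0 be1.
    have o1 := ordO_mono R 3 _ _ sg c1E; have o2 := ordO_mono R 6 _ _ sh c2E.
    have o12 : ordO R 2 c1 by exact: ordO_le o1.
    have o22 : ordO R 2 c2 by exact: ordO_le o2.
    have o32 : ordO R 3 c2 by exact: ordO_le o2.
    have o42 : ordO R 4 c2 by exact: ordO_le o2.
    have no3 j v' : (j == 4)%N || (j == 5)%N -> ~ cuspidal_edge j 3 r (u0, v').
      move=> j45 H; have {}H : cusp_jets R 3 j c1 c2.
        by apply: (necessary 3%N j v') => //; case/orP: j45 => /eqP ->.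
      (* Either the curve has order at least four, which excludes [q^3], or [c1] has order exactly 3
         and [j] lies strictly between 3 and 6. *)
      have [g0|g0] := eqVneq (g 0) 0.
        by apply: (no_cusp_small R c1 c2 3 j H) => //; exact: ordO_vanishing sg g0 c1E.
      apply: (no_cusp_high R c1 c2 3 j H 3 6 g) => //.
      by case/orP: j45 => /eqP ->.
    rewrite be1 mul0r eqxx; split; [split => // H|split; [|split]].
    + by have := no_cusp_small R c1 c2 2 5 (necessary 2%N 5%N _ isT isT o12 o22 H) isT o1 o32.
    + by move=> H; apply: (no_cusp_small R c1 c2 2 3 (necessary 2%N 3%N _ isT isT o12 o22 H)).
    + exact: no3.
    + exact: no3.
  have [m [g [h [k [[sg sh sk] [c1E c2E kE g0 k0]]]]]] := profile_I_regular R X ze a' b' be el lam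
    sX sze sa' sb' sbe' X0 ze0 lam0 frame be0 b0 be1.
  have o1 := ordO_mono R 2 _ _ sg c1E; have o2 := ordO_mono R 4 _ _ sh c2E.
  have o22 : ordO R 2 c2 by exact: ordO_le o2.
  split; [split => [H|e0]|split; [|split]].
  (* If [ell] vanishes, the profile agrees with a parabola up to order six, which is incompatible
     with [q^5]. *)
  + rewrite mulf_neq0 //; apply/eqP => el0.
    have k00 : k 0 = 0 by rewrite k0 el0 mulr0 mul0r oppr0.
    apply: (no_cusp_parabola R c1 c2 2 5 (necessary 2%N 5%N _ isT isT o1 o22 H) g (- m)) => //.
    have := ordO_vanishing R 5 (fun t => c2 t + m * c1 t ^+ 2) k sk k00 kE.
    by apply: eq_ordO => t; ring.
  + apply: sufficient => //.
    (* The shear along this parabola turns the profile into [(t^2 g, t^5 k)], with [k 0] nonzero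
       exactly because [ell] is. *)
    have sA : smg R 0 (fun s : R => - m * s ^+ 2).
      by apply: smgM; [exact: smg_cst|apply: smgX; exact: smg_id].
    have A0 : - m * 0 ^+ 2 = 0 :> R by rewrite expr0n mulr0.
    apply: (planar_cusp_left R _ _ _ _ _ (shear_diffeo R _ _ sA (smg_cst R 0 1) A0 (oner_neq0 R))).
    apply: (planar_cusp2 R 2 _ g k sg sk g0).
      move: e0; rewrite mulf_eq0 negb_or => /andP[_ el0].
      by rewrite k0 oppr_eq0 !mulf_neq0 ?invr_eq0 ?mulf_neq0 ?pnatr_eq0 // expf_neq0.
    near=> t; have e1 : c1 t = t ^+ 2 * g t := c1E t.
    have e2 : c2 t + m * c1 t ^+ 2 = t ^+ 5 * k t := kE t.
    by rewrite /= divr1 -e1 -e2; congr pair; ring.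
  (* In the three remaining exclusions [q^3] occurs, and 3 lies strictly between the order 2 of [c1]
     and the least order 4 of [c1^2] and [c2]. *)
  + move=> H.
    by apply: (no_cusp_high R c1 c2 2 3 (necessary 2%N 3%N _ isT isT o1 o22 H) 2 4 g).
  + move=> H.
    by apply: (no_cusp_high R c1 c2 3 4 (necessary 3%N 4%N _ isT isT o1 o22 H) 2 4 g).
  + move=> H.
    by apply: (no_cusp_high R c1 c2 3 5 (necessary 3%N 5%N _ isT isT o1 o22 H) 2 4 g).
- move=> be0 b0 v; have [el0|el0] := eqVneq (el 0) 0.
    have [g [h [sg sh c1E c2E [deg reg]]]] := profile_II_singular R X ze a' b' be el lam
      sX sze sa' sb' sbe' sel' X0 ze0 lam0 frame b0 be0 el0.
    have o1 := ordO_mono R 3 _ _ sg c1E; have o2 := ordO_mono R 4 _ _ sh c2E.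
    have o12 : ordO R 2 c1 by exact: ordO_le o1.
    have o22 : ordO R 2 c2 by exact: ordO_le o2.
    have o32 : ordO R 3 c2 by exact: ordO_le o2.
    split; [split => // H|split; [split => [H|[_ el1]]|split => H]].
    + by have := no_cusp_small R c1 c2 2 3 (necessary 2%N 3%N _ isT isT o12 o22 H) isT o1 o32.
    + split => //; apply/eqP => el1.
      apply: (no_cusp_small R c1 c2 3 4 (necessary 3%N 4%N _ isT isT o12 o22 H)) => //.
      exact: ordO_vanishing sg (deg el1) c1E.
    + have [g0 h0] := reg el1; apply: sufficient => //.
      by apply: (planar_cusp3 R 1 _ g h) => //; near=> t; rewrite -c1E -c2E.
    + by apply: (no_cusp_small R c1 c2 2 5 (necessary 2%N 5%N _ isT isT o12 o22 H)).
    + have J := necessary 3%N 5%N _ isT isT o12 o22 H.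
      (* If [ell'] vanishes the curve has order at least four, too much for [q^3]; otherwise its
         orders are 3 and 4, and [q^5] loses its linear part. *)
      have [el1|el1] := eqVneq (derive1 el 0) 0.
        apply: (no_cusp_small R c1 c2 3 5 J) => //.
        exact: ordO_vanishing sg (deg el1) c1E.
      have [g0 h0] := reg el1.
      by apply: (no_cusp_mid R c1 c2 3 5 J 3 g h).
  have [g [h [sg sh c1E c2E [g0 h0]]]] := profile_II_regular R X ze a' b' be el lam
    sX sze sa' sb' sbe' X0 ze0 lam0 frame b0 be0 el0.
  have o1 := ordO_mono R 2 _ _ sg c1E; have o2 := ordO_mono R 3 _ _ sh c2E.
  have o22 : ordO R 2 c2 by exact: ordO_le o2.
  split; [split => // _|split; [split => [H|[]]|split => H]].
  + apply: sufficient => //.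
    by apply: (planar_cusp2 R 1 _ g h) => //; near=> t; rewrite -c1E -c2E.
  + by have := no_cusp_low R c1 c2 3 4 (necessary 3%N 4%N _ isT isT o1 o22 H) 2 g sg g0 c1E o2 isT isT isT.
  + by move/eqP; rewrite (negbTE el0).
  + by apply: (no_cusp_mid R c1 c2 2 5 (necessary 2%N 5%N _ isT isT o1 o22 H) 2 g h).
  + by apply: (no_cusp_low R c1 c2 3 5 (necessary 3%N 5%N _ isT isT o1 o22 H) 2 g).
- move=> be0 b0 v.
  have [g [h [sg sh c1E c2E [deg reg]]]] := profile_III R X ze a' b' be el lam
    sX sze sa' sb' sbe' X0 ze0 lam0 frame b0 be0.
  have o1 := ordO_mono R 3 _ _ sg c1E; have o2 := ordO_mono R 5 _ _ sh c2E.
  have o12 : ordO R 2 c1 by exact: ordO_le o1.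
  have o22 : ordO R 2 c2 by exact: ordO_le o2.
  have o32 : ordO R 3 c2 by exact: ordO_le o2.
  have o42 : ordO R 4 c2 by exact: ordO_le o2.
  split; [split => [H|e0]|split; [|split]] => [|| H | H | H].
  + apply/eqP => e0.
    apply: (no_cusp_small R c1 c2 3 5 (necessary 3%N 5%N _ isT isT o12 o22 H)) => //.
    exact: ordO_vanishing sg (deg e0) c1E.
  + have [g0 h0] := reg e0; apply: sufficient => //.
    by apply: (planar_cusp3 R 2 _ g h) => //; near=> t; rewrite -c1E -c2E.
  + by apply: (no_cusp_small R c1 c2 2 3 (necessary 2%N 3%N _ isT isT o12 o22 H)).
  + by apply: (no_cusp_small R c1 c2 2 5 (necessary 2%N 5%N _ isT isT o12 o22 H)).
  + have J := necessary 3%N 4%N _ isT isT o12 o22 H.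
    (* If [c1] has order exactly 3, the exponent 4 lies strictly between it and the order bound 5 of
       [c2]. *)
    have [g0|g0] := eqVneq (g 0) 0.
      by apply: (no_cusp_small R c1 c2 3 4 J) => //; exact: ordO_vanishing sg g0 c1E.
    by apply: (no_cusp_high R c1 c2 3 4 J 3 5 g).
Unshelve. all: by end_near. Qed.
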